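(* Let $p$ be a probability distribution on $\mathbb{R}^d$ with continuously differentiable density, let $T>0$ and $\alpha:=e^{-T}\in(0,1)$. Let $X_0\sim p$ and, conditionally on $X_0$, let $X_T\sim\mathcal N(\sqrt{\alpha}\,X_0,(1-\alpha)I_d)$. Let $P$ be the Markov kernel on $\mathbb{R}^d$ obtained from the current state $X_0$ by drawing $X_T$ given $X_0$ and then drawing the next state from the conditional law of $X_0$ given $X_T$. Suppose that $p$ satisfies the Poincaré inequality with constant $C_{\mathrm P}$: $$\operatorname{Var}_p(f)\le C_{\mathrm P}\int\|\nabla f(x)\|^2\,p(dx)\qquad\text{for all smooth } f.$$ Then $$\rho_{\max}(X_0,X_T)^2\le\frac{\alpha C_{\mathrm P}}{1-\alpha+\alpha C_{\mathrm P}}\qquad\text{and hence}\qquad \mathrm{Gap}(P)\ge\frac{1-\alpha}{1-\alpha+\alpha C_{\mathrm P}}.$$ Both bounds are tight for Gaussian targets: if $p=\mathcal N(\mu,\Sigma)$, then its (optimal) Poincaré constant is $C_{\mathrm P}=\lambda_{\max}(\Sigma)$, the largest eigenvalue of $\Sigma$, and $$\rho_{\max}(X_0,X_T)^2=\frac{\alpha\lambda_{\max}(\Sigma)}{1-\alpha+\alpha\lambda_{\max}(\Sigma)},\qquad \mathrm{Gap}(P)=\frac{1-\alpha}{1-\alpha+\alpha\lambda_{\max}(\Sigma)}.$$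
   Context: Let $p_0=p$ and $p_T$ denote the laws of $X_0$ and $X_T$. The maximal correlation is $$\rho_{\max}(X_0,X_T)^2=\sup_{f\in L^2(p_0),\,g\in L^2(p_T),\ f,g\text{ non-constant}}\mathrm{Corr}\big(f(X_0),g(X_T)\big)^2 ,$$ computed under the joint law of $(X_0,X_T)$. With $(Pf)(x)=\int f(y)P(x,dy)$, the spectral gap is $$\mathrm{Gap}(P)=1-\sup_{f\in L^2(p_0),\ \mathbb E_{p_0}[f]=0,\ f\ne0}\frac{\langle f,Pf\rangle_{L^2(p_0)}}{\|f\|^2_{L^2(p_0)}} .$$ The conditional law of $X_T$ given $X_0$ is the time-$T$ transition of the Ornstein–Uhlenbeck process $dX_t=-\tfrac12X_t\,dt+dB_t$, and the conditional law of $X_0$ given $X_T$ is the transition of its time reversal started from $X_0\sim p$. *)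

(* Defs.v *)
From HB Require Import structures.
From mathcomp Require Import all_boot all_order all_algebra.
From mathcomp Require Import all_classical all_reals all_analysis.
From mathcomp Require Import measurable_realfun.

Set Implicit Arguments.
Unset Strict Implicit.
Unset Printing Implicit Defensive.
Import Order.TTheory GRing.Theory Num.Theory.
Import numFieldNormedType.Exports.
Local Open Scope classical_set_scope.
Local Open Scope ring_scope.

Definition rV_display : measure_display.
Proof. exact: default_measure_display. Qed.

(* The sigma-algebra on R^d generated by the coordinates, as the library does
   for tuples; it is the Borel sigma-algebra, see measurable_rVE below. *)
Section measurable_rV.
Context {R : realType} {d : nat}.

Definition rV_coord (i : 'I_d) (x : 'rV[R]_d) : R := x ord0 i.

Let rV_set0 : g_sigma_preimage rV_coord set0.
Proof. exact: sigma_algebra0. Qed.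

Let rV_setC A : g_sigma_preimage rV_coord A -> g_sigma_preimage rV_coord (~` A).
Proof. exact: sigma_algebraC. Qed.

Let rV_bigcup (F : _^nat) : (forall i, g_sigma_preimage rV_coord (F i)) ->
  g_sigma_preimage rV_coord (\bigcup_i (F i)).
Proof. exact: sigma_algebra_bigcup. Qed.

HB.instance Definition _ := @isMeasurable.Build rV_display 'rV[R]_d
  (g_sigma_preimage rV_coord) rV_set0 rV_setC rV_bigcup.

End measurable_rV.

Section lebesgue_rV.
Context {R : realType}.

Lemma measurable_rV_coord d (i : 'I_d) :
  measurable_fun [set: 'rV[R]_d] (fun x : 'rV[R]_d => x ord0 i : R).
Proof.
move=> _ Y mY; rewrite setTI; apply: sub_sigma_algebra => /=.
rewrite -bigcup_seq/=; exists i => /=; first by rewrite mem_index_enum.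
by exists Y => //; rewrite setTI.
Qed.

Lemma measurable_fun_rV disp (T : measurableType disp) d (f : T -> 'rV[R]_d) :
  (forall i, measurable_fun [set: T] (fun t => f t ord0 i : R)) ->
  measurable_fun [set: T] f.
Proof.
move=> mf.
have sub : g_sigma_preimage (@rV_coord R d) `<=`
    image_set_system setT f measurable.
  apply: smallest_sub; first exact/sigma_algebra_image/sigma_algebra_measurable.
  rewrite -bigcup_seq => A [i _ [B mB <-]].
  rewrite /image_set_system /= !setTI.
  by have := mf i measurableT B mB; rewrite setTI.
by move=> _ A mA; exact: sub.
Qed.

Definition rV_cons d (u : R * 'rV[R]_d) : 'rV[R]_d.+1 :=
  row_mx (u.1)%:M u.2 : 'rV[R]_(1 + d).

Definition rV_uncons d (x : 'rV[R]_d.+1) : R * 'rV[R]_d :=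
  (x ord0 ord0, rsubmx (x : 'rV[R]_(1 + d))).

Lemma rV_consK d : cancel (@rV_cons d) (@rV_uncons d).
Proof.
move=> [a v]; rewrite /rV_uncons /rV_cons row_mxKr; congr pair.
have -> : ord0 = lshift d ord0 :> 'I_(1 + d) by exact: val_inj.
by rewrite (@row_mxEl _ 1 1 d) !mxE.
Qed.

Lemma measurable_rV_cons d : measurable_fun setT (@rV_cons d).
Proof.
apply: measurable_fun_rV => i; rewrite /rV_cons.
have [j|j] := splitP (i : 'I_(1 + d)) => ij.
  have -> : i = lshift d j by exact: val_inj.
  apply: (eq_measurable_fun fst) => [u _|]; last exact: measurable_fst.
  by rewrite (@row_mxEl _ 1 1 d) !mxE !ord1.
have -> : i = rshift 1 j by exact: val_inj.
apply: (eq_measurable_fun (rV_coord j \o snd)) => [u _|].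
  by rewrite (@row_mxEr _ 1 1 d).
by apply: measurableT_comp; [exact: measurable_rV_coord|exact: measurable_snd].
Qed.

Lemma measurable_rV_uncons d : measurable_fun setT (@rV_uncons d).
Proof.
apply/measurable_fun_pairP; split; first exact: measurable_rV_coord.
apply: measurable_fun_rV => i.
apply: (eq_measurable_fun (rV_coord (rshift 1 i))) => [x _|].
  by rewrite /= mxE.
exact: measurable_rV_coord.
Qed.

Section lebesgue_step.
Variables (d : nat) (m : {sigma_finite_measure set 'rV[R]_d -> \bar R}).

Definition lebesgue_step : set 'rV[R]_d.+1 -> \bar R :=
  pushforward (@lebesgue_measure R \x m)%E (@rV_cons d).

Let mcons (A : set 'rV[R]_d.+1) :
  measurable A -> measurable (@rV_cons d @^-1` A).
Proof.
by move=> mA; rewrite -[X in measurable X]setTI; exact: measurable_rV_cons.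
Qed.

Let step0 : lebesgue_step set0 = 0%E.
Proof. by rewrite /lebesgue_step /pushforward preimage_set0 measure0. Qed.

Let step_ge0 A : (0 <= lebesgue_step A)%E.
Proof. by rewrite /lebesgue_step /pushforward; exact: measure_ge0. Qed.

Let step_sigma_additive : semi_sigma_additive lebesgue_step.
Proof.
move=> F mF tF mUF; rewrite /lebesgue_step /pushforward preimage_bigcup.
apply: measure_semi_sigma_additive.
- by move=> n; exact: mcons.
- apply/trivIsetP => /= i j _ _ ij; rewrite -preimage_setI.
  by move/trivIsetP : tF => /(_ _ _ _ _ ij) ->//; rewrite preimage_set0.
- by rewrite -preimage_bigcup; exact: mcons.
Qed.

HB.instance Definition _ := isMeasure.Build _ _ _ lebesgue_step
  step0 step_ge0 step_sigma_additive.

Let step_sigma_finite : sigma_finite setT lebesgue_step.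
Proof.
have /sigma_finiteP[F [TF ndF Foo]] := sigma_finiteT (@lebesgue_measure R).
have /sigma_finiteP[G [TG ndG Goo]] := sigma_finiteT m.
exists (fun n => @rV_uncons d @^-1` (F n `*` G n)).
  rewrite -preimage_bigcup; apply/esym; rewrite -subTset => x _ /=.
  have : setT (rV_uncons x).1 by [].
  rewrite TF => -[n _ Fn].
  have : setT (rV_uncons x).2 by [].
  rewrite TG => -[k _ Gk]; exists (maxn n k) => //; split.
  - by move: Fn; exact/subsetPset/ndF/leq_maxl.
  - by move: Gk; exact/subsetPset/ndG/leq_maxr.
move=> n; have [mF Fn] := Foo n; have [mG Gn] := Goo n.
have mFG : measurable (F n `*` G n) by exact: measurableX.
split.
  rewrite -[X in measurable X]setTI.
  by apply: measurable_rV_uncons => //; exact: measurableX.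
rewrite /lebesgue_step /pushforward -comp_preimage.
rewrite (_ : _ \o _ = id); last by apply/funext => u; exact: rV_consK.
rewrite preimage_id (product_measure1E (@lebesgue_measure R) m mF mG).
by rewrite lte_mul_pinfty// ge0_fin_numE.
Qed.

HB.instance Definition _ := Measure_isSigmaFinite.Build _ _ _ lebesgue_step
  step_sigma_finite.

End lebesgue_step.

(* d-dimensional Lebesgue measure, as an iterated product; lebesgue_rV_box below
   gives its value on products of measurable sets. *)
Fixpoint lebesgue_rV d : {sigma_finite_measure set 'rV[R]_d -> \bar R} :=
  match d with
  | 0 => dirac (0 : 'rV[R]_0)
  | d'.+1 => lebesgue_step (lebesgue_rV d')
  end.

End lebesgue_rV.

Lemma open_measurable_rV (R : realType) d (U : set 'rV[R]_d) :
  open U -> measurable U.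
Proof.
move=> oU.
have mball (c : 'rV[R]_d) (r : R) : measurable (ball c r).
  have [r0|r0] := ltP 0 r; last first.
    rewrite (_ : ball c r = set0)//; apply/seteqP; split=> // y [+ _].
    by rewrite ltNge r0.
  have -> : ball c r =
      \bigcap_(i in [set: 'I_d]) (rV_coord i @^-1` ball (c ord0 i) r).
    apply/seteqP; split=> [y [_ yc] i _|y yc]; first exact: yc.
    by split=> // i j; rewrite ord1; exact: yc.
  apply: fin_bigcap_measurable => // i _; rewrite -[X in measurable X]setTI.
  apply: measurable_rV_coord => //.
  by apply: open_measurable; exact: ball_open.
pose B (z : 'rV[rat]_d * rat) : set 'rV[R]_d :=
  let b := ball (map_mx ratr z.1 : 'rV[R]_d) (ratr z.2 : R) in
  if `[< b `<=` U >] then b else set0.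
rewrite (_ : U = \bigcup_z B z).
  apply: countable_bigcupT_measurable => [|z].
    by apply: countableP.
  by rewrite /B; case: ifPn => _; [exact: mball|exact: measurable0].
apply/seteqP; split=> [x Ux|x [z _]]; last first.
  by rewrite /B; case: asboolP => [bU bx|//]; exact: bU.
have : nbhs x U by exact: open_nbhs_nbhs.
rewrite -nbhs_ballE => -[e /= e0 xeU].
have /rat_in_itvoo[r] : 0 < e / 2 by rewrite divr_gt0.
rewrite in_itv/= => /andP[r0 re].
have cex i : exists q : rat, ball (x ord0 i) (ratr r : R) (ratr q).
  have /rat_in_itvoo[q] : x ord0 i - ratr r < x ord0 i + ratr r.
    by rewrite ltrD2l (lt_trans _ r0)// oppr_lt0.
  rewrite in_itv/= => /andP[q1 q2]; exists q.
  by rewrite /ball/= ltr_distlC q1 q2.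
pose c := \row_i sval (cid (cex i)).
have xc : ball (map_mx ratr c : 'rV[R]_d) (ratr r) x.
  apply: ball_sym; split=> // i j; rewrite ord1 !mxE.
  exact: (svalP (cid (cex j))).
exists (c, r) => //; rewrite /B; case: asboolP => //= -[].
move=> y cy; apply: xeU; apply: (@le_ball _ _ _ (ratr r + ratr r)).
  by rewrite [leRHS]splitr lerD// ltW.
exact: ball_triangle (ball_sym xc) cy.
Qed.

Lemma measurable_rVE (R : realType) d :
  @measurable _ 'rV[R]_d = <<s [set U | open U] >>.
Proof.
apply/seteqP; split; last first.
  apply: smallest_sub; first exact: sigma_algebra_measurable.
  by move=> U; exact: open_measurable_rV.
apply: smallest_sub; first exact: smallest_sigma_algebra.
rewrite -bigcup_seq => A [i _ [B mB <-]]; rewrite setTI.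
have : (@RGenOpens.G R).-sigma.-measurable B by rewrite -RGenOpens.measurableE.
move: B {mB} => B mB.
have sub : <<s @RGenOpens.G R >> `<=`
    image_set_system setT (@rV_coord R d i) <<s [set U | open U] >>.
  apply: smallest_sub.
    by apply: sigma_algebra_image; exact: smallest_sigma_algebra.
  move=> _ [x [y ->]]; rewrite /image_set_system /= setTI.
  apply: sub_sigma_algebra => /=.
  by apply: open_comp; [move=> v _; exact: coord_continuous|exact: itv_open].
by have := sub _ mB; rewrite /image_set_system /= setTI.
Qed.

Lemma lebesgue_rV_box (R : realType) d (A : 'I_d -> set R) :
  (forall i, measurable (A i)) ->
  lebesgue_rV d [set x : 'rV[R]_d | forall i, A i (x ord0 i)] =
  (\prod_(i < d) lebesgue_measure (A i))%E.
Proof.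
elim: d A => [|d IH] A mA.
  by rewrite big_ord0 /= diracE mem_set// => -[].

have mbox n (C : 'I_n -> set R) : (forall i, measurable (C i)) ->
    measurable [set x : 'rV[R]_n | forall i, C i (x ord0 i)].
  move=> mC; rewrite (_ : [set x | _] =
      \bigcap_(i in [set: 'I_n]) (rV_coord i @^-1` C i)).
    apply: fin_bigcap_measurable => // i _; rewrite -[X in measurable X]setTI.
    exact: measurable_rV_coord.
  by apply/seteqP; split=> [x Cx i _|x Cx i]; exact: Cx.
rewrite big_ord_recl -(IH (fun i => A (lift ord0 i)))//=.
pose C := [set x : 'rV[R]_d | forall i, A (lift ord0 i) (x ord0 i)].
have mC : measurable C.
  by apply: (mbox d (fun i => A (lift ord0 i))) => i; exact: mA.
rewrite -(product_measure1E (@lebesgue_measure R) (lebesgue_rV d) (mA ord0) mC).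
rewrite /lebesgue_step /pushforward.
have consE (u : R * 'rV[R]_d) : (rV_cons u) ord0 ord0 = u.1 /\
    forall i, (rV_cons u) ord0 (lift ord0 i) = u.2 ord0 i.
  have uE := rV_consK u; split; first by rewrite -[in RHS]uE.
  by move=> i; rewrite -rshift1 -[in RHS]uE [in RHS]mxE.
congr (product_measure1 _ _ _); apply/seteqP; split=> [u Au|u [A0 Au] i] /=.
  have [u1 u2] := consE u; split=> /=; first by rewrite -u1; exact: Au.
  by move=> i; rewrite -u2; exact: Au.
have [u1 u2] := consE u.
by have [j ->|->] := unliftP ord0 i; [rewrite u2; exact: Au|rewrite u1].
Qed.

Section calculus.
Context {R : realType} {d : nat}.
Implicit Type f : 'rV[R]_d -> R.

Definition partial (i : 'I_d) f : 'rV[R]_d -> R :=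
  fun x => 'D_(delta_mx ord0 i) f x.

(* C^k in the sense of iterated continuous partial derivatives; a function is
   C^1 iff it is differentiable with continuous partial derivatives. *)
Fixpoint Ck (k : nat) f : Prop :=
  if k is k'.+1
  then (forall x, differentiable f x) /\ (forall i, Ck k' (partial i f))
  else continuous f.

Definition smooth f := forall k, Ck k f.

(* Squared Euclidean norm of the gradient (the norm of 'rV[R]_d in the library
   is the sup norm). *)
Definition sqnorm_grad f (x : 'rV[R]_d) : R := \sum_(i < d) partial i f x ^+ 2.

End calculus.

Section laws.
Context {R : realType} {d : nat}.
Implicit Type p : {measure set 'rV[R]_d -> \bar R}.

Definition has_density p (q : 'rV[R]_d -> R) :=
  [/\ measurable_fun setT q, forall x, 0 <= q x &
      forall A, measurable A ->
        p A = (\int[lebesgue_rV d]_(x in A) (q x)%:E)%E].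

Definition gaussian_pdf (mu : 'rV[R]_d) (Sigma : 'M[R]_d) (x : 'rV[R]_d) : R :=
  (Num.sqrt ((2 * pi) ^+ d * \det Sigma))^-1 *
  expR (- ((x - mu) *m invmx Sigma *m (x - mu)^T) ord0 ord0 / 2).

Definition spd (Sigma : 'M[R]_d) :=
  Sigma^T = Sigma /\
  forall v : 'rV[R]_d, v != 0 -> 0 < (v *m Sigma *m v^T) ord0 ord0.

(* N(mu, Sigma) for a positive definite Sigma, the only case in which it has a
   density; for Sigma not invertible gaussian_pdf is meaningless. *)
Definition is_gaussian p (mu : 'rV[R]_d) (Sigma : 'M[R]_d) :=
  spd Sigma /\ has_density p (gaussian_pdf mu Sigma).

(* The set of eigenvalues of a symmetric real matrix of positive size is finite
   and nonempty, so that this sup is its maximum. *)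
Definition lambda_max (Sigma : 'M[R]_d) : R :=
  sup [set a | eigenvalue Sigma a].

End laws.

Section poincare.
Context {R : realType} {d : nat}.
Variable p : probability 'rV[R]_d R.
Local Open Scope ereal_scope.

(* Var_p(f) is defined when f is square-integrable; the energy on the right-hand
   side may be +oo. No sign condition is imposed on C. *)
Definition poincare (C : R) :=
  forall f : 'rV[R]_d -> R, smooth f -> f \in Lfun p 2%:E ->
  'V_p[f] <= C%:E * \int[p]_x (sqnorm_grad f x)%:E.

Definition optimal_poincare (C : R) :=
  poincare C /\ forall C', poincare C' -> (C <= C')%R.

End poincare.

(* k is a version of the conditional law of Y given X. *)
Definition cond_law dO d1 d2 (Omega : measurableType dO)
    (T1 : measurableType d1) (T2 : measurableType d2) (R : realType)
    (Pr : probability Omega R) (X : {RV Pr >-> T1}) (Y : {RV Pr >-> T2})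
    (k : R.-pker T1 ~> T2) :=
  forall A B, measurable A -> measurable B ->
  (Pr (X @^-1` A `&` Y @^-1` B) = \int[distribution Pr X]_(x in A) k x B)%E.

Section maximal_correlation.
Context dO d1 d2 (Omega : measurableType dO)
  (T1 : measurableType d1) (T2 : measurableType d2) (R : realType).
Variable Pr : probability Omega R.

Definition corr (U V : Omega -> R) : R :=
  fine (covariance Pr U V) /
  (Num.sqrt (fine 'V_Pr[U]) * Num.sqrt (fine 'V_Pr[V])).

Definition ae_constant d (T : measurableType d)
    (p : {measure set T -> \bar R}) (f : T -> R) :=
  exists c, {ae p, forall x, f x = c}.

(* Elements of L^2 are classes for a.e. equality, hence non-constant means not
   a.e. constant; correlations are then well-defined. The sup is taken in the
   extended reals, where it needs no boundedness side condition. *)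
Definition rho_max2 (X : {RV Pr >-> T1}) (Y : {RV Pr >-> T2}) : \bar R :=
  ereal_sup [set r | exists (f : T1 -> R) (g : T2 -> R),
    [/\ f \in Lfun (distribution Pr X) 2%:E,
        g \in Lfun (distribution Pr Y) 2%:E,
        ~ ae_constant (distribution Pr X) f,
        ~ ae_constant (distribution Pr Y) g &
        r = (corr (f \o X) (g \o Y) ^+ 2)%:E]].

End maximal_correlation.

Section spectral_gap.
Context dT (T : measurableType dT) (R : realType).
Variables (p : probability T R) (P : T -> {measure set T -> \bar R}).

Definition kernel_op (f : T -> R) (x : T) : R := \int[P x]_y f y.

(* As above, a nonzero element of L^2(p) is a function that is not a.e. 0. *)
Definition spectral_gap : \bar R :=
  (1 - ereal_sup [set r | exists f : T -> R,
    [/\ f \in Lfun p 2%:E, 'E_p[f] = 0, ~ {ae p, forall x, f x = 0%R} &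
        r = ((\int[p]_x (f x * kernel_op f x)) /
             (\int[p]_x (f x ^+ 2)))%:E]])%E.

End spectral_gap.

(* Main.v *)
(* Let s = 1 - alpha, let K x be the law of X_T given X_0 = x, and let Kg(x) be
   the integral of g under K x. The measures K x form an exponential family
   exp(<w(y), x> - b |x|^2 / 2) K_0(dy) with w(y) = sqrt(alpha) y / s and
   b = alpha / s, so the i-th partial derivative of Kg at x is the covariance
   of g and w_i under K x. The w_i have covariance matrix b I, and Bessel's
   inequality gives |grad Kg|^2 <= b Var_{K x}(g). Integrating, and applying the
   Poincare inequality of p to Kg (smooth if g is bounded; the general case
   follows by truncation),
     Var(Kg) <= C b E[Var_{K x}(g)] = C b (Var(g(X_T)) - Var(Kg)),
   i.e. Var(Kg) <= r Var(g(X_T)) with r = bC / (1 + bC)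
   = alpha C / (1 - alpha + alpha C). Since the covariance of f(X_0) and g(X_T)
   is that of f and Kg, Cauchy-Schwarz bounds the squared correlation by r. For
   centered f, <f, Pf> is both the squared norm of Qf(X_T) and the covariance of
   f(X_0) and Qf(X_T), hence <f, Pf> <= r |f|^2.

   If p = N(mu, Sigma), then p is the image of the standard normal law under
   z |-> mu + zA with A^T A = Sigma. The standard normal law satisfies
     E (F(Z) - F(Z'))^2 <= 2 E |grad F(Z)|^2 for independent Z and Z':
   in dimension one, bound (F(x) - F(y))^2 by (x - y) times the integral of F'^2
   over [y, x] and apply Tonelli; in higher dimension, tensorize. Hence p has
   Poincare constant lambda_max(Sigma). The linear function x |-> <v, x>, with v
   an eigenvector of Sigma for lambda_max(Sigma), attains equality in the
   Poincare inequality, and the pair <v, X_0>, <v, X_T> has squared correlation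
   exactly r, which bounds <f, Pf> / |f|^2 from below by Cauchy-Schwarz. *)
Require Import Defs.
From HB Require Import structures.
From mathcomp Require Import all_boot all_order all_algebra.
From mathcomp Require Import all_classical all_reals all_analysis.
From mathcomp Require Import measurable_realfun ring lra.
Set Implicit Arguments.
Unset Strict Implicit.
Unset Printing Implicit Defensive.
Import Order.TTheory GRing.Theory Num.Theory.
Import numFieldNormedType.Exports.
Local Open Scope classical_set_scope.
Local Open Scope ring_scope.

(** * Conditional laws and square-integrable functions *)

(** Four points shape the argument. The predicate [poincare] fixes no sign for its constant, while
    the bounds multiply inequalities by C and divide by 1 + bC; nonnegativity comes from testing
    with exp(-|x|^2), whose energy is strictly positive because p has a density and the dimension is
    positive. A function in L^2 need not be integrable under every K x, so identities for Kg, Qf and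
    Pf are proved for almost every state, and smoothness of Kg is established for bounded g. In the
    one-dimensional inequality no constant is lost because E (X - Y) 1_{Y < s <= X} is exactly the
    normal density at s for independent standard normal X and Y, so that Tonelli returns the normal
    law itself. Finally, Gaussian laws are treated without a multivariate change of variables and
    without evaluating a determinant: the standard normal law is built by the same recursion on
    coordinates as Lebesgue measure, a general Gaussian density is reduced to it by completing the
    square one coordinate at a time, and the normalizing factor is identified by total mass. *)

Section integral_bind.
Context d1 d2 (T1 : measurableType d1) (T2 : measurableType d2) (R : realType).
Variables (mu : {measure set T1 -> \bar R})
  (k : T1 -> {measure set T2 -> \bar R}) (m : {measure set T2 -> \bar R}).
Hypothesis mk : forall U, measurable U -> measurable_fun setT (k ^~ U).
Hypothesis mE : forall U, measurable U -> (m U = \int[mu]_x k x U)%E.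
Local Open Scope ereal_scope.
Import HBNNSimple.

Let bind_nnsfun (f : {nnsfun T2 >-> R}) :
  \int[m]_y (f y)%:E = \int[mu]_x \int[k x]_y (f y)%:E.
Proof.
have intE (l : {measure set T2 -> \bar R}) :
    \int[l]_y (f y)%:E = \sum_(r \in range f) (r%:E * l (f @^-1` [set r])).
  under eq_integral do rewrite fimfunE -fsumEFin//.
  rewrite ge0_integral_fsum//; last 2 first.
    by move=> r; exact/measurable_EFinP/measurableT_comp.
    by move=> r z _; rewrite EFinM nnfun_muleindic_ge0.
  apply: eq_fsbigr => r _.
  rewrite (integralZl_indic _ (fun r => f @^-1` [set r]))//; last first.
    by move=> r0; rewrite preimage_nnfun0.
  by rewrite integral_indic// setIT.
rewrite intE; under [RHS]eq_integral do rewrite intE.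
rewrite ge0_integral_fsum//; last 2 first.
- by move=> r; apply: measurable_funeM; exact: mk.
- move=> n y _; have := mulemu_ge0 (fun n => f @^-1` [set n]).
  by apply; exact: preimage_nnfun0.
apply: eq_fsbigr => r _; have [r0|r0] := leP 0%R r.
  by rewrite ge0_integralZl//; [rewrite mE|exact: mk].
rewrite preimage_nnfun0// measure0 mule0 integral0_eq// => y _.
by rewrite measure0 mule0.
Qed.

Lemma measurable_integral_bind f : (forall y, 0 <= f y) ->
  measurable_fun setT f -> measurable_fun setT (fun x => \int[k x]_y f y).
Proof. by move=> f0 mf; exact: measurable_fun_integral_kernel. Qed.

(** Simple functions, then monotone convergence. Only measurability of x |-> k x U is asked of the
    family, so that probability kernels, scaled point masses and composed kernels are all
    covered. *)
Lemma integral_bind f : (forall y, 0 <= f y) -> measurable_fun setT f ->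
  \int[m]_y f y = \int[mu]_x \int[k x]_y f y.
Proof.
move=> f0 mf; pose f_ := nnsfun_approx measurableT mf.
have intE (l : {measure set T2 -> \bar R}) :
    \int[l]_y f y = lim (\int[l]_y (f_ n y)%:E @[n --> \oo]).
  transitivity (\int[l]_y (lim ((f_ n y)%:E @[n --> \oo]))).
    apply/eq_integral => z _.
    by apply/esym/cvg_lim => //=; exact: cvg_nnsfun_approx.
  rewrite monotone_convergence//; last 3 first.
  - by move=> n; exact/measurable_EFinP.
  - by move=> n z _; rewrite lee_fin.
  - by move=> z _ a b ab; rewrite lee_fin; exact/lefP/nd_nnsfun_approx.
rewrite intE; under [RHS]eq_integral do rewrite intE.
rewrite monotone_convergence//.
- by congr (limn _); apply/funext => n; exact: bind_nnsfun.
- move=> n; apply: measurable_integral_bind; first by move=> y; rewrite lee_fin.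
  exact/measurable_EFinP.
- by move=> n x _; apply: integral_ge0 => y _; rewrite lee_fin.
- move=> x _ a b ab; apply: ge0_le_integral => //.
  + by move=> z _; rewrite lee_fin.
  + exact/measurable_EFinP.
  + exact/measurable_EFinP.
  + by move=> z _; rewrite lee_fin; exact/lefP/nd_nnsfun_approx.
Qed.

End integral_bind.

Section integral_density.
Context d (T : measurableType d) (R : realType).
Variables (nu m : {measure set T -> \bar R}) (q : T -> R).
Hypothesis mq : measurable_fun setT q.
Hypothesis q0 : forall x, 0 <= q x.
Hypothesis mE : forall A, measurable A -> (m A = \int[nu]_(x in A) (q x)%:E)%E.
Local Open Scope ereal_scope.

(** A density disintegrates m into the point masses q x * delta_x, which makes this an instance of
    [integral_bind]. *)
Lemma integral_density f : (forall x, 0 <= f x) -> measurable_fun setT f ->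
  \int[m]_x f x = \int[nu]_x ((q x)%:E * f x).
Proof.
move=> f0 mf; pose k x : {measure set T -> \bar R} := mscale (NngNum (q0 x)) (@dirac _ T x R).
have kE x U : k x U = (q x * \1_U x)%:E by rewrite EFinM.
rewrite (@integral_bind _ _ _ _ _ nu k)//.
- apply: eq_integral => x _.
  by rewrite ge0_integral_mscale// integral_dirac// diracT mul1e.
- move=> U mU; rewrite (_ : k ^~ U = fun x => (q x * \1_U x)%:E); last exact/funext.
  by apply/measurable_EFinP/measurable_funM => //; exact: measurable_indic.
- move=> U mU; rewrite mE// integral_mkcond; apply: eq_integral => x _.
  by rewrite kE patchE indicE; case: ifPn; rewrite ?mulr1 ?mulr0.
Qed.

End integral_density.

Section square_integrable.
Context d (T : measurableType d) (R : realType) (P : probability T R).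
Implicit Types f g : T -> R.

Lemma Lfun2P f : f \in Lfun P 2%:E <->
  measurable_fun setT f /\ (\int[P]_x (f x ^+ 2)%:E < +oo)%E.
Proof.
split=> [f2|[mf foo]].
  split; first by move: f2; rewrite inE => /andP[+ _]; rewrite inE.
  have /integrableP[_] := Lfun2_integrable_sqr f2.
  by under eq_integral do rewrite /= ger0_norm ?sqr_ge0//.
rewrite inE; apply/andP; split; rewrite inE//= /finite_norm unlock /Lnorm.
rewrite poweR_lty//.
under eq_integral do rewrite /= powR_mulrn// real_normK ?num_real//.
by [].
Qed.

Lemma Lfun2_measurable f : f \in Lfun P 2%:E -> measurable_fun setT f.
Proof. by case/Lfun2P. Qed.

Lemma Lfun2_Lfun1 f : f \in Lfun P 2%:E -> f \in Lfun P 1.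
Proof. by apply: Lfun_subset12; exact: fin_num_measure. Qed.

Lemma Lfun2_integrable f : f \in Lfun P 2%:E -> P.-integrable setT (EFin \o f).
Proof. by move=> /Lfun2_Lfun1 /Lfun1_integrable. Qed.

Lemma Lfun2_integrableM f g : f \in Lfun P 2%:E -> g \in Lfun P 2%:E ->
  P.-integrable setT (EFin \o (fun x => f x * g x)).
Proof. by move=> f2 g2; apply/Lfun1_integrable; exact: Lfun2_mul_Lfun1. Qed.

Lemma Lfun2_bounded f (M : R) : measurable_fun setT f ->
  (forall x, `|f x| <= M) -> f \in Lfun P 2%:E.
Proof.
move=> mf fM; apply/Lfun2P; split=> //.
apply: (@le_lt_trans _ _ (\int[P]_x (M ^+ 2)%:E)%E).
  apply: ge0_le_integral => //.
  - by move=> x _; rewrite lee_fin sqr_ge0.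
  - exact/measurable_EFinP/measurable_funX.
  - move=> x _; rewrite lee_fin -[f x ^+ 2]real_normK ?num_real//.
    by rewrite lerXn2r ?nnegrE// (le_trans _ (fM x)).
by rewrite integral_cst// ltey_eq fin_numM// fin_num_measure.
Qed.

(** Covariance as a real number: total, hence open to ring reasoning, and equal to
    [covariance P f g] when both functions are square-integrable. *)
Definition rcov f g : R :=
  \int[P]_x (f x * g x) - (\int[P]_x f x) * (\int[P]_x g x).

Lemma rcovC f g : rcov f g = rcov g f.
Proof.
by rewrite /rcov mulrC; congr (_ - _); apply: eq_Rintegral => x _; rewrite mulrC.
Qed.

Lemma covariance_rcov f g : f \in Lfun P 2%:E -> g \in Lfun P 2%:E ->
  covariance P f g = (rcov f g)%:E.
Proof.
move=> f2 g2; have f1 := Lfun2_Lfun1 f2; have g1 := Lfun2_Lfun1 g2.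
have fg1 := Lfun2_mul_Lfun1 f2 g2.
rewrite covarianceE// unlock /rcov EFinB EFinM !fineK//.
- exact/integrable_fin_num/Lfun1_integrable.
- exact/integrable_fin_num/Lfun1_integrable.
- exact/integrable_fin_num/Lfun1_integrable.
Qed.

Lemma variance_rcov f : f \in Lfun P 2%:E -> ('V_P[f])%E = (rcov f f)%:E.
Proof. by move=> f2; rewrite /variance covariance_rcov. Qed.

Lemma rcov_ge0 f : f \in Lfun P 2%:E -> 0 <= rcov f f.
Proof. by move=> f2; rewrite -lee_fin -variance_rcov// variance_ge0. Qed.

(** Applying [covariance_le] to f and to -f bounds the absolute value of the covariance. *)
Lemma rcov_sqr_le f g : f \in Lfun P 2%:E -> g \in Lfun P 2%:E ->
  rcov f g ^+ 2 <= rcov f f * rcov g g.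
Proof.
move=> f2 g2; have le h : h \in Lfun P 2%:E ->
    rcov h g <= Num.sqrt (rcov h h) * Num.sqrt (rcov g g).
  move=> h2; have := covariance_le h2 g2.
  by rewrite covariance_rcov// !variance_rcov//= -EFinM lee_fin.
have Nf2 : (\- f) \in Lfun P 2%:E by rewrite rpredN.
have Ncov h : h \in Lfun P 2%:E -> rcov (\- f) h = - rcov f h.
  move=> h2; apply: EFin_inj; rewrite EFinN -!covariance_rcov// covarianceNl//.
  - exact: Lfun2_Lfun1.
  - exact: Lfun2_Lfun1.
  - exact: Lfun2_mul_Lfun1.
have := le _ Nf2; rewrite !Ncov// (rcovC f (\- f)) Ncov// opprK => le1.
have le2 := le _ f2.
rewrite -[X in _ <= X]sqr_sqrtr ?mulr_ge0 ?rcov_ge0// sqrtrM ?rcov_ge0//.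
rewrite -[X in X <= _]real_normK ?num_real//.
rewrite lerXn2r ?nnegrE ?mulr_ge0 ?sqrtr_ge0//.
by rewrite ler_norml lerNl le1 le2.
Qed.

(** If the right side is finite, this is nonnegativity of the variance; otherwise the right side is
    +oo. *)
Lemma sqr_Rintegral_le f : measurable_fun setT f ->
  (((\int[P]_x f x) ^+ 2)%:E <= \int[P]_x (f x ^+ 2)%:E)%E.
Proof.
move=> mf; have [foo|] := ltP (\int[P]_x (f x ^+ 2)%:E)%E +oo%E; last first.
  by rewrite leye_eq => /eqP ->; rewrite leey.
have f2 : f \in Lfun P 2%:E by apply/Lfun2P.
have := rcov_ge0 f2; rewrite subr_ge0 -expr2.
rewrite -lee_fin fineK//; apply/integrable_fin_num => //.
exact: Lfun2_integrableM.
Qed.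

End square_integrable.

Section bind_measure.
Context d1 d2 (T1 : measurableType d1) (T2 : measurableType d2) (R : realType).
Variables (mu : {measure set T1 -> \bar R}) (k : T1 -> {measure set T2 -> \bar R}).
Hypothesis mk : forall U, measurable U -> measurable_fun setT (k ^~ U).
Local Open Scope ereal_scope.

(** The proof of measurability is an argument so that the measure structure can be attached to the
    term. *)
Definition bind_measure of
    (forall U, measurable U -> measurable_fun setT (k ^~ U)) :=
  fun U : set T2 => \int[mu]_x k x U.

Let bind0 : bind_measure mk set0 = 0.
Proof. by apply: integral0_eq => y _; rewrite measure0. Qed.

Let bind_ge0 U : 0 <= bind_measure mk U.
Proof. exact: integral_ge0. Qed.

Let bind_sigma_additive : semi_sigma_additive (bind_measure mk).
Proof.
move=> U mU tU mUU; rewrite [X in _ --> X](_ : _ =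
  \int[mu]_x (\sum_(n <oo) k x (U n))); last first.
  apply: eq_integral => V _.
  by apply/esym/cvg_lim => //; exact/measure_semi_sigma_additive.
apply/cvg_closeP; split.
  by apply: is_cvg_nneseries => n _ _; exact: integral_ge0.
by rewrite closeE// integral_nneseries// => n; exact: mk.
Qed.

HB.instance Definition _ := isMeasure.Build _ _ R
  (bind_measure mk) bind0 bind_ge0 bind_sigma_additive.

End bind_measure.

Section integrable_bind.
Context d1 d2 (T1 : measurableType d1) (T2 : measurableType d2) (R : realType).
Variables (mu : {measure set T1 -> \bar R})
  (k : T1 -> {measure set T2 -> \bar R}) (m : {measure set T2 -> \bar R}).
Hypothesis mk : forall U, measurable U -> measurable_fun setT (k ^~ U).
Hypothesis mE : forall U, measurable U -> (m U = \int[mu]_x k x U)%E.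
Local Open Scope ereal_scope.
Variable h : T2 -> R.
Hypothesis ih : m.-integrable setT (EFin \o h).

Let mh : measurable_fun setT (EFin \o h) := measurable_int _ ih.

(** Disintegrating the finite integral of |h| shows that its inner integral is finite almost
    everywhere. *)
Lemma ae_integrable_bind :
  {ae mu, forall x, (k x).-integrable setT (EFin \o h)}.
Proof.
have foo : \int[mu]_x \int[k x]_y `|(h y)%:E| < +oo.
  have /integrableP[_] := ih; rewrite (integral_bind mk mE)//.
  exact: measurableT_comp.
have ifin : mu.-integrable setT (fun x => \int[k x]_y `|(h y)%:E|).
  apply/integrableP; split.
    by apply: measurable_integral_bind => //; exact: measurableT_comp.
  by under eq_integral do rewrite gee0_abs ?integral_ge0//.
apply: filterS (integrable_ae measurableT ifin) => x /(_ I) xfin.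
by apply/integrableP; split=> //; rewrite ltey_eq xfin.
Qed.

Lemma integrable_bind : mu.-integrable setT (fun x => \int[k x]_y (h y)%:E) /\
  \int[m]_y (h y)%:E = \int[mu]_x \int[k x]_y (h y)%:E.
Proof.
have ipos := integrable_funepos measurableT ih.
have ineg := integrable_funeneg measurableT ih.
have bind_fin (f : T2 -> \bar R) : (forall y, 0 <= f y) ->
    m.-integrable setT f -> mu.-integrable setT (fun x => \int[k x]_y f y).
  move=> f0 iff; have mf := measurable_int _ iff; apply/integrableP; split.
    exact: measurable_integral_bind.
  under eq_integral do rewrite gee0_abs ?integral_ge0//.
  rewrite -(integral_bind mk mE)//; have /integrableP[_] := iff.
  by under eq_integral do rewrite gee0_abs//.
have Ipos := bind_fin _ (funepos_ge0 _) ipos.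
have Ineg := bind_fin _ (funeneg_ge0 _) ineg.
have splitE : (fun x => \int[k x]_y (h y)%:E) =
    (fun x => \int[k x]_y (EFin \o h)^\+ y - \int[k x]_y (EFin \o h)^\- y).
  by apply/funext => x; rewrite integralE.
split; first by rewrite splitE; exact: integrableB.
rewrite splitE integralB// [LHS]integralE.
by rewrite !(integral_bind mk mE)//; exact: measurable_int ineg || exact: measurable_int ipos.
Qed.

(** The real-valued inner integral can differ from the extended one only on the null set where h is
    not integrable, where [fine] may return a default value; equality almost everywhere carries over
    integrability and value. *)
Lemma Rintegral_bind :
  mu.-integrable setT (EFin \o (fun x => \int[k x]_y h y)%R) /\
  (\int[m]_y h y = \int[mu]_x \int[k x]_y h y)%R.
Proof.
have [ibind bindE] := integrable_bind.
have fineE : ae_eq mu setT (EFin \o (fun x => \int[k x]_y h y)%R)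
    (fun x => \int[k x]_y (h y)%:E).
  apply: filterS ae_integrable_bind => x ix _ /=.
  by rewrite fineK//; exact: integrable_fin_num.
have mbind := measurable_int _ ibind.
have mfine : measurable_fun setT (EFin \o (fun x => \int[k x]_y h y)%R).
  by apply/measurable_EFinP; exact: measurableT_comp.
split; last by rewrite /Rintegral bindE; congr fine; apply/esym/ae_eq_integral.
apply/integrableP; split=> //; have /integrableP[_] := ibind.
congr (_ < _); apply: ae_eq_integral => //; try exact: measurableT_comp.
by apply: filterS fineE => x /(_ I) /= xE _; rewrite -xE.
Qed.

End integrable_bind.

(** A name for the pushforward together with its measure structure, which depends on the proof of
    measurability. *)
Definition image_measure d1 d2 (T1 : measurableType d1) (T2 : measurableType d2)
    (R : realType) (m : {measure set T1 -> \bar R}) (f : T1 -> T2)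
    (mf : measurable_fun setT f) : {measure set T2 -> \bar R} :=
  measure_function_pushforward__canonical__measure_function_Measure m mf.

Section cond_law_theory.
Context dO d1 d2 (Omega : measurableType dO) (T1 : measurableType d1)
  (T2 : measurableType d2) (R : realType) (Pr : probability Omega R).
Variables (X : {RV Pr >-> T1}) (Y : {RV Pr >-> T2}) (k : R.-pker T1 ~> T2).
Hypothesis XYk : cond_law X Y k.
Local Open Scope ereal_scope.

Let pairXY w := (X w, Y w).

Let mpair : measurable_fun setT pairXY.
Proof. by apply/measurable_fun_pairP; split; exact: measurable_funPT. Qed.

Let joint : {measure set (T1 * T2) -> \bar R} := image_measure Pr mpair.

Let kpair x : {measure set (T1 * T2) -> \bar R} :=
  image_measure (k x) (pair1_measurable x).

Let kpairE x U : kpair x U = k x (xsection U x).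
Proof. by rewrite xsectionE. Qed.

Let mkpair U : measurable U -> measurable_fun setT (kpair ^~ U).
Proof.
move=> mU; rewrite (_ : kpair ^~ U = fun x => k x (xsection U x)).
  by apply: measurable_fun_xsection_finite_kernel; rewrite inE.
by apply/funext => x; exact: kpairE.
Qed.

(** [cond_law] determines the joint law on rectangles only. These form a pi-system generating the
    product sigma-algebra, and Pr is finite, so the two measures agree. *)
Let jointE U : measurable U ->
  joint U = \int[distribution Pr X]_x kpair x U.
Proof.
move=> mU; pose C : set (set (T1 * T2)) :=
  [set A `*` B | A in measurable & B in measurable].
apply: (measure_unique C (fun=> setT) _ _ _ _ joint
  (bind_measure (distribution Pr X) mkpair)) => //.
- exact: measurable_prod_measurableType.
- move=> _ _ [A1 mA1 [A2 mA2 <-]] [B1 mB1 [B2 mB2 <-]].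
  exists (A1 `&` B1); first exact: measurableI.
  by exists (A2 `&` B2); [exact: measurableI|rewrite setXI].
- by move=> _; exists setT => //; exists setT => //; rewrite setXTT.
- by rewrite bigcup_const.
- move=> _ [A mA [B mB <-]].
  transitivity (\int[distribution Pr X]_(x in A) k x B); first exact: XYk.
  rewrite integral_mkcond; apply: eq_integral => x _; rewrite kpairE patchE.
  by case: ifPn => xA; [rewrite in_xsectionX|rewrite notin_xsectionX ?measure0].
- have Pfin : Pr setT < +oo by rewrite ltey_eq fin_num_measure.
  by move=> _; exact: Pfin.
Qed.

Lemma cond_law_ge0_integral (h : T1 * T2 -> \bar R) : (forall z, 0 <= h z) ->
  measurable_fun setT h ->
  \int[Pr]_w h (X w, Y w) = \int[distribution Pr X]_x \int[k x]_y h (x, y).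
Proof.
move=> h0 mh.
transitivity (\int[joint]_z h z).
  by rewrite ge0_integral_pushforward.
rewrite (integral_bind mkpair jointE)//; apply: eq_integral => x _.
by rewrite ge0_integral_pushforward//; exact: pair1_measurable.
Qed.

Lemma cond_law_Rintegral (h : T1 * T2 -> R) : measurable_fun setT h ->
  Pr.-integrable setT (EFin \o (fun w => h (X w, Y w))) ->
  [/\ {ae distribution Pr X, forall x,
        (k x).-integrable setT (EFin \o (fun y => h (x, y)))},
      (distribution Pr X).-integrable setT
        (EFin \o (fun x => \int[k x]_y h (x, y))%R) &
      (\int[Pr]_w h (X w, Y w) =
       \int[distribution Pr X]_x \int[k x]_y h (x, y))%R].
Proof.
move=> mh ih.
have ipush : (joint).-integrable setT (EFin \o h).
  by apply: (integrable_pushforward mpair) => //; exact/measurable_EFinP.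
have kE x : (\int[kpair x]_z h z = \int[k x]_y h (x, y))%R.
  have mhp : measurable_fun setT (EFin \o h) by exact/measurable_EFinP.
  rewrite /Rintegral integralE [in RHS]integralE; congr (fine (_ - _)).
    rewrite (ge0_integral_pushforward (pair1_measurable x))//.
      by apply: eq_integral => y _; rewrite /= !funeposE.
    exact: measurable_funepos.
  rewrite (ge0_integral_pushforward (pair1_measurable x))//.
    by apply: eq_integral => y _; rewrite /= !funenegE.
  exact: measurable_funeneg.
have [iR RE] := Rintegral_bind mkpair jointE ipush.
split.
- apply: filterS (ae_integrable_bind mkpair jointE ipush) => x /integrableP[_].
  rewrite (ge0_integral_pushforward (pair1_measurable x))//; last first.
    by apply: measurableT_comp => //; exact/measurable_EFinP.
  move=> hx; apply/integrableP; split=> //; apply/measurable_EFinP.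
  by apply: measurableT_comp => //; exact: pair1_measurable.
- by move: iR; congr (_.-integrable _ (EFin \o _)); apply/funext => x; exact: kE.
- transitivity (\int[joint]_z h z)%R.
    by rewrite /Rintegral (integral_pushforward mpair)//; exact/measurable_EFinP.
  by rewrite RE; apply: eq_Rintegral => x _; exact: kE.
Qed.

End cond_law_theory.

(** * Functions of class C^k on R^d *)

(** A quadratic remainder is o(|v|). The explicit derivatives of coordinates, sums of squares,
    linear functions and Laplace transforms all come from such a bound. *)
Lemma quadratic_diff (R : realType) (V W : normedModType R) (f : V -> W)
    (df : {linear V -> W}) (x : V) (M : R) : continuous df ->
  (forall v, `|v| <= 1 -> `|f (x + v) - f x - df v| <= M * `|v| ^+ 2) ->
  differentiable f x /\ 'd f x = df :> (V -> W).
Proof.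
move=> cdf fM; have fE : f \o shift x = cst (f x) + df +o_ 0 id.
  apply/eqaddoP => e e0; near=> v.
  have v1 : `|v| <= 1.
    rewrite -[v]subr0 distrC; near: v.
    by apply: cvgr_dist_le => //; exact: cvg_id.
  have := fM _ v1; rewrite -addrA -opprD [x + v]addrC.
  move=> /le_trans; apply; rewrite expr2 mulrA ler_wpM2r//.
  (* The denominator |M| + 1 covers M of any sign, zero included. *)
  have vM : `|v| <= e / (`|M| + 1).
    rewrite -[v]subr0 distrC; near: v.
    apply: cvgr_dist_le; first exact: cvg_id.
    by rewrite divr_gt0// ltr_wpDl.
  apply: (@le_trans _ _ (`|M| * `|v|)); first by rewrite ler_wpM2r// ler_norm.
  apply: (@le_trans _ _ (`|M| * (e / (`|M| + 1)))); first by rewrite ler_wpM2l.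
  rewrite mulrCA; apply: ler_piMr; first exact: ltW.
  by rewrite ler_pdivrMr ?mul1r ?lerDl// ltr_wpDl.
have dfE : 'd f x = df :> (_ -> _) by exact: diff_unique.
by split=> //; apply/diff_locallyP; rewrite dfE.
Unshelve. all: by end_near. Qed.

Section smooth_functions.
Context {R : realType} {d : nat}.
Implicit Types (f g : 'rV[R]_d -> R) (x v : 'rV[R]_d).

Lemma rV_coord_le_norm x i : `|x ord0 i| <= `|x|.
Proof.
by rewrite [leRHS]mx_normrE (le_bigmax _ (fun ij => `|x ij.1 ij.2|) (ord0, i)).
Qed.

Lemma continuous_sum_coord (c : 'I_d -> R) :
  continuous (fun v : 'rV[R]_d => \sum_i v ord0 i * c i).
Proof.
move=> v; apply: differentiable_continuous.
rewrite (_ : (fun v => _) =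
    \sum_i ((fun v : 'rV[R]_d => v ord0 i) * cst (c i))); last first.
  by apply/funext => w; rewrite fct_sumE.
apply: differentiable_sum => i; apply: differentiableM => //.
exact: differentiable_coord.
Qed.

Lemma quadratic_differentiable f x (c : 'I_d -> R) (M : R) :
  (forall v, `|v| <= 1 ->
    `|f (x + v) - f x - \sum_i v ord0 i * c i| <= M * `|v| ^+ 2) ->
  differentiable f x /\ forall i, partial i f x = c i.
Proof.
move=> fM; pose L v := \sum_i v ord0 i * c i.
have L_lin : linear L.
  move=> a u v; rewrite /L scaler_sumr -big_split; apply: eq_bigr => i _.
  by rewrite !mxE mulrDl -mulrA.
pose LM := GRing.isLinear.Build _ _ _ _ _ L_lin.
pose LL : {linear 'rV[R]_d -> R} := HB.pack L LM.
have cL : continuous LL by exact: continuous_sum_coord.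
have [df dfE] := quadratic_diff cL fM.
split=> // i; rewrite /partial deriveE// dfE /= /L.
rewrite (bigD1 i)//= big1 => [|j ji]; last by rewrite mxE (negbTE ji) andbF mul0r.
by rewrite mxE !eqxx mul1r addr0.
Qed.

Lemma partial_cst (a : R) i : partial i (cst a : 'rV[R]_d -> R) = cst 0.
Proof. by apply/funext => x; rewrite /partial derive_cst. Qed.

Lemma partial_coord i j :
  partial i (fun x : 'rV[R]_d => x ord0 j) = cst (i == j)%:R.
Proof.
apply/funext => x; have [|_ ->//] := @quadratic_differentiable
  (fun x => x ord0 j) x (fun i => (i == j)%:R) 0.
move=> v _; rewrite mul0r mxE (bigD1 j)//= eqxx mulr1 big1 ?addr0.
  by rewrite [x ord0 j + _]addrC addrK subrr normr0.
by move=> k /negbTE ->; rewrite mulr0.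
Qed.

Lemma partialD i f g x : differentiable f x -> differentiable g x ->
  partial i (fun x => f x + g x) x = partial i f x + partial i g x.
Proof. by move=> df dg; rewrite /partial deriveD//; exact: diff_derivable. Qed.

Lemma partialM i f g x : differentiable f x -> differentiable g x ->
  partial i (fun x => f x * g x) x = f x * partial i g x + g x * partial i f x.
Proof. by move=> df dg; rewrite /partial deriveM//; exact: diff_derivable. Qed.

Lemma differentiable_expR_comp f x : differentiable f x ->
  differentiable (fun x => expR (f x)) x.
Proof.
move=> df; apply: (differentiable_comp df).
exact/derivable1_diffP/derivable_expR.
Qed.

Lemma partial_expR i f x : differentiable f x ->
  partial i (fun x => expR (f x)) x = expR (f x) * partial i f x.
Proof.
move=> df; have dexp : differentiable (@expR R) (f x).
  exact/derivable1_diffP/derivable_expR.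
rewrite /partial deriveE; last exact: differentiable_expR_comp.
rewrite (diff_comp df dexp) /= deriveE// -[in LHS](mulr1 ('d f x _)).
rewrite -[_ * 1]/(_ *: (1 : R)) linearZ.
have -> : 'd (@expR R) (f x) 1 = expR (f x) by rewrite -deriveE// derive_val.
by rewrite /= -[_ *: _]/(_ * _) mulrC.
Qed.

Lemma Ck_continuous k f : Ck k f -> continuous f.
Proof. by case: k => //= k [df _] x; exact/differentiable_continuous/df. Qed.

Lemma CkW k f : Ck k.+1 f -> Ck k f.
Proof.
elim: k f => [|k IH] f; first exact: Ck_continuous.
by move=> [df pf]; split=> // i; apply: IH; exact: pf.
Qed.

Lemma eq_Ck k f g : f =1 g -> Ck k f -> Ck k g.
Proof. by move=> /funext ->. Qed.

Lemma Ck_cst k (a : R) : Ck k (cst a : 'rV[R]_d -> R).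
Proof.
elim: k a => [|k IH] a; first exact: cst_continuous.
by split=> [x|i]; [exact: differentiable_cst|rewrite partial_cst].
Qed.

Lemma Ck_coord k i : Ck k (fun x : 'rV[R]_d => x ord0 i).
Proof.
case: k => [|k]; first exact: coord_continuous.
split=> [x|j]; [exact: differentiable_coord|rewrite partial_coord].
exact: Ck_cst.
Qed.

Lemma CkD k f g : Ck k f -> Ck k g -> Ck k (fun x => f x + g x).
Proof.
elim: k f g => [|k IH] f g; first by move=> cf cg x; exact: cvgD (cf x) (cg x).
move=> [df pf] [dg pg]; split=> [x|i]; first exact: differentiableD.
apply: eq_Ck (IH _ _ (pf i) (pg i)) => x; exact/esym/partialD.
Qed.

Lemma CkM k f g : Ck k f -> Ck k g -> Ck k (fun x => f x * g x).
Proof.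
elim: k f g => [|k IH] f g; first by move=> cf cg x; exact: cvgM (cf x) (cg x).
move=> Cf Cg; have [df pf] := Cf; have [dg pg] := Cg.
split=> [x|i]; first exact: differentiableM.
apply: eq_Ck (CkD (IH _ _ (CkW Cf) (pg i)) (IH _ _ (CkW Cg) (pf i))) => x.
exact/esym/partialM.
Qed.

Lemma Ck_sum k (F : 'I_d -> 'rV[R]_d -> R) : (forall i, Ck k (F i)) ->
  Ck k (fun x => \sum_i F i x).
Proof.
move=> CF; elim: (index_enum _) => [|i s IH].
  by apply: eq_Ck (Ck_cst k 0) => x; rewrite big_nil.
by apply: eq_Ck (CkD (CF i) IH) => x; rewrite big_cons.
Qed.

Lemma Ck_expR k f : Ck k f -> Ck k (fun x => expR (f x)).
Proof.
elim: k f => [|k IH] f.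
  by move=> cf x; apply: (continuous_comp (cf x)); exact: continuous_expR.
move=> Cf; have [df pf] := Cf.
split=> [x|i]; first exact: differentiable_expR_comp.
by apply: eq_Ck (CkM (IH _ (CkW Cf)) (pf i)) => x; exact/esym/partial_expR.
Qed.

Lemma continuous_measurable_rV f : continuous f -> measurable_fun setT f.
Proof.
move=> /continuousP cf; apply: (measurability _ (@measurable_realfun.RGenOpens.measurableE R)).
move=> _ [_ [a [b ->] <-]]; rewrite setTI.
by apply: open_measurable_rV; apply: cf; exact: itv_open.
Qed.

Lemma Ck_measurable k f : Ck k f -> measurable_fun setT f.
Proof. by move=> /Ck_continuous; exact: continuous_measurable_rV. Qed.

Lemma measurable_sqnorm_grad f : Ck 1 f -> measurable_fun setT (sqnorm_grad f).
Proof.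
move=> [_ pf]; apply: measurable_sum => i; apply: measurable_funX.
exact: continuous_measurable_rV.
Qed.

Lemma sqnorm_grad_ge0 f x : 0 <= sqnorm_grad f x.
Proof. by apply: sumr_ge0 => i _; exact: sqr_ge0. Qed.

End smooth_functions.

(** * Regression for exponential families *)

(** From 1 + u <= exp u, taken at u and at -u, one gets 0 <= exp u - 1 - u <= u (exp u - 1); the
    last product is then bounded according to the sign of u. *)
Lemma expR_taylor2_le {R : realType} (u : R) :
  `|expR u - 1 - u| <= u ^+ 2 * expR `|u|.
Proof.
have u1 : 1 + u <= expR u := expR_ge1Dx u.
rewrite ger0_norm; last by rewrite -addrA -opprD subr_ge0.
have u2 : expR u - 1 <= u * expR u.
  have := expR_ge1Dx (- u); rewrite -(ler_pM2r (expR_gt0 u)) expRN.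
  by rewrite mulVf ?gt_eqF ?expR_gt0//; nra.
have [u0|u0] := leP 0 u; first by rewrite ger0_norm//; nra.
have : 1 <= expR `|u| by rewrite -expR0 ler_expR.
have := sqr_ge0 u; nra.
Qed.

Lemma Rintegral_sum dT (T : measurableType dT) (R : realType)
    (m : {measure set T -> \bar R}) (I : finType) (G : I -> T -> R) :
  (forall i, m.-integrable setT (EFin \o G i)) ->
  m.-integrable setT (EFin \o (fun y => \sum_i G i y)) /\
  \int[m]_y (\sum_i G i y) = \sum_i \int[m]_y G i y.
Proof.
move=> iG; elim: (index_enum _) => [|i s [IH1 IH2]].
  split; last first.
    rewrite big_nil /Rintegral integral0_eq// => y _.
    by rewrite big_nil.
  apply: eq_integrable (integrable0 m setT) => // y _ /=.
  by rewrite big_nil.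
split.
  apply: eq_integrable (integrableD measurableT (iG i) IH1) => // y _ /=.
  by rewrite big_cons.
rewrite big_cons -IH2 -RintegralD//.
by apply: eq_Rintegral => y _; rewrite big_cons.
Qed.

(** * Laplace transforms and differentiation under the integral sign *)

Section laplace_transform.
Context dT (T : measurableType dT) (R : realType) (d : nat).
Variables (m : {measure set T -> \bar R}) (w : T -> 'rV[R]_d).
Hypothesis mw : measurable_fun setT w.
Implicit Types (h : T -> R) (x v : 'rV[R]_d).

Definition expo y x := \sum_i w y ord0 i * x ord0 i.

Definition laplace h x : R := \int[m]_y (h y * expR (expo y x)).

(** Integrability against every exponential is stable under multiplication by exponentials, hence by
    the coordinates of w, so that differentiation under the integral sign can be iterated. *)
Definition laplaceable h := measurable_fun setT h /\
  forall x, m.-integrable setT (EFin \o (fun y => h y * expR (expo y x))).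

Let mwi i : measurable_fun setT (fun y => w y ord0 i).
Proof. exact: measurableT_comp (measurable_rV_coord i) mw. Qed.

Lemma measurable_expo x : measurable_fun setT (expo ^~ x).
Proof. by apply: measurable_sum => i; exact: measurable_funM. Qed.

Let mexp x : measurable_fun setT (fun y => expR (expo y x)).
Proof. by apply: measurableT_comp => //; exact: measurable_expo. Qed.

Lemma expoD y x v : expo y (x + v) = expo y x + expo y v.
Proof.
by rewrite -big_split; apply: eq_bigr => i _; rewrite mxE mulrDr.
Qed.

Lemma eq_laplaceable h h' : h =1 h' -> laplaceable h -> laplaceable h'.
Proof. by move=> /funext ->. Qed.

Lemma laplaceable_le h h' : measurable_fun setT h' ->
  (forall y, `|h' y| <= `|h y|) -> laplaceable h -> laplaceable h'.
Proof.
move=> mh' hh' [mh ih]; split=> // x; apply: le_integrable (ih x) => //.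
  by apply/measurable_EFinP; exact: measurable_funM.
by move=> y _; rewrite lee_fin !normrM ler_wpM2r.
Qed.

Lemma laplaceableD h h' : laplaceable h -> laplaceable h' ->
  laplaceable (fun y => h y + h' y).
Proof.
move=> [mh ih] [mh' ih']; split=> [|x]; first exact: measurable_funD.
have := integrableD measurableT (ih x) (ih' x).
by apply: eq_integrable => // y _ /=; rewrite mulrDl.
Qed.

Lemma laplaceable_shift h v : laplaceable h ->
  laplaceable (fun y => h y * expR (expo y v)).
Proof.
move=> [mh ih]; split=> [|x]; first exact: measurable_funM.
apply: eq_integrable (ih (v + x)) => // y _ /=.
by rewrite expoD expRD mulrA.
Qed.

(** This is 2 cosh t: it dominates exp |t| and, being a sum of two exponentials, preserves
    [laplaceable] as a factor. *)
Definition cosh2 (t : R) := expR t + expR (- t).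

Lemma expR_norm_le_cosh2 t : expR `|t| <= cosh2 t.
Proof.
rewrite /cosh2; have := expR_gt0 t; have := expR_gt0 (- t).
by case: (ger0P t) => _ p1 p2; lra.
Qed.

Lemma laplaceable_cosh2 h i : laplaceable h ->
  laplaceable (fun y => h y * cosh2 (w y ord0 i)).
Proof.
move=> lh; have expoE (e : R) y : expo y (e *: delta_mx ord0 i) = e * w y ord0 i.
  rewrite /expo (bigD1 i)//= big1 => [|j ji].
    by rewrite !mxE !eqxx mulr1 addr0 mulrC.
  by rewrite !mxE (negbTE ji) andbF mulr0 mulr0.
apply: eq_laplaceable (laplaceableD
  (laplaceable_shift (1 *: delta_mx ord0 i) lh)
  (laplaceable_shift (-1 *: delta_mx ord0 i) lh)) => y.
by rewrite !expoE mul1r mulN1r -mulrDr.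
Qed.

(** A majorant of the exponential of the l1 norm of w y that is still a finite sum of exponentials
    of linear forms in w y. *)
Definition coshs y := \prod_i cosh2 (w y ord0 i).

Lemma laplaceable_coshs h : laplaceable h -> laplaceable (fun y => h y * coshs y).
Proof.
move=> lh; rewrite /coshs; elim: (index_enum _) => [|i s IH].
  by apply: eq_laplaceable lh => y; rewrite big_nil mulr1.
apply: eq_laplaceable (laplaceable_cosh2 i IH) => y.
by rewrite big_cons -mulrA; congr (_ * _); rewrite mulrC.
Qed.

Let s y := \sum_i `|w y ord0 i|.

Let s_ge0 y : 0 <= s y. Proof. exact: sumr_ge0. Qed.

Lemma expR_sum_norm_le_coshs y : expR (s y) <= coshs y.
Proof.
rewrite /s /coshs; elim/big_rec2: _ => [|i p q _ pq]; first by rewrite expR0.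
rewrite expRD ler_pM ?expR_ge0// ?expR_norm_le_cosh2//.
Qed.

Let s_le y : s y <= coshs y.
Proof.
apply: le_trans (expR_sum_norm_le_coshs y).
by rewrite (le_trans _ (expR_ge1Dx _))// lerDr.
Qed.

Let coshs_ge0 y : 0 <= coshs y.
Proof. exact: le_trans (s_ge0 y) (s_le y). Qed.

(** |w_i| is at most the l1 norm of w, hence at most its exponential, hence at most [coshs]. *)
Lemma laplaceable_coord h i : laplaceable h ->
  laplaceable (fun y => h y * w y ord0 i).
Proof.
move=> lh; have [mh _] := lh; apply: laplaceable_le (laplaceable_coshs lh).
  exact: measurable_funM.
move=> y; rewrite !normrM ler_wpM2l// (ger0_norm (coshs_ge0 y)).
apply: le_trans (s_le y); rewrite /s (bigD1 i)//= lerDl.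
exact: sumr_ge0.
Qed.

(** The norm of v is the sup norm, so |<w, v>| is at most |v| times the l1 norm of w. Two of the
    three factors [coshs] absorb the square of that l1 norm, the third absorbs the exponential. *)
Lemma expo_taylor2_le y v : `|v| <= 1 ->
  `|expR (expo y v) - 1 - expo y v| <= `|v| ^+ 2 * coshs y ^+ 3.
Proof.
move=> v1; have ev : `|expo y v| <= `|v| * s y.
  rewrite mulr_sumr (le_trans (ler_norm_sum _ _ _))//.
  by apply: ler_sum => i _; rewrite normrM mulrC ler_wpM2r// rV_coord_le_norm.
apply: le_trans (expR_taylor2_le _) _.
rewrite [coshs y ^+ 3]exprSr mulrA ler_pM ?sqr_ge0 ?expR_ge0//.
  rewrite -exprMn -[X in X <= _]real_normK ?num_real// lerXn2r ?nnegrE//.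
    by rewrite mulr_ge0.
  by rewrite (le_trans ev)// ler_wpM2l.
apply: le_trans (expR_sum_norm_le_coshs y); rewrite ler_expR (le_trans ev)//.
by rewrite ler_piMl.
Qed.

(** The second-order remainder is at most |v|^2 M, and M is finite because three successive factors
    [coshs] preserve [laplaceable]. *)
Lemma laplace_differentiable h x : laplaceable h ->
  differentiable (laplace h) x /\
  forall i, partial i (laplace h) x = laplace (fun y => h y * w y ord0 i) x.
Proof.
move=> lh; have lc := laplaceable_coshs (laplaceable_coshs (laplaceable_coshs lh)).
pose M := \int[m]_y (`|h y| * coshs y ^+ 3 * expR (expo y x)).
have iM : m.-integrable setT
    (EFin \o (fun y => `|h y| * coshs y ^+ 3 * expR (expo y x))).
  have := integrable_norm (lc.2 x); apply: eq_integrable => // y _ /=.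
  rewrite !normrM !(ger0_norm (coshs_ge0 y)) (ger0_norm (expR_ge0 _)).
  by rewrite !exprS expr0 mulr1 !mulrA.
apply: (@quadratic_differentiable _ _ _ _ _ M) => v v1.
have ih := lh.2; have ihi i := (laplaceable_coord i lh).2 x.
pose G i y := v ord0 i * (h y * w y ord0 i * expR (expo y x)).
have iG i : m.-integrable setT (EFin \o G i).
  exact: eq_integrable (integrableZl measurableT (v ord0 i) (ihi i)).
have [isum sumE'] := Rintegral_sum iG.
have sumE : \sum_i v ord0 i * laplace (fun y => h y * w y ord0 i) x =
    \int[m]_y \sum_i G i y.
  by rewrite sumE'; apply: eq_bigr => i _; rewrite /G RintegralZl.
have iB : m.-integrable setT (EFin \o (fun y =>
    h y * expR (expo y (x + v)) - h y * expR (expo y x))).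
  exact: eq_integrable (integrableB measurableT (ih (x + v)) (ih x)).
have iBsum : m.-integrable setT (EFin \o (fun y =>
    h y * expR (expo y (x + v)) - h y * expR (expo y x) - \sum_i G i y)).
  exact: eq_integrable (integrableB measurableT iB isum).
rewrite sumE /laplace -(RintegralB _ (ih _) (ih _))// -(RintegralB _ iB isum)//.
rewrite /M mulrC -RintegralZl//.
apply: le_trans (le_normr_Rintegral _ iBsum) _ => //.
have lhsE y : h y * expR (expo y (x + v)) - h y * expR (expo y x) -
    \sum_i G i y =
    h y * expR (expo y x) * (expR (expo y v) - 1 - expo y v).
  rewrite expoD expRD mulrBr mulrBr mulr1 mulrA; congr (_ - _).
  by rewrite [expo y v]/expo mulr_sumr; apply: eq_bigr => i _; rewrite /G; ring.
apply: le_Rintegral => //.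
- exact: eq_integrable (integrable_norm iBsum).
- exact: eq_integrable (integrableZl measurableT (`|v| ^+ 2) iM).
move=> y _; rewrite lhsE !normrM (ger0_norm (expR_ge0 _)).
have := ler_wpM2l (mulr_ge0 (normr_ge0 (h y)) (expR_ge0 (expo y x)))
  (expo_taylor2_le y v1).
by move=> /le_trans; apply; rewrite le_eqVlt; apply/orP; left; apply/eqP; ring.
Qed.

Lemma Ck_laplace k h : laplaceable h -> Ck k (laplace h).
Proof.
elim: k h => [|k IH] h lh.
  by move=> x; apply/differentiable_continuous/(laplace_differentiable x lh).1.
split=> [x|i]; first exact: (laplace_differentiable x lh).1.
apply: eq_Ck (IH _ (laplaceable_coord i lh)) => x.
by rewrite (laplace_differentiable x lh).2.
Qed.

End laplace_transform.

Lemma Rintegral_density d (T : measurableType d) (R : realType)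
    (nu m : {measure set T -> \bar R}) (q g : T -> R) :
  measurable_fun setT q -> (forall x, 0 <= q x) ->
  (forall A, measurable A -> m A = \int[nu]_(x in A) (q x)%:E)%E ->
  measurable_fun setT g ->
  nu.-integrable setT (EFin \o (fun x => q x * g x)) ->
  m.-integrable setT (EFin \o g) /\ \int[m]_x g x = \int[nu]_x (q x * g x).
Proof.
move=> mq q0 mE mg ig; have mg' : measurable_fun setT (EFin \o g).
  exact/measurable_EFinP.
have dens := integral_density mq q0 mE; split.
  apply/integrableP; split=> //; rewrite dens//; last exact: measurableT_comp.
  have /integrableP[_] := ig; congr (_ < _)%E; apply: eq_integral => x _ /=.
  by rewrite normrM ger0_norm.
rewrite /Rintegral integralE [in RHS]integralE; congr (fine (_ - _)).
  rewrite dens//; last exact: measurable_funepos.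
  by apply: eq_integral => x _; rewrite !funeposE /= EFinM maxe_pMr ?lee_fin ?mule0.
rewrite dens//; last exact: measurable_funeneg.
by apply: eq_integral => x _; rewrite !funenegE /= maxe_pMr ?lee_fin// mule0 -?EFinN -EFinM mulrN.
Qed.

Lemma rcov_sumr d (T : measurableType d) (R : realType) (P : probability T R)
    (I : finType) (f : T -> R) (g : I -> T -> R) (c : I -> R) :
  f \in Lfun P 2%:E -> (forall i, g i \in Lfun P 2%:E) ->
  (fun x => \sum_i c i * g i x) \in Lfun P 2%:E /\
  rcov P f (fun x => \sum_i c i * g i x) = \sum_i c i * rcov P f (g i).
Proof.
move=> f2 g2; split.
  elim: (index_enum _) => [|i s IH].
    rewrite (_ : (fun x => _) = cst 0) ?Lfun_cst//.
    by apply/funext => x; rewrite big_nil.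
  rewrite (_ : (fun x => _) = c i \o* g i + (fun x => \sum_(j <- s) c j * g j x)).
    rewrite rpredD// ?lee1n// => le12.
    by apply: Lfun_scale; rewrite ?ler1n.
  by apply/funext => x; rewrite big_cons /= mulrC.
have ic i : P.-integrable setT (EFin \o (fun x => c i * g i x)).
  exact: eq_integrable (integrableZl measurableT (c i) (Lfun2_integrable (g2 i))).
have ifc i : P.-integrable setT (EFin \o (fun x => c i * (f x * g i x))).
  exact: eq_integrable (integrableZl measurableT (c i)
    (Lfun2_integrableM f2 (g2 i))).
rewrite /rcov (Rintegral_sum ic).2.
rewrite (_ : \int[P]_x (f x * _) = \int[P]_x (\sum_i c i * (f x * g i x)));
  last first.
  by apply: eq_Rintegral => x _; rewrite mulr_sumr; apply: eq_bigr => i _; ring.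
rewrite (Rintegral_sum ifc).2 mulr_sumr -sumrB; apply: eq_bigr => i _.
rewrite RintegralZl//; last exact: Lfun2_integrableM.
by rewrite RintegralZl//; [ring|exact: Lfun2_integrable].
Qed.

Section exponential_family.
Context dT (T : measurableType dT) (R : realType) (d : nat).
Variables (m : {measure set T -> \bar R}) (w : T -> 'rV[R]_d) (b : R).
Hypothesis mw : measurable_fun setT w.
Variable K : 'rV[R]_d -> probability T R.
Hypothesis KE : forall x A, measurable A -> (K x A = \int[m]_(y in A)
  (expR (expo w y x - b / 2 * \sum_i x ord0 i ^+ 2))%:E)%E.
Implicit Types (g : T -> R) (x v : 'rV[R]_d).

Let u x : R := - (b / 2 * \sum_i x ord0 i ^+ 2).

Let u_differentiable x :
  differentiable u x /\ forall i, partial i u x = - (b * x ord0 i).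
Proof.
apply: (@quadratic_differentiable _ _ _ _ _ (`|b / 2| * d%:R)) => v _.
rewrite (_ : _ - _ - _ = - (b / 2 * \sum_i v ord0 i ^+ 2)); last first.
  pose X := \sum_i v ord0 i * x ord0 i.
  have -> : \sum_i v ord0 i * - (b * x ord0 i) = - (b * X).
    by rewrite mulr_sumr -sumrN; apply: eq_bigr => i _; ring.
  have xvE : \sum_i (x + v) ord0 i ^+ 2 =
      \sum_i x ord0 i ^+ 2 + 2 * X + \sum_i v ord0 i ^+ 2.
    rewrite mulr_sumr -!big_split; apply: eq_bigr => i _.
    by rewrite /= mxE; ring.
  by rewrite /u xvE; field.
rewrite normrN normrM -mulrA ler_wpM2l//.
rewrite mulrC mulr_natr -[X in _ <= _ *+ X](card_ord d) -sumr_const.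
rewrite ger0_norm ?sumr_ge0// => [|i _]; last exact: sqr_ge0.
apply: ler_sum => i _; rewrite -[leLHS]real_normK ?num_real//.
by rewrite lerXn2r ?nnegrE// rV_coord_le_norm.
Qed.

Let Ck_u k : Ck k u.
Proof.
have Cs : Ck k (fun x : 'rV[R]_d => \sum_i x ord0 i ^+ 2).
  apply: Ck_sum => i; apply: eq_Ck (CkM (Ck_coord k i) (Ck_coord k i)) => x.
  by rewrite expr2.
apply: eq_Ck (CkM (Ck_cst k (- (b / 2))) Cs) => x.
by rewrite /u mulNr.
Qed.

Let qE y x : expR (expo w y x - b / 2 * \sum_i x ord0 i ^+ 2) =
  expR (u x) * expR (expo w y x).
Proof. by rewrite /u -expRD addrC. Qed.

Let mq x : measurable_fun setT
  (fun y => expR (expo w y x - b / 2 * \sum_i x ord0 i ^+ 2)).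
Proof.
by apply: measurableT_comp => //; apply: measurable_funB => //; exact: measurable_expo.
Qed.

Lemma exp_family_integral g x : laplaceable m w g ->
  (K x).-integrable setT (EFin \o g) /\
  \int[K x]_y g y = expR (u x) * laplace m w g x.
Proof.
move=> [mg ig].
have igq : m.-integrable setT (EFin \o (fun y =>
    expR (expo w y x - b / 2 * \sum_i x ord0 i ^+ 2) * g y)).
  apply: eq_integrable (integrableZl measurableT (expR (u x)) (ig x)) => //.
  by move=> y _ /=; rewrite qE -EFinM; congr EFin; ring.
have [iK ->] := Rintegral_density (mq x) (fun y => expR_ge0 _) (KE x) mg igq.
split=> //; rewrite /laplace -RintegralZl//.
by apply: eq_Rintegral => y _; rewrite qE; ring.
Qed.

(** Each K x has finite mass, so exp <w, x> is integrable under m for every x; bounded functions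
    follow by domination. *)
Lemma laplaceable_bounded g (M : R) : measurable_fun setT g ->
  (forall y, `|g y| <= M) -> laplaceable m w g.
Proof.
move=> mg gM; apply: (@laplaceable_le _ _ _ _ _ _ mw (cst M)) => //.
  by move=> y; rewrite (le_trans (gM y))// ler_norm.
split=> // x; have := KE x measurableT.
have mq' := mq x; move=> KxE.
have i1 : m.-integrable setT (EFin \o (fun y =>
    expR (expo w y x - b / 2 * \sum_i x ord0 i ^+ 2))).
  apply/integrableP; split; first exact/measurable_EFinP.
  under eq_integral do rewrite /= ger0_norm ?expR_ge0//.
  by rewrite -KxE ltey_eq fin_num_measure.
apply: eq_integrable (integrableZl measurableT (M / expR (u x)) i1) => //.
move=> y _ /=; rewrite qE -EFinM; congr EFin.
by rewrite mulrA divfK// gt_eqF// expR_gt0.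
Qed.

Let KEE g : laplaceable m w g ->
  (fun x => \int[K x]_y g y) = (fun x => expR (u x) * laplace m w g x).
Proof.
by move=> lg; apply/funext => x; exact: (exp_family_integral x lg).2.
Qed.

Lemma Ck_exp_family k g : laplaceable m w g -> Ck k (fun x => \int[K x]_y g y).
Proof.
move=> lg; rewrite (KEE lg); apply: CkM; first exact/Ck_expR/Ck_u.
exact: Ck_laplace.
Qed.

(** Product rule for exp(u) times the Laplace transform of g; the derivative of u contributes - b
    x_i. *)
Lemma partial_exp_family i g x : laplaceable m w g ->
  partial i (fun x => \int[K x]_y g y) x =
  \int[K x]_y (g y * w y ord0 i) - b * x ord0 i * \int[K x]_y g y.
Proof.
move=> lg; have [ud ui] := u_differentiable x.
have [ld li] := laplace_differentiable mw x lg.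
rewrite (KEE lg) partialM//; last exact: differentiable_expR_comp.
rewrite partial_expR// ui li (exp_family_integral x (laplaceable_coord mw i lg)).2.
by rewrite (exp_family_integral x lg).2; ring.
Qed.

Let l1 : laplaceable m w (cst 1).
Proof. by apply: (@laplaceable_bounded _ 1) => // y; rewrite normr1. Qed.

Let lw i : laplaceable m w (fun y => w y ord0 i).
Proof.
apply: eq_laplaceable (laplaceable_coord mw i l1) => y.
by rewrite mul1r.
Qed.

Let K1 x : \int[K x]_y cst 1 y = 1.
Proof.
by rewrite Rintegral_cst// mul1r; have -> : fine (K x setT) = 1 by
  rewrite probability_setT.
Qed.

(** The total mass is constantly 1, so the derivative formula for g = 1 has left side 0. *)
Lemma exp_family_mean i x : \int[K x]_y w y ord0 i = b * x ord0 i.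
Proof.
have := partial_exp_family i x l1; rewrite K1.
have -> : (fun x => \int[K x]_y cst 1 y) = cst 1 by apply/funext => z; exact: K1.
rewrite partial_cst /= mulr1 => /esym/eqP; rewrite subr_eq0 => /eqP <-.
by apply: eq_Rintegral => y _; rewrite mul1r.
Qed.

Lemma exp_family_Lfun2 i x : (fun y => w y ord0 i) \in Lfun (K x) 2%:E.
Proof.
apply/Lfun2P; split; first exact: (lw i).1.
have := (exp_family_integral x (laplaceable_coord mw i (lw i))).1.
move=> /integrableP[_]; congr (_ < _)%E; apply: eq_integral => y _ /=.
by rewrite -expr2 ger0_norm// sqr_ge0.
Qed.

(** By the derivative formula this covariance is the i-th partial derivative of the mean b x_j. *)
Lemma exp_family_cov i j x :
  rcov (K x) (fun y => w y ord0 j) (fun y => w y ord0 i) = b * (i == j)%:R.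
Proof.
have := partial_exp_family i x (lw j); rewrite /rcov !exp_family_mean.
rewrite [b * x ord0 j * _]mulrC => <-.
rewrite (_ : (fun x => \int[K x]_y w y ord0 j) =
    (fun x : 'rV[R]_d => cst b x * x ord0 j)); last first.
  by apply/funext => z; exact: exp_family_mean.
rewrite partialM ?partial_cst ?partial_coord/= ?mulr0 ?addr0//.
exact: differentiable_coord.
Qed.

Lemma partial_exp_family_rcov i g x (M : R) : measurable_fun setT g ->
  (forall y, `|g y| <= M) ->
  partial i (fun x => \int[K x]_y g y) x = rcov (K x) g (fun y => w y ord0 i).
Proof.
move=> mg gM; have lg := laplaceable_bounded mg gM.
by rewrite partial_exp_family// /rcov exp_family_mean; ring.
Qed.

(* Bessel's inequality for the scores [w y - b x], which are orthogonal with
   variance [b]: the partial derivatives of the regression of [g] are its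
   Fourier coefficients. *)
Lemma sqnorm_grad_exp_family_le g x (M : R) : measurable_fun setT g ->
  (forall y, `|g y| <= M) -> 0 <= b ->
  sqnorm_grad (fun x => \int[K x]_y g y) x <= b * rcov (K x) g g.
Proof.
move=> mg gM b0; set S := sqnorm_grad _ x.
have g2 : g \in Lfun (K x) 2%:E := Lfun2_bounded _ mg gM.
have w2 := fun i => exp_family_Lfun2 i x.
pose t i := partial i (fun x => \int[K x]_y g y) x.
have tE i : t i = rcov (K x) g (fun y => w y ord0 i).
  exact: partial_exp_family_rcov.
(* For W = sum_i t_i w_i one has Cov(g, W) = S and Var(W) = b S, so that Cauchy-Schwarz reads S^2 <=
   Var(g) b S. *)
have [W2 gW] := rcov_sumr t g2 w2.
set W := (fun y => _) in W2 gW.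
have gWE : rcov (K x) g W = S.
  by rewrite gW; apply: eq_bigr => i _; rewrite -tE expr2.
have WWE : rcov (K x) W W = b * S.
  have [_ ->] := rcov_sumr t W2 w2; rewrite mulr_sumr; apply: eq_bigr => i _.
  have [_] := rcov_sumr t (w2 i) w2; rewrite -/W rcovC => ->.
  rewrite (bigD1 i)//= exp_family_cov eqxx big1 => [|j ji].
    by rewrite -[partial i _ x]/(t i) mulr1 addr0; ring.
  by rewrite exp_family_cov (negbTE ji) mulr0 mulr0.
have := rcov_sqr_le g2 W2; rewrite gWE WWE.
have S0 : 0 <= S := sqnorm_grad_ge0 _ _.
have [S_gt0|] := ltP 0 S.
  by rewrite expr2 mulrA ler_pM2r// [b * _]mulrC.
by move=> S_le0 _; apply: le_trans S_le0 _; rewrite mulr_ge0// rcov_ge0.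
Qed.

End exponential_family.

(** * Conditional expectation along a kernel, and truncation *)

Section measure_probability.
Context d (T : measurableType d) (R : realType) (m : {measure set T -> \bar R}).
Hypothesis m1 : m setT = 1%E.

Definition mprob of m setT = 1%E : set T -> \bar R := m.

HB.instance Definition _ := Measure.on (mprob m1).

Let mprobT : mprob m1 setT = 1%E. Proof. exact: m1. Qed.

HB.instance Definition _ := Measure_isProbability.Build _ _ _ (mprob m1) mprobT.

Definition measure_probability : probability T R := mprob m1.

End measure_probability.

(** Lets results about a single probability be applied to each value of a kernel. *)
Definition kernel_prob d1 d2 (T1 : measurableType d1) (T2 : measurableType d2)
    (R : realType) (k : R.-pker T1 ~> T2) (x : T1) : probability T2 R :=
  @measure_probability _ _ _ (k x) (@prob_kernel _ _ _ _ _ k x).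

Section conditional_expectation.
Context dO d1 d2 (Omega : measurableType dO) (T1 : measurableType d1)
  (T2 : measurableType d2) (R : realType) (Pr : probability Omega R).
Variables (X : {RV Pr >-> T1}) (Y : {RV Pr >-> T2}) (k : R.-pker T1 ~> T2).
Hypothesis XYk : cond_law X Y k.
Implicit Types (f : T1 -> R) (g : T2 -> R).

Lemma Lfun2_distribution d (T : measurableType d) (Z : {RV Pr >-> T})
    (h : T -> R) : h \in Lfun (distribution Pr Z) 2%:E ->
  h \o Z \in Lfun Pr 2%:E.
Proof.
move=> /Lfun2P[mh hoo]; apply/Lfun2P; split; first exact: measurableT_comp.
move: hoo; rewrite ge0_integral_distribution//.
  by apply/measurable_EFinP; exact: measurable_funX.
by move=> y; rewrite lee_fin sqr_ge0.
Qed.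

Lemma Rintegral_distribution d (T : measurableType d) (Z : {RV Pr >-> T})
    (h : T -> R) : measurable_fun setT h ->
  Pr.-integrable setT (EFin \o (h \o Z)) ->
  \int[distribution Pr Z]_x h x = \int[Pr]_w h (Z w).
Proof.
by move=> mh ih; rewrite /Rintegral integral_distribution//; exact/measurable_EFinP.
Qed.

Lemma rcov_distribution d (T : measurableType d) (Z : {RV Pr >-> T})
    (h h' : T -> R) : h \in Lfun (distribution Pr Z) 2%:E ->
  h' \in Lfun (distribution Pr Z) 2%:E ->
  rcov Pr (h \o Z) (h' \o Z) = rcov (distribution Pr Z) h h'.
Proof.
move=> h2 h2'; have H := Lfun2_distribution h2; have H' := Lfun2_distribution h2'.
rewrite /rcov !Rintegral_distribution//; try exact: Lfun2_integrable.
- exact: Lfun2_measurable h2'.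
- exact: Lfun2_measurable h2.
- exact: measurable_funM (Lfun2_measurable h2) (Lfun2_measurable h2').
- exact: Lfun2_integrableM.
Qed.

Let mk U : measurable U -> measurable_fun setT (k ^~ U).
Proof. exact: measurable_kernel. Qed.

Lemma measurable_Rintegral_kernel g : measurable_fun setT g ->
  measurable_fun setT (fun x => \int[k x]_y g y).
Proof.
move=> mg; apply: measurableT_comp => //.
rewrite (_ : (fun x => _) = fun x => ((\int[k x]_y (EFin \o g)^\+ y) -
  (\int[k x]_y (EFin \o g)^\- y))%E); last first.
  by apply/funext => x; rewrite integralE.
apply: emeasurable_funB; apply: (measurable_integral_bind mk) => //.
- by apply: measurable_funepos; exact/measurable_EFinP.
- by apply: measurable_funeneg; exact/measurable_EFinP.
Qed.

(** Jensen's inequality under each [k x]; integrating over x then returns the second moment of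
    g(Y). *)
Lemma Lfun2_kernel g : g \in Lfun (distribution Pr Y) 2%:E ->
  (fun x => \int[k x]_y g y) \in Lfun (distribution Pr X) 2%:E.
Proof.
move=> g2; have mg := Lfun2_measurable g2; apply/Lfun2P.
split; first exact: measurable_Rintegral_kernel.
have mg2 : measurable_fun setT (fun y => (g y ^+ 2)%:E).
  by apply/measurable_EFinP; exact: measurable_funX.
apply: (@le_lt_trans _ _
  (\int[distribution Pr X]_x \int[k x]_y (g y ^+ 2)%:E)%E).
  apply: ge0_le_integral => //.
  - by move=> x _; rewrite lee_fin sqr_ge0.
  - by apply/measurable_EFinP/measurable_funX; exact: measurable_Rintegral_kernel.
  - apply: (measurable_integral_bind mk) => // y.
    by rewrite lee_fin sqr_ge0.
  - by move=> x _; exact: (@sqr_Rintegral_le _ _ _ (kernel_prob k x)).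
have h0 (z : T1 * T2) : (0 <= (g z.2 ^+ 2)%:E)%E by rewrite lee_fin sqr_ge0.
have mh : measurable_fun setT (fun z : T1 * T2 => (g z.2 ^+ 2)%:E).
  exact: measurableT_comp mg2 measurable_snd.
rewrite -(cond_law_ge0_integral XYk h0 mh).
by have /Lfun2P[_ +] := Lfun2_distribution g2.
Qed.

(** The factor f x leaves the inner integral wherever g is integrable under [k x], which is almost
    everywhere. *)
Lemma Rintegral_kernelM f g : f \in Lfun (distribution Pr X) 2%:E ->
  g \in Lfun (distribution Pr Y) 2%:E ->
  \int[Pr]_w (f (X w) * g (Y w)) =
  \int[distribution Pr X]_x (f x * \int[k x]_y g y).
Proof.
move=> f2 g2; have mf := Lfun2_measurable f2; have mg := Lfun2_measurable g2.
have F2 := Lfun2_distribution f2; have G2 := Lfun2_distribution g2.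
have mg' : measurable_fun setT (fun z : T1 * T2 => g z.2).
  exact: measurableT_comp.
have [aeg _ _] := cond_law_Rintegral XYk mg' (Lfun2_integrable G2).
have mfg : measurable_fun setT (fun z : T1 * T2 => f z.1 * g z.2).
  by apply: measurable_funM => //; exact: measurableT_comp.
have [_ iK ->] := cond_law_Rintegral XYk mfg (Lfun2_integrableM F2 G2).
rewrite /Rintegral; congr fine; apply: ae_eq_integral => //.
- exact: measurable_int iK.
- apply/measurable_EFinP/measurable_funM => //.
  exact: measurable_Rintegral_kernel.
apply: filterS aeg => x ig _ /=; congr EFin.
exact: RintegralZl.
Qed.

Lemma Rintegral_kernel g : g \in Lfun (distribution Pr Y) 2%:E ->
  \int[Pr]_w g (Y w) = \int[distribution Pr X]_x \int[k x]_y g y.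
Proof.
move=> g2; have := Rintegral_kernelM (Lfun_cst _ 1 2) g2.
under eq_Rintegral do rewrite mul1r.
by under [in RHS]eq_Rintegral do rewrite mul1r.
Qed.

Lemma rcov_kernel f g : f \in Lfun (distribution Pr X) 2%:E ->
  g \in Lfun (distribution Pr Y) 2%:E ->
  rcov Pr (f \o X) (g \o Y) =
  rcov (distribution Pr X) f (fun x => \int[k x]_y g y).
Proof.
move=> f2 g2; rewrite /rcov Rintegral_kernelM// Rintegral_kernel//.
rewrite (Rintegral_distribution (Lfun2_measurable f2))//.
exact/Lfun2_integrable/Lfun2_distribution.
Qed.

End conditional_expectation.

Section truncation.
Context d (T : measurableType d) (R : realType) (P : probability T R).
Variable V : T -> R.
Hypothesis V2 : V \in Lfun P 2%:E.

(** Large values are sent to 0 rather than clamped: the truncated V is then V times an indicator,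
    and its square is the product of V and the truncated V. *)
Definition truncation (n : nat) (t : R) := if `|t| <= n%:R then t else 0.

Lemma measurable_truncation n : measurable_fun setT (truncation n).
Proof.
by apply: measurable_fun_if => //; exact: measurable_fun_ler.
Qed.

Lemma truncation_bounded n t : `|truncation n t| <= n%:R.
Proof. by rewrite /truncation; case: ifP => // _; rewrite normr0. Qed.

Lemma cvg_Rintegral_truncation (W : T -> R) :
  P.-integrable setT (EFin \o W) ->
  (\int[P]_x (W x * (`|V x| <= n%:R)%R%:R)) @[n --> \oo] --> \int[P]_x W x.
Proof.
move=> iW; have mV := Lfun2_measurable V2.
have mW : measurable_fun setT W by apply/measurable_EFinP; exact: measurable_int iW.
apply: fine_cvg; rewrite fineK; last exact: integrable_fin_num.
apply: (@dominated_cvg _ _ _ _ _ _ _ _ (fun x => `|(W x)%:E|%E)) => //.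
- move=> n; apply/measurable_EFinP/measurable_funM => //.
  rewrite (_ : (fun x => _) = fun x => if `|V x| <= n%:R then 1 else 0).
    by apply: measurable_fun_if => //; apply: measurable_fun_ler => //;
      exact: measurableT_comp.
  by apply/funext => x; case: ifP.
- move=> x _; apply: cvg_near_cst; near=> n.
  rewrite (_ : `|V x| <= n%:R) ?mulr1//.
  by near: n; exact: nbhs_infty_ger.
- by apply: integrable_abse.
- move=> n x _; rewrite /= lee_fin normrM ler_piMr//.
  by case: (_ <= n%:R); rewrite ?normr1 ?normr0.
Unshelve. all: by end_near. Qed.

Lemma cvg_rcov_truncation (U : T -> R) : U \in Lfun P 2%:E ->
  rcov P U (truncation n \o V) @[n --> \oo] --> rcov P U V /\
  rcov P (truncation n \o V) (truncation n \o V) @[n --> \oo] --> rcov P V V.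
Proof.
move=> U2; have tE n x : truncation n (V x) = V x * (`|V x| <= n%:R)%R%:R.
  by rewrite /truncation; case: ifP; rewrite ?mulr1 ?mulr0.
have cV : (\int[P]_x truncation n (V x)) @[n --> \oo] --> \int[P]_x V x.
  have := cvg_Rintegral_truncation (Lfun2_integrable V2).
  by under eq_fun do under eq_Rintegral do rewrite -tE.
have cM W : W \in Lfun P 2%:E ->
    (\int[P]_x (W x * truncation n (V x))) @[n --> \oo] --> \int[P]_x (W x * V x).
  move=> W2; have := cvg_Rintegral_truncation (Lfun2_integrableM W2 V2).
  by under eq_fun do under eq_Rintegral do rewrite -mulrA -tE.
split; first by apply: cvgB; [exact: cM|apply: cvgMr].
rewrite (_ : (fun n => _) = fun n => \int[P]_x (V x * truncation n (V x)) -
  (\int[P]_x truncation n (V x)) * (\int[P]_x truncation n (V x))).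
  by apply: cvgB; [exact: cM|exact: cvgM].
apply/funext => n; rewrite /rcov; congr (_ - _); apply: eq_Rintegral => x _ /=.
by rewrite /truncation; case: ifP => //; rewrite !mulr0.
Qed.

End truncation.

(** * The correlation bound for an exponential family under a Poincare inequality *)

Section correlation_bound.
Context dO dT (Omega : measurableType dO) (T : measurableType dT)
  (R : realType) (d : nat) (Pr : probability Omega R).
Variables (X : {RV Pr >-> 'rV[R]_d}) (Y : {RV Pr >-> T}).
Variables (K : R.-pker 'rV[R]_d ~> T) (m : {measure set T -> \bar R}).
Variables (w : T -> 'rV[R]_d) (b C : R).
Hypothesis XYK : cond_law X Y K.
Hypothesis mw : measurable_fun setT w.
Hypothesis KE : forall x A, measurable A -> (K x A = \int[m]_(y in A)
  (expR (expo w y x - b / 2 * \sum_i x ord0 i ^+ 2))%:E)%E.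
Hypothesis b0 : 0 <= b.
Hypothesis C0 : 0 <= C.
Hypothesis poincareC : forall F : 'rV[R]_d -> R, smooth F ->
  F \in Lfun (distribution Pr X) 2%:E ->
  ((rcov (distribution Pr X) F F)%:E <=
    C%:E * \int[distribution Pr X]_x (sqnorm_grad F x)%:E)%E.
Implicit Types (f : 'rV[R]_d -> R) (g : T -> R).

Let pX := distribution Pr X.

Let bC1_gt0 : 0 < 1 + b * C.
Proof. by rewrite ltr_wpDr// mulr_ge0. Qed.

Lemma regression_variance_le g (M : R) : measurable_fun setT g ->
  (forall y, `|g y| <= M) ->
  (1 + b * C) * rcov pX (fun x => \int[K x]_y g y) (fun x => \int[K x]_y g y) <=
  b * C * rcov Pr (g \o Y) (g \o Y).
Proof.
move=> mg gM; set F := fun x => _.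
have mg2 : measurable_fun setT (fun y => g y * g y) by exact: measurable_funM.
have g2M y : `|g y * g y| <= M * M by rewrite normrM ler_pM.
have g2 : g \in Lfun (distribution Pr Y) 2%:E := Lfun2_bounded _ mg gM.
have gg2 : (fun y => g y * g y) \in Lfun (distribution Pr Y) 2%:E :=
  Lfun2_bounded _ mg2 g2M.
have F2 : F \in Lfun pX 2%:E := Lfun2_kernel XYK g2.
pose G x := \int[K x]_y (g y * g y).
have G2 : G \in Lfun pX 2%:E := Lfun2_kernel XYK gg2.
have lg : laplaceable m w g.
  exact: (laplaceable_bounded (K := kernel_prob K) mw KE mg gM).
have Fsmooth : smooth F.
  by move=> k; exact: (Ck_exp_family (K := kernel_prob K) mw KE k lg).
have iGF : pX.-integrable setT (EFin \o (fun x => G x - F x * F x)).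
  exact: eq_integrable (integrableB measurableT (Lfun2_integrable G2)
    (Lfun2_integrableM F2 F2)).
(* G - F^2 is the variance of g under K x, so this is Bessel's inequality integrated over x. *)
have energy : (\int[pX]_x (sqnorm_grad F x)%:E <=
    (b * (\int[pX]_x G x - \int[pX]_x (F x * F x)))%:E)%E.
  rewrite -RintegralB//; last 2 first.
  - exact: Lfun2_integrable.
  - exact: Lfun2_integrableM.
  rewrite -RintegralZl// /Rintegral fineK; last first.
    by apply: integrable_fin_num => //; exact: eq_integrable (integrableZl measurableT b iGF).
  apply: ge0_le_integral => //.
  - by move=> x _; rewrite lee_fin sqnorm_grad_ge0.
  - by apply/measurable_EFinP; exact: measurable_sqnorm_grad (Fsmooth 1%N).
  - apply/measurable_EFinP/measurable_funM => //.
    by apply/measurable_EFinP; exact: measurable_int iGF.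
  - move=> x _; rewrite lee_fin.
    exact: (sqnorm_grad_exp_family_le (K := kernel_prob K) mw KE x mg gM b0).
have C0' : (0 <= C%:E)%E by rewrite lee_fin.
have {}energy := le_trans (poincareC Fsmooth F2) (lee_wpmul2l C0' energy).
have GE : \int[pX]_x G x = \int[Pr]_w (g (Y w) * g (Y w)).
  exact/esym/(Rintegral_kernel XYK gg2).
have FE : \int[pX]_x F x = \int[Pr]_w g (Y w).
  exact/esym/(Rintegral_kernel XYK g2).
move: energy; rewrite -EFinM lee_fin GE => energy.
rewrite mulrDl mul1r; apply: le_trans (lerD energy (lexx _)) _.
by rewrite /rcov FE /= le_eqVlt; apply/orP; left; apply/eqP; ring.
Qed.

Lemma correlation_bound_bounded f g (M : R) : f \in Lfun pX 2%:E ->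
  measurable_fun setT g -> (forall y, `|g y| <= M) ->
  rcov Pr (f \o X) (g \o Y) ^+ 2 <= b * C / (1 + b * C) *
    (rcov Pr (f \o X) (f \o X) * rcov Pr (g \o Y) (g \o Y)).
Proof.
move=> f2 mg gM.
have g2 : g \in Lfun (distribution Pr Y) 2%:E := Lfun2_bounded _ mg gM.
rewrite (rcov_kernel XYK f2 g2) (rcov_distribution f2 f2).
apply: le_trans (rcov_sqr_le f2 (Lfun2_kernel XYK g2)) _.
rewrite mulrCA ler_wpM2l ?rcov_ge0// mulrAC ler_pdivlMr// mulrC.
exact: regression_variance_le gM.
Qed.

(** Both sides pass to the limit along truncations of g, by dominated convergence of the
    covariances. *)
Lemma correlation_bound f g : f \in Lfun pX 2%:E ->
  g \in Lfun (distribution Pr Y) 2%:E ->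
  rcov Pr (f \o X) (g \o Y) ^+ 2 <= b * C / (1 + b * C) *
    (rcov Pr (f \o X) (f \o X) * rcov Pr (g \o Y) (g \o Y)).
Proof.
move=> f2 g2; have [cc cv] := cvg_rcov_truncation
  (Lfun2_distribution g2) (Lfun2_distribution f2).
have lhs : rcov Pr (f \o X) (truncation n \o (g \o Y)) ^+ 2 @[n --> \oo] -->
    rcov Pr (f \o X) (g \o Y) ^+ 2 by exact: cvgM.
set a := b * C / (1 + b * C); set v := rcov Pr (f \o X) (f \o X).
have rhs : a * (v * rcov Pr (truncation n \o (g \o Y))
    (truncation n \o (g \o Y))) @[n --> \oo] -->
    a * (v * rcov Pr (g \o Y) (g \o Y)).
  by apply: cvgM; [exact: cvg_cst|apply: cvgM; [exact: cvg_cst|exact: cv]].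
apply: (ler_cvg_to lhs rhs); apply: nearW => n /=.
apply: (@correlation_bound_bounded f (truncation n \o g) n%:R) => //.
  apply: measurableT_comp; first exact: measurable_truncation.
  exact: Lfun2_measurable g2.
by move=> y; exact: truncation_bounded.
Qed.

End correlation_bound.

(** * Maximal correlation and spectral gap *)

Section eq_measure.
Context d (T : measurableType d) (R : realType).
Variables (p p' : probability T R).
Hypothesis pp' : forall A, measurable A -> p A = p' A.

Lemma eq_measure_integralT (f : T -> \bar R) :
  (\int[p]_x f x = \int[p']_x f x)%E.
Proof. by apply: eq_measure_integral => A mA _; exact: pp'. Qed.

Lemma eq_measure_Rintegral (f : T -> R) : \int[p]_x f x = \int[p']_x f x.
Proof. by rewrite /Rintegral eq_measure_integralT. Qed.

Lemma eq_measure_Lfun2 (f : T -> R) : f \in Lfun p 2%:E -> f \in Lfun p' 2%:E.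
Proof. by move=> /Lfun2P[mf foo]; apply/Lfun2P; rewrite -eq_measure_integralT. Qed.

Lemma eq_measure_rcov (f g : T -> R) : rcov p f g = rcov p' f g.
Proof. by rewrite /rcov !eq_measure_Rintegral. Qed.

End eq_measure.

Section composed_kernel.
Context dO d1 d2 (Omega : measurableType dO) (T1 : measurableType d1)
  (T2 : measurableType d2) (R : realType) (Pr : probability Omega R).
Variables (X : {RV Pr >-> T1}) (Y : {RV Pr >-> T2}).
Variables (K : R.-pker T1 ~> T2) (Q : R.-pker T2 ~> T1).
Hypothesis XYK : cond_law X Y K.
Hypothesis YXQ : cond_law Y X Q.

Let P := mkcomp_noparam K Q.

Let PE x A : measurable A -> P x A = (\int[K x]_y Q y A)%E.
Proof. by []. Qed.

Let mQ U : measurable U -> measurable_fun setT (Q ^~ U).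
Proof. exact: measurable_kernel. Qed.

Let mP U : measurable U -> measurable_fun setT (P ^~ U).
Proof. by move=> mU; exact: (measurable_kernel (mkcomp_noparam K Q)). Qed.

(** Given Y, the current state and the redrawn one both have conditional law Q. *)
Lemma stationary_composed_kernel A : measurable A ->
  (distribution Pr X A = \int[distribution Pr X]_x P x A)%E.
Proof.
move=> mA; transitivity (Pr (Y @^-1` setT `&` X @^-1` A)).
  by rewrite preimage_setT setTI.
rewrite YXQ// (ge0_integral_distribution Y (mQ mA))//.
have mh : measurable_fun setT (fun z : T1 * T2 => Q z.2 A).
  exact: measurableT_comp (mQ mA) measurable_snd.
exact: (cond_law_ge0_integral XYK (fun=> measure_ge0 _ _) mh).
Qed.

Lemma Rintegral_composed_kernel (f : T1 -> R) :
  f \in Lfun (distribution Pr X) 2%:E ->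
  \int[distribution Pr X]_x (f x * kernel_op P f x) =
  \int[Pr]_w ((\int[Q (Y w)]_z f z) ^+ 2).
Proof.
move=> f2; have mf := Lfun2_measurable f2.
have Qf2 := Lfun2_kernel YXQ f2.
have mQf := Lfun2_measurable Qf2.
transitivity (\int[Pr]_w (f (X w) * \int[Q (Y w)]_z f z)).
  rewrite (Rintegral_kernelM XYK f2 Qf2).
  rewrite /Rintegral; congr fine; apply: ae_eq_integral => //.
  - apply/measurable_EFinP/measurable_funM => //.
    apply: measurableT_comp => //.
    rewrite (_ : (fun x => _) = fun x => ((\int[P x]_y (EFin \o f)^\+ y) -
      (\int[P x]_y (EFin \o f)^\- y))%E); last first.
      by apply/funext => x; rewrite integralE.
    apply: emeasurable_funB; apply: (measurable_integral_bind mP) => //.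
      by apply: measurable_funepos; exact/measurable_EFinP.
    by apply: measurable_funeneg; exact/measurable_EFinP.
  - apply/measurable_EFinP/measurable_funM => //.
    exact: measurable_Rintegral_kernel.
  (* Pf x is the iterated integral of f at the points where f is integrable under P x; by
     stationarity these are almost all points. *)
  apply: filterS (ae_integrable_bind mP stationary_composed_kernel
    (Lfun2_integrable f2)) => x ifx _ /=; congr (_ * _)%:E.
  exact: (Rintegral_bind mQ (PE x) ifx).2.
transitivity (\int[Pr]_w ((\int[Q (Y w)]_z f z) * f (X w))).
  by apply: eq_Rintegral => w _; rewrite mulrC.
rewrite (Rintegral_kernelM YXQ Qf2 f2) Rintegral_distribution//.
  exact: measurable_funM.
exact: Lfun2_integrableM (Lfun2_distribution Qf2) (Lfun2_distribution Qf2).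
Qed.

End composed_kernel.

Section correlation_consequences.
Context dO d1 d2 (Omega : measurableType dO) (T1 : measurableType d1)
  (T2 : measurableType d2) (R : realType) (Pr : probability Omega R).
Variables (X : {RV Pr >-> T1}) (Y : {RV Pr >-> T2}).
Variables (K : R.-pker T1 ~> T2) (Q : R.-pker T2 ~> T1).
Hypothesis XYK : cond_law X Y K.
Hypothesis YXQ : cond_law Y X Q.
Variable p : probability T1 R.
Hypothesis X_law : forall A, measurable A -> distribution Pr X A = p A.
Variable r : R.
Hypothesis r0 : 0 <= r.
Hypothesis rbound : forall f g, f \in Lfun (distribution Pr X) 2%:E ->
  g \in Lfun (distribution Pr Y) 2%:E ->
  rcov Pr (f \o X) (g \o Y) ^+ 2 <=
  r * (rcov Pr (f \o X) (f \o X) * rcov Pr (g \o Y) (g \o Y)).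

Lemma corr_sqrE (U V : Omega -> R) : U \in Lfun Pr 2%:E -> V \in Lfun Pr 2%:E ->
  corr Pr U V ^+ 2 = rcov Pr U V ^+ 2 / (rcov Pr U U * rcov Pr V V).
Proof.
move=> U2 V2; rewrite /corr covariance_rcov// !variance_rcov//=.
by rewrite exprMn exprVn exprMn !sqr_sqrtr ?rcov_ge0.
Qed.

Lemma rho_max2_le : (rho_max2 X Y <= r%:E)%E.
Proof.
apply: ge_ereal_sup => _ [f [g [f2 g2 _ _ ->]]].
have F2 := Lfun2_distribution f2; have G2 := Lfun2_distribution g2.
rewrite lee_fin corr_sqrE//; set V := _ * rcov _ _ _.
have V0 : 0 <= V by rewrite mulr_ge0// rcov_ge0.
have [V_gt0|V_le0] := ltP 0 V; first by rewrite ler_pdivrMr//; exact: rbound.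
(* The inverse of 0 is 0, so a vanishing variance makes the quotient 0, and the bound is 0 <= r. *)
by have -> : V = 0 by [apply/eqP; rewrite eq_le V_le0]; rewrite invr0 mulr0.
Qed.

Lemma rcov_composed_kernel (f : T1 -> R) :
    f \in Lfun (distribution Pr X) 2%:E ->
    \int[distribution Pr X]_x f x = 0 ->
  let N := \int[Pr]_w ((\int[Q (Y w)]_z f z) ^+ 2) in
  [/\ rcov Pr (f \o X) ((fun y => \int[Q y]_z f z) \o Y) = N,
      rcov Pr ((fun y => \int[Q y]_z f z) \o Y)
        ((fun y => \int[Q y]_z f z) \o Y) = N &
      rcov Pr (f \o X) (f \o X) = \int[distribution Pr X]_x (f x ^+ 2)].
Proof.
move=> f2 f0 N; have mf := Lfun2_measurable f2.
have F2 := Lfun2_distribution f2.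
have Qf2 := Lfun2_kernel YXQ f2; have QF2 := Lfun2_distribution Qf2.
have fX0 : \int[Pr]_w f (X w) = 0.
  by rewrite -Rintegral_distribution//; exact: Lfun2_integrable.
split.
- rewrite rcovC (rcov_kernel YXQ Qf2 f2) /rcov.
  rewrite -(Rintegral_kernel YXQ f2) fX0 mulr0 subr0.
  rewrite Rintegral_distribution//.
    exact: measurable_funM (Lfun2_measurable Qf2) (Lfun2_measurable Qf2).
  exact: Lfun2_integrableM.
- rewrite (rcov_distribution Qf2 Qf2) /rcov -(Rintegral_kernel YXQ f2) fX0.
  rewrite mulr0 subr0 Rintegral_distribution//.
    exact: measurable_funM (Lfun2_measurable Qf2) (Lfun2_measurable Qf2).
  exact: Lfun2_integrableM.
- by rewrite (rcov_distribution f2 f2) /rcov f0 mulr0 subr0.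
Qed.

(** With g = Qf the correlation bound reads N^2 <= r V N, where N = <f, Pf> and V = |f|^2; dividing
    by N leaves N <= r V. *)
Lemma gap_ratio_le (f : T1 -> R) : f \in Lfun p 2%:E -> 'E_p[f]%E = 0%E ->
  (\int[p]_x (f x * kernel_op (mkcomp_noparam K Q) f x)) /
  (\int[p]_x (f x ^+ 2)) <= r.
Proof.
move=> fp2 Ef.
have f2 : f \in Lfun (distribution Pr X) 2%:E.
  by apply: (@eq_measure_Lfun2 _ _ _ p) => // A mA; exact/esym/X_law.
have f0 : \int[distribution Pr X]_x f x = 0.
  by rewrite (eq_measure_Rintegral X_law) /Rintegral; move: Ef; rewrite unlock => ->.
have [e1 e2 e3] := rcov_composed_kernel f2 f0.
rewrite -!(eq_measure_Rintegral X_law) (Rintegral_composed_kernel XYK YXQ)//.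
have := rbound f2 (Lfun2_kernel YXQ f2); rewrite e1 e2 e3.
set N := \int[Pr]_w _; set V := \int[_]_x _ => NV.
have N0 : 0 <= N by apply: Rintegral_ge0 => w _; exact: sqr_ge0.
have V0 : 0 <= V by apply: Rintegral_ge0 => w _; exact: sqr_ge0.
have [V_gt0|V_le0] := ltP 0 V; last first.
  by have -> : V = 0 by [apply/eqP; rewrite eq_le V_le0]; rewrite invr0 mulr0.
rewrite ler_pdivrMr//; have [N_gt0|N_le0] := ltP 0 N.
  by move: NV; rewrite mulrA expr2 ler_pM2r.
by rewrite (le_trans N_le0)// mulr_ge0.
Qed.

Lemma spectral_gap_ge :
  ((1 - r)%:E <= spectral_gap p (mkcomp_noparam K Q))%E.
Proof.
rewrite /spectral_gap EFinB leeB//; apply: ge_ereal_sup => _ [f [f2 Ef _ ->]].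
by rewrite lee_fin; exact: gap_ratio_le.
Qed.

End correlation_consequences.

(** * Gaussian kernels as exponential families *)

Section gaussian_kernel.
Context {R : realType} {d : nat}.
Implicit Types (x y mu : 'rV[R]_d).

Definition scale_rV (c : R) (z : 'rV[R]_d) : 'rV[R]_d := c *: z.

Lemma measurable_scale_rV c : measurable_fun setT (scale_rV c).
Proof.
apply: measurable_fun_rV => i; apply: (eq_measurable_fun
  (fun y : 'rV[R]_d => c * y ord0 i)) => [y _|]; first by rewrite mxE.
by apply: measurable_funM => //; exact: measurable_rV_coord.
Qed.

Lemma row_mul_trE (v : 'rV[R]_d) : (v *m v^T) ord0 ord0 = \sum_i v ord0 i ^+ 2.
Proof. by rewrite mxE; apply: eq_bigr => i _; rewrite mxE expr2. Qed.

Lemma gaussian_pdf_scalar mu (s : R) y : gaussian_pdf mu s%:M y =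
  (Num.sqrt ((2 * pi) ^+ d * \det (s%:M : 'M[R]_d)))^-1 *
  expR (- (s^-1 * \sum_i (y - mu) ord0 i ^+ 2) / 2).
Proof.
by rewrite /gaussian_pdf invmx_scalar mul_mx_scalar -scalemxAl mxE row_mul_trE.
Qed.

(** In the expansion of |y - a x|^2 / s, the term in y alone is the density of K 0, the cross term
    gives w = (a / s) y, and the term in x alone gives b = a^2 / s. The normalizing constants cancel
    since the covariance does not depend on x. *)
Lemma gaussian_kernel_exp_family (K : 'rV[R]_d -> {measure set 'rV[R]_d -> \bar R})
    (a s : R) : s != 0 ->
  (forall x, has_density (K x) (gaussian_pdf (a *: x) s%:M)) ->
  forall x A, measurable A -> (K x A = \int[K 0%R]_(y in A)
    (expR (expo (scale_rV (a / s)) y x - a ^+ 2 / s / 2 * \sum_i x ord0 i ^+ 2))%:E)%E.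
Proof.
move=> s0 Kg x A mA; have [mq0 q0 K0E] := Kg 0; have [mqx qx KxE] := Kg x.
have mw := measurable_scale_rV (a / s).
rewrite KxE// [RHS]integral_mkcond (integral_density mq0 q0 K0E).
- rewrite [LHS]integral_mkcond; apply: eq_integral => y _ /=.
  rewrite !patchE; case: ifP => _; last by rewrite mule0.
  rewrite -EFinM !gaussian_pdf_scalar; congr EFin.
  rewrite -[RHS]mulrA -expRD; congr (_ * expR _).
  pose Y := \sum_i y ord0 i ^+ 2; pose XY := \sum_i x ord0 i * y ord0 i.
  have -> : \sum_i (y - a *: x) ord0 i ^+ 2 =
      Y - 2 * a * XY + a ^+ 2 * \sum_i x ord0 i ^+ 2.
    rewrite !mulr_sumr -sumrN -!big_split; apply: eq_bigr => i _.
    by rewrite /= !mxE; ring.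
  have -> : \sum_i (y - a *: 0) ord0 i ^+ 2 = Y.
    by apply: eq_bigr => i _; rewrite !mxE mulr0 subr0.
  have -> : expo (scale_rV (a / s)) y x = a / s * XY.
    by rewrite mulr_sumr; apply: eq_bigr => i _; rewrite mxE; ring.
  by field.
- by move=> y; rewrite patchE; case: ifP => // _; rewrite lee_fin expR_ge0.
- apply/(measurable_restrict _ mA measurableT); rewrite setTI.
  apply: measurable_funTS; apply/measurable_EFinP/measurableT_comp => //.
  by apply: measurable_funB => //; exact: measurable_expo.
Qed.

End gaussian_kernel.

(** * Nonnegativity of Poincare constants *)

Section poincare_constant.
Context {R : realType} {d : nat}.
Hypothesis d_gt0 : (0 < d)%N.
Variables (p : probability 'rV[R]_d R) (q : 'rV[R]_d -> R).
Hypothesis pq : has_density p q.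

(** A bounded smooth test function whose gradient, -2 x exp(-|x|^2), vanishes at the origin only. *)
Let bump (x : 'rV[R]_d) : R := expR (- \sum_i x ord0 i ^+ 2).

Let Cu k : Ck k (fun x : 'rV[R]_d => - \sum_i x ord0 i ^+ 2).
Proof.
have Cs : Ck k (fun x : 'rV[R]_d => \sum_i x ord0 i ^+ 2).
  apply: Ck_sum => i; apply: eq_Ck (CkM (Ck_coord k i) (Ck_coord k i)) => x.
  by rewrite expr2.
apply: eq_Ck (CkM (Ck_cst k (- 1)) Cs) => x.
by rewrite mulN1r.
Qed.

Let sqnorm_grad_bump_eq0 x : sqnorm_grad bump x = 0 -> x = 0.
Proof.
have [du _] := Cu 1.
have pu i : partial i (fun x : 'rV[R]_d => - \sum_i x ord0 i ^+ 2) x =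
    - (2 * x ord0 i).
  have [|_ /(_ i)//] := @quadratic_differentiable R d
    (fun x : 'rV[R]_d => - \sum_i x ord0 i ^+ 2) x (fun i => - (2 * x ord0 i)) d%:R.
  move=> v _; rewrite [X in `|X|](_ : _ = - \sum_i v ord0 i ^+ 2); last first.
    rewrite opprK addrC addrA -!sumrN -!big_split/=.
    by apply: eq_bigr => i' _; rewrite !mxE; ring.
  rewrite normrN mulr_natl -[X in _ *+ X](card_ord d) -sumr_const.
  rewrite ger0_norm ?sumr_ge0// => [|i' _]; last exact: sqr_ge0.
  apply: ler_sum => i' _; rewrite -[leLHS]real_normK ?num_real//.
  by rewrite lerXn2r ?nnegrE// rV_coord_le_norm.
move=> /eqP; rewrite psumr_eq0 => [/allP z|i _]; last exact: sqr_ge0.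
apply/rowP => i; rewrite mxE; have := z i (mem_index_enum _).
rewrite /= sqrf_eq0 partial_expR// pu mulf_eq0 gt_eqF ?expR_gt0//=.
by rewrite oppr_eq0 mulf_eq0 pnatr_eq0/= => /eqP.
Qed.

Let measurable_origin : measurable [set (0 : 'rV[R]_d)].
Proof.
rewrite (_ : [set _] = \bigcap_(i in [set: 'I_d])
    ((fun x : 'rV[R]_d => x ord0 i : R) @^-1` [set 0])).
  apply: fin_bigcap_measurable => // i _; rewrite -[X in measurable X]setTI.
  by apply: measurable_rV_coord => //; exact: measurable_set1.
apply/seteqP; split=> [x -> i _|x x0]; first by rewrite /= mxE.
by apply/rowP => i; rewrite mxE; exact: x0.
Qed.

Let lebesgue_origin : lebesgue_rV d [set (0 : 'rV[R]_d)] = 0%E.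
Proof.
rewrite (_ : [set _] = [set x : 'rV[R]_d | forall i, [set (0 : R)] (x ord0 i)]).
  rewrite (@lebesgue_rV_box R d (fun=> [set 0]) (fun=> measurable_set1 _)).
  rewrite (bigD1 (Ordinal d_gt0))//= lebesgue_measure_set1.
  by rewrite mul0e.
apply/seteqP; split=> [x -> i|x x0]; first by rewrite /= mxE.
by apply/rowP => i; rewrite mxE; exact: x0.
Qed.

Let measure_origin : p [set (0 : 'rV[R]_d)] = 0%E.
Proof.
have [mq q0 ->//] := pq; apply: null_set_integral => //.
exact/measurable_EFinP/measurable_funTS.
Qed.

(** Zero energy would concentrate p on the origin, which is null for a law with a density in
    positive dimension. *)
Let energy_gt0 : (0 < \int[p]_x (sqnorm_grad bump x)%:E)%E.
Proof.
have Cb : Ck 1 bump by exact: Ck_expR (Cu 1).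
rewrite lt0e integral_ge0 ?andbT; last by move=> x _; rewrite lee_fin sqnorm_grad_ge0.
apply/eqP => E0.
have : ae_eq p setT (fun x => (sqnorm_grad bump x)%:E) (cst 0%E).
  apply/(ae_eq_integral_abs _ measurableT); first by apply/measurable_EFinP; exact: measurable_sqnorm_grad Cb.
  by rewrite -[RHS]E0; apply: eq_integral => x _; rewrite gee0_abs// lee_fin sqnorm_grad_ge0.
move=> [N [mN N0 subN]].
have pC : p (~` [set (0 : 'rV[R]_d)]) = 0%E.
  apply/eqP; rewrite eq_le measure_ge0 andbT -N0 le_measure ?inE//.
    exact: measurableC.
  move=> x x0; apply: subN => /= /(_ I)[] /sqnorm_grad_bump_eq0; exact: x0.
pose O : set 'rV[R]_d := [set 0].
have U2 : (p (O `|` ~` O) <= p O + p (~` O))%E.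
  by apply: measureU2 => //; exact: measurableC.
by move: U2; rewrite measure_origin pC adde0 setUv probability_setT lee_fin ler10.
Qed.

(** With a negative C, the right side of the inequality for [bump] would be negative, below a
    variance. *)
Lemma poincare_constant_ge0 C : poincare p C -> 0 <= C.
Proof.
move=> pC; rewrite leNgt; apply/negP => C_lt0.
have Cb k : Ck k bump by exact: Ck_expR (Cu k).
have b2 : bump \in Lfun p 2%:E.
  apply: (@Lfun2_bounded _ _ _ _ _ 1); first exact: Ck_measurable (Cb 0).
  move=> x; rewrite ger0_norm ?expR_ge0// -expR0 ler_expR oppr_le0.
  by apply: sumr_ge0 => i _; exact: sqr_ge0.
have := le_trans (variance_ge0 _ _) (pC _ Cb b2).
by rewrite leNgt nmule_rlt0 ?lte_fin// energy_gt0.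
Qed.

End poincare_constant.

Section gaussian_channel.
Context {R : realType} {d : nat} dO (Omega : measurableType dO).
Variables (alpha : R) (Pr : probability Omega R).
Variables (X0 XT : {RV Pr >-> 'rV[R]_d}) (K : R.-pker 'rV[R]_d ~> 'rV[R]_d).
Variable p : probability 'rV[R]_d R.
Hypothesis alpha0 : 0 < alpha.
Hypothesis alpha1 : alpha < 1.
Hypothesis X0_law : forall A, measurable A -> distribution Pr X0 A = p A.
Hypothesis XT_given_X0 : cond_law X0 XT K.
Hypothesis K_gaussian : forall x,
  is_gaussian (K x) (Num.sqrt alpha *: x) ((1 - alpha)%:M).

Lemma gaussian_channel_exp_family x A : measurable A ->
  (K x A = \int[K 0%R]_(y in A)
    (expR (expo (scale_rV (Num.sqrt alpha / (1 - alpha))) y x -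
      alpha / (1 - alpha) / 2 * \sum_i x ord0 i ^+ 2))%:E)%E.
Proof.
move=> mA; have Kg z := (K_gaussian z).2.
rewrite (gaussian_kernel_exp_family _ Kg)//; last by rewrite gt_eqF// subr_gt0.
by rewrite sqr_sqrtr// ltW.
Qed.

Lemma gaussian_channel_correlation (CP : R) : poincare p CP -> 0 <= CP ->
  forall f g, f \in Lfun (distribution Pr X0) 2%:E ->
  g \in Lfun (distribution Pr XT) 2%:E ->
  rcov Pr (f \o X0) (g \o XT) ^+ 2 <= alpha * CP / (1 - alpha + alpha * CP) *
    (rcov Pr (f \o X0) (f \o X0) * rcov Pr (g \o XT) (g \o XT)).
Proof.
move=> pCP CP0 f g f2 g2; have s0 : 0 < 1 - alpha by rewrite subr_gt0.
have -> : alpha * CP / (1 - alpha + alpha * CP) =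
    alpha / (1 - alpha) * CP / (1 + alpha / (1 - alpha) * CP).
  field; rewrite (gt_eqF s0) gt_eqF//= ltr_wpDr// mulr_ge0// ltW//.
apply: (correlation_bound XT_given_X0 (measurable_scale_rV _)
  gaussian_channel_exp_family) => //.
  by rewrite divr_ge0// ltW.
move=> F sF F2.
have F2p : F \in Lfun p 2%:E by exact: (eq_measure_Lfun2 X0_law).
by rewrite (eq_measure_rcov X0_law) -variance_rcov//
  (eq_measure_integralT X0_law); exact: pCP.
Qed.

End gaussian_channel.

(** * Poincare inequality of the standard normal law *)

Section standard_normal.
Context {R : realType}.

Definition std_normal : probability (measurableTypeR R) R := normal_prob 0 1.

Definition std_pdf (x : R) : R := normal_pdf 0 1 x.

Lemma std_pdfE x : std_pdf x = normal_peak 1 * expR (- x ^+ 2 / 2).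
Proof.
by rewrite /std_pdf /normal_pdf oner_eq0 /normal_fun subr0 expr1n mulr2n.
Qed.

Lemma std_pdf_ge0 x : 0 <= std_pdf x.
Proof. exact: normal_pdf_ge0. Qed.

Lemma std_pdfN x : std_pdf (- x) = std_pdf x.
Proof. by rewrite !std_pdfE sqrrN. Qed.

Lemma measurable_std_pdf : measurable_fun setT std_pdf.
Proof. exact: measurable_normal_pdf. Qed.

Lemma ge0_integral_std (f : R -> \bar R) : (forall x, 0 <= f x)%E ->
  measurable_fun setT f ->
  (\int[std_normal]_x f x = \int[lebesgue_measure]_x ((std_pdf x)%:E * f x))%E.
Proof.
by move=> f0 mf; apply: integral_density => //;
  [exact: measurable_std_pdf|exact: std_pdf_ge0].
Qed.

Lemma ge0_integral_lebesgueN (f : R -> \bar R) : (forall x, 0 <= f x)%E ->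
  measurable_fun setT f ->
  (\int[lebesgue_measure]_x f (- x)%R = \int[lebesgue_measure]_x f x)%E.
Proof.
move=> f0 mf.
transitivity (\int[pushforward lebesgue_measure
    (-%R : _ -> measurableTypeR R)]_x f x)%E.
  by rewrite ge0_integral_pushforward.
by apply: eq_measure_integral => A mA _; exact: lebesgue_measureN.
Qed.

Lemma ge0_integral_stdN (f : R -> \bar R) : (forall x, 0 <= f x)%E ->
  measurable_fun setT f ->
  (\int[std_normal]_x f (- x)%R = \int[std_normal]_x f x)%E.
Proof.
move=> f0 mf; have mfN : measurable_fun setT (fun x : R => f (- x)%R).
  exact: measurableT_comp.
rewrite (ge0_integral_std _ mfN)// (ge0_integral_std f0 mf).
pose G x := ((std_pdf x)%:E * f x)%E.
have G0 x : (0 <= G x)%E by rewrite mule_ge0// lee_fin std_pdf_ge0.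
have mG : measurable_fun setT G.
  by apply: emeasurable_funM => //; apply/measurable_EFinP; exact: measurable_std_pdf.
rewrite -[RHS](ge0_integral_lebesgueN G0 mG).
by apply: eq_integral => x _; rewrite /G std_pdfN.
Qed.

Lemma std_pdfE' : std_pdf = fun x => normal_peak 1 * expR (- (x ^+ 2) / 2).
Proof. by apply/funext => x; exact: std_pdfE. Qed.

Lemma is_derive_std_pdf (x : R) :
  is_derive x (1 : R) std_pdf (- (x * std_pdf x)).
Proof.
rewrite std_pdfE'.
have du : is_derive x (1 : R) (fun x : R => - (x ^+ 2) / 2) (- x).
  by apply: is_derive_eq; rewrite /GRing.scale/=; field.
have de := is_derive1_comp (is_derive_expR _) du.
have -> : - (x * (normal_peak 1 * expR (- x ^+ 2 / 2))) =
   normal_peak 1 *: (expR (- x ^+ 2 / 2) * - x) by rewrite /GRing.scale/=; ring.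
exact: is_deriveZ.
Qed.

Lemma continuous_std_pdf : continuous std_pdf.
Proof. by apply: continuous_normal_pdf; exact: oner_neq0. Qed.

Lemma cvg_std_pdfy : std_pdf x @[x --> +oo%R] --> 0.
Proof.
rewrite std_pdfE' -[X in _ --> X](mulr0 (normal_peak 1)).
apply: cvgM; first exact: cvg_cst.
rewrite (_ : (fun x => _) = gauss_fun \o (fun x => x * (Num.sqrt 2)^-1)).
  apply: cvg_comp; last exact: cvg_gauss_fun.
  by apply: gt0_cvgMly; [rewrite invr_gt0 sqrtr_gt0|exact: cvg_id].
apply/funext => x; rewrite /gauss_fun /= exprMn exprVn sqr_sqrtr//.
by rewrite mulNr.
Qed.

(** The function [- std_pdf] is an antiderivative of x [std_pdf x] and vanishes at infinity. *)
Lemma integral_id_std_pdf (s : R) : 0 <= s ->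
  (\int[lebesgue_measure]_(x in `[s, +oo[) (x * std_pdf x)%:E = (std_pdf s)%:E)%E.
Proof.
move=> s0; have dF (x : R) : is_derive x (1 : R) (fun x => - std_pdf x) (x * std_pdf x).
  rewrite -[x * _]opprK; apply: is_deriveN; exact: is_derive_std_pdf.
rewrite (@ge0_continuous_FTC2y _ _ (fun x => - std_pdf x) s 0).
- by rewrite -EFinB opprK add0r.
- by move=> x sx; rewrite mulr_ge0 ?std_pdf_ge0// (le_trans s0).
- apply: continuous_subspaceT => x; apply: cvgM; first exact: cvg_id.
  exact: continuous_std_pdf.
- by rewrite -oppr0; apply: cvgN; exact: cvg_std_pdfy.
- by move=> x _; exact: (@ex_derive _ _ _ _ _ _ _ (dF x)).
- apply: cvg_at_right_filter; apply: cvgN; exact: continuous_std_pdf.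
- by move=> x _; rewrite derive1E (@derive_val _ _ _ _ _ _ _ (dF x)).
Qed.

End standard_normal.

(** * Mean excess of a standard normal variable over a level *)

Section normal_excess.
Context {R : realType}.
Local Notation gam := (@std_normal R).
Local Notation phi := (@std_pdf R).

Definition pos (t : R) : R := Num.max t 0.

Lemma pos_ge0 t : 0 <= pos t.
Proof. by rewrite /pos le_max lexx orbT. Qed.

Lemma posBN t : pos t - pos (- t) = t.
Proof. by rewrite /pos; case: (leP t 0) => t0; case: (leP (- t) 0) => t0'; lra. Qed.

Lemma measurable_pos : measurable_fun setT pos.
Proof. exact: measurable_maxr. Qed.

(** The stop-loss transform E (Z - s)^+ of the standard normal law. *)
Definition excess (s : R) : \bar R := (\int[gam]_x (pos (x - s))%:E)%E.

Let mposB s : measurable_fun setT (fun x : R => (pos (x - s))%:E).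
Proof.
apply/measurable_EFinP; apply: measurableT_comp; first exact: measurable_pos.
exact: measurable_funB.
Qed.

(** The normal law has no atoms. Reflection turns ]-oo, s[ into an open upper tail, whereas
    [excess_balance] is stated with closed ones. *)
Lemma std_prob_upper (s : R) : gam `]s, +oo[%classic = gam `[s, +oo[%classic.
Proof.
rewrite /std_normal /= /normal_prob; apply: integral_itv_obnd_cbnd.
by apply/measurable_EFinP; apply: measurable_funTS; exact: measurable_std_pdf.
Qed.

Lemma std_probN (A B : set R) : measurable A -> measurable B ->
  (forall x, A (- x) <-> B x) -> gam A = gam B.
Proof.
move=> mA mB AB.
have gamE C : measurable C -> gam C = (\int[gam]_x (\1_C x : R)%:E)%E.
  by move=> mC; rewrite integral_indic// setIT.
rewrite (gamE _ mA) (gamE _ mB).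
have m1 : measurable_fun setT (fun x : R => (\1_A x : R)%:E).
  by apply/measurable_EFinP; exact: measurable_indic.
rewrite -(ge0_integral_stdN _ m1) => [|x]; last by rewrite lee_fin.
apply: eq_integral => x _; rewrite !indicE.
by have -> : (- x \in A) = (x \in B) by apply/idP/idP; rewrite !inE => /AB.
Qed.

(** Pointwise, (x - s)^+ + s 1_{x >= s} = x 1_{x >= s}, and the integral of x phi(x) over [s, +oo[
    is phi(s). *)
Lemma excess_tail (s : R) : 0 <= s ->
  (excess s + s%:E * gam `[s, +oo[%classic = (phi s)%:E)%E.
Proof.
move=> s0; rewrite -integral_id_std_pdf//.
have m1 : measurable_fun setT (fun x : R => (s * \1_(`[s, +oo[%classic) x)%:E).
  by apply/measurable_EFinP/measurable_funM => //; exact: measurable_indic.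
have s1 x : 0 <= s * (\1_(`[s, +oo[%classic) x : R) by rewrite mulr_ge0.
have -> : (s%:E * gam `[s, +oo[%classic =
    \int[gam]_x (s * \1_(`[s, +oo[%classic) x)%:E)%E.
  under eq_integral do rewrite EFinM.
  rewrite ge0_integralZl//; last by apply/measurable_EFinP; exact: measurable_indic.
  by rewrite integral_indic// setIT.
rewrite /excess -ge0_integralD//; try by move=> x _; rewrite lee_fin ?pos_ge0.
  2: exact: mposB.
rewrite ge0_integral_std; last 2 first.
- by move=> x; rewrite -EFinD lee_fin addr_ge0// pos_ge0.
- exact: emeasurable_funD.
rewrite [RHS]integral_mkcond; apply: eq_integral => x _.
rewrite patchE indicE mem_setE in_itv/= andbT -EFinD -EFinM mulrC.
case: leP => sx; first by rewrite /pos max_l ?subr_ge0// mulr1 subrK.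
by rewrite /pos max_r ?subr_le0 1?ltW// mulr0 addr0 mul0r.
Qed.

Lemma excess_le (s : R) : 0 <= s -> (excess s <= (phi s)%:E)%E.
Proof.
by move=> s0; rewrite -excess_tail// leeDl// mule_ge0.
Qed.

Lemma excess_ge0 s : (0 <= excess s)%E.
Proof. by apply: integral_ge0 => x _; rewrite lee_fin pos_ge0. Qed.

Lemma excess_fin_num (s : R) : 0 <= s -> excess s \is a fin_num.
Proof.
move=> s0; rewrite ge0_fin_numE ?excess_ge0//.
by rewrite (le_lt_trans (excess_le s0))// ltry.
Qed.

Lemma excessN (s : R) : excess (- s) = (\int[gam]_x (pos (s - x))%:E)%E.
Proof.
rewrite /excess -(ge0_integral_stdN _ (mposB (- s))) => [|x].
  by apply: eq_integral => x _; rewrite opprK addrC.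
by rewrite lee_fin pos_ge0.
Qed.

Lemma excess_diff (s : R) : 0 <= s -> (excess (- s) = excess s + s%:E)%E.
Proof.
move=> s0; have e0 : excess 0 \is a fin_num by exact: excess_fin_num.
have mp (g : R -> R) : measurable_fun setT g -> measurable_fun setT (pos \o g).
  by move=> mg; apply: measurableT_comp => //; exact: measurable_pos.
have gD (f g : R -> R) : measurable_fun setT f -> measurable_fun setT g ->
    (forall x, 0 <= f x) -> (forall x, 0 <= g x) ->
    (\int[gam]_x (f x)%:E + \int[gam]_x (g x)%:E =
     \int[gam]_x (f x + g x)%:E)%E.
  move=> mf mg f0 g0; under [RHS]eq_integral do rewrite EFinD.
  rewrite ge0_integralD//; try by move=> x _; rewrite lee_fin.
  - exact/measurable_EFinP.
  - exact/measurable_EFinP.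
have cs : (\int[gam]_x s%:E = s%:E)%E.
  by rewrite integral_cst// [X in (_ * X)%E](_ : _ = 1%E) ?mule1//; exact: probability_setT.
(* Adding [excess 0], the mean of x^+ as well as of (-x)^+, replaces a signed integral by the
   identity (s - x)^+ + x^+ = (x - s)^+ + s + (-x)^+ between nonnegative functions. *)
suff : (excess (- s) + excess 0 = (excess s + s%:E) + excess 0)%E.
  by move=> E; rewrite -[LHS](addeK _ e0) E addeK.
have e0N : excess 0 = (\int[gam]_x (pos (0 - x))%:E)%E by rewrite -excessN oppr0.
rewrite excessN [in RHS]e0N /excess -[in RHS]cs.
have mBl t : measurable_fun setT (fun x : R => pos (x - t)).
  by apply: (mp (fun x => x - t)); exact: measurable_funB.
have mBr t : measurable_fun setT (fun x : R => pos (t - x)).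
  by apply: (mp (fun x => t - x)); exact: measurable_funB.
have p0 t : 0 <= pos t := pos_ge0 t.
rewrite (gD (fun x => pos (s - x)) (fun x => pos (x - 0)))//.
rewrite (gD (fun x => pos (x - s)) (fun=> s))//.
rewrite (gD (fun x => pos (x - s) + s) (fun x => pos (0 - x)))//.
- apply: eq_integral => x _; congr EFin.
  by have := posBN (s - x); have := posBN x; rewrite opprB subr0 sub0r /=; lra.
- exact: measurable_funD.
- by move=> x; rewrite addr_ge0.
Qed.

Lemma std_prob_setC (s : R) :
  (gam `]-oo, s[%classic + gam `[s, +oo[%classic = 1)%E.
Proof.
rewrite -measureU//.
  rewrite (_ : _ `|` _ = setT); first exact: probability_setT.
  by apply/seteqP; split=> // x _; rewrite /= !in_itv/= andbT; case: (ltP x s); [left|right].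
by apply/seteqP; split=> // x /=; rewrite !in_itv/= andbT => -[/lt_geF ->].
Qed.

(** The left side is E (X - Y) 1_{Y < s <= X} for independent X and Y. For s >= 0 it reduces to
    [excess s] + s P(X >= s), because [excess (- s)] is [excess s] + s and the two probabilities add
    up to 1; reflection exchanges the two terms for s < 0. *)
Lemma excess_balance (s : R) :
  (excess s * gam `]-oo, s[%classic + excess (- s) * gam `[s, +oo[%classic =
   (phi s)%:E)%E.
Proof.
wlog s0 : s / 0 <= s.
  move=> H; have [|s_lt0] := leP 0 s; first exact: H.
  have Ns0 : 0 <= - s by rewrite oppr_ge0 ltW.
  rewrite -std_pdfN -(H _ Ns0) opprK addeC; congr (_ * _ + _ * _)%E.
    rewrite -std_prob_upper; apply: std_probN => // x /=.
    by rewrite !in_itv/= andbT; split; lra.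
  rewrite -std_prob_upper; apply: std_probN => // x /=.
  by rewrite !in_itv/= andbT; split; lra.
have e_fin := excess_fin_num s0.
have Q_fin : gam `[s, +oo[%classic \is a fin_num by rewrite fin_num_measure.
have P_fin : gam `]-oo, s[%classic \is a fin_num by rewrite fin_num_measure.
have Q0 : (0 <= gam `[s, +oo[%classic)%E by [].
have P0 : (0 <= gam `]-oo, s[%classic)%E by [].
rewrite excess_diff// (ge0_muleDl _ (excess_ge0 s)) ?lee_fin// addeA.
by rewrite -(ge0_muleDr _ P0 Q0) std_prob_setC mule1 excess_tail.
Qed.

End normal_excess.

Section normal_poincare.
Context {R : realType}.
Local Notation gam := (@std_normal R).
Local Notation phi := (@std_pdf R).
Local Notation mu := (@lebesgue_measure R).
Local Notation RR := (measurableTypeR R).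

Lemma measurable_natr_bool dT (T : measurableType dT) (f : T -> bool) :
  measurable_fun setT f -> measurable_fun setT (fun x => (f x)%:R : R).
Proof.
move=> mf; rewrite (_ : (fun x => _) = fun x => if f x then 1 else 0).
  by apply: measurable_fun_if => //; apply: measurable_funTS.
by apply/funext => x; case: (f x).
Qed.

(* Equal to [(x - y) * h s] if [y < s <= x] and to 0 otherwise; splitting [x - y]
   as [(x - s) + (s - y)] lets it be integrated in x and y separately. *)
Definition gap_kernel (h : R -> R) (x y s : R) : R :=
  (pos (x - s) * (y < s)%R%:R + pos (s - y) * (s <= x)%R%:R) * h s.

Section kernel.
Variable h : R -> R.
Hypothesis mh : measurable_fun setT h.
Hypothesis h0 : forall s, 0 <= h s.

Lemma gap_kernel_ge0 x y s : 0 <= gap_kernel h x y s.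
Proof. by rewrite mulr_ge0// addr_ge0// mulr_ge0// pos_ge0. Qed.

Lemma measurable_gap_kernel dT (T : measurableType dT) (a b c : T -> R) :
  measurable_fun setT a -> measurable_fun setT b -> measurable_fun setT c ->
  measurable_fun setT (fun t => gap_kernel h (a t) (b t) (c t)).
Proof.
move=> ma mb mc; apply: measurable_funM; last exact: measurableT_comp.
have mpos f : measurable_fun setT f -> measurable_fun setT (fun t : T => pos (f t)).
  by move=> mf; apply: measurableT_comp => //; exact: measurable_pos.
apply: measurable_funD; apply: measurable_funM.
- by apply: mpos; exact: measurable_funB.
- by apply: measurable_natr_bool; exact: measurable_fun_ltr.
- by apply: mpos; exact: measurable_funB.
- by apply: measurable_natr_bool; exact: measurable_fun_ler.
Qed.

Let gap_y (x s : R) : (\int[gam]_y (gap_kernel h x y s)%:E =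
  ((pos (x - s))%:E * gam `]-oo, s[%classic + (s <= x)%R%:R%:E * excess (- s)) *
    (h s)%:E)%E.
Proof.
have m1 : measurable_fun setT (fun y : RR => ((y < s)%R%:R)%:E : \bar R).
  by apply/measurable_EFinP/measurable_natr_bool/measurable_fun_ltr.
have m2 : measurable_fun setT (fun y : RR => (pos (s - y))%:E).
  apply/measurable_EFinP; apply: measurableT_comp; first exact: measurable_pos.
  exact: measurable_funB.
under eq_integral do rewrite /gap_kernel EFinM EFinD !EFinM.
rewrite ge0_integralZr ?lee_fin//; last 2 first.
- by apply: emeasurable_funD; [exact: emeasurable_funM|exact: emeasurable_funM].
- by move=> y _; rewrite -!EFinM -EFinD lee_fin addr_ge0 ?mulr_ge0 ?pos_ge0.
congr (_ * _)%E; rewrite ge0_integralD//;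
  try (by move=> y _; rewrite -!EFinM lee_fin mulr_ge0 ?pos_ge0);
  try exact: emeasurable_funM.
congr (_ + _)%E.
  rewrite ge0_integralZl ?lee_fin ?pos_ge0//; congr (_ * _)%E.
  rewrite -[LHS]/(\int[gam]_y ((y < s)%R%:R)%:E)%E.
  rewrite -[in RHS](setIT `]-oo, s[%classic) -integral_indic//.
  by apply: eq_integral => y _; rewrite indicE mem_setE in_itv.
rewrite ge0_integralZr//; first by rewrite muleC excessN.
by move=> y _; rewrite lee_fin pos_ge0.
Qed.

Let gap_xy (s : R) :
  (\int[gam]_x \int[gam]_y (gap_kernel h x y s)%:E = (phi s * h s)%:E)%E.
Proof.
under eq_integral do rewrite gap_y.
have m1 : measurable_fun setT (fun x : RR => ((s <= x)%R%:R)%:E : \bar R).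
  by apply/measurable_EFinP/measurable_natr_bool/measurable_fun_ler.
have m2 : measurable_fun setT (fun x : RR => (pos (x - s))%:E).
  apply/measurable_EFinP; apply: measurableT_comp; first exact: measurable_pos.
  exact: measurable_funB.
have p0 x : (0 <= (pos (x - s))%:E * gam `]-oo, s[%classic)%E.
  by rewrite mule_ge0// lee_fin pos_ge0.
have q0 x : (0 <= (s <= x)%R%:R%:E * excess (- s))%E.
  by rewrite mule_ge0// excess_ge0.
rewrite ge0_integralZr ?lee_fin//; last 2 first.
- by apply: emeasurable_funD; [exact: emeasurable_funM|exact: emeasurable_funM].
- by move=> y _; rewrite adde_ge0.
rewrite EFinM -excess_balance; congr (_ * _)%E.
rewrite ge0_integralD//; try exact: emeasurable_funM.
congr (_ + _)%E.
  rewrite ge0_integralZr//.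
  by move=> y _; rewrite lee_fin pos_ge0.
rewrite ge0_integralZr ?excess_ge0// muleC; congr (_ * _)%E.
rewrite -[in RHS](setIT `[s, +oo[%classic) -integral_indic//.
by apply: eq_integral => y _; rewrite indicE mem_setE in_itv/= andbT.
Qed.

Let fub3 (x : R) :
  (\int[gam]_y \int[mu]_s (gap_kernel h x y s)%:E =
   \int[mu]_s \int[gam]_y (gap_kernel h x y s)%:E)%E.
Proof.
apply: (fubini_tonelli (fun z : RR * RR => (gap_kernel h x z.1 z.2)%:E)).
- apply/measurable_EFinP; apply: measurable_gap_kernel => //.
- by move=> z; rewrite /= lee_fin gap_kernel_ge0.
Qed.

(** By [excess_balance] the kernel puts total weight phi(s) on the level s, so averaging over x and
    y turns Lebesgue measure in s into the normal law. *)
Lemma integral_gap_kernel :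
  (\int[gam]_x \int[gam]_y \int[mu]_s (gap_kernel h x y s)%:E =
   \int[gam]_s (h s)%:E)%E.
Proof.
under eq_integral do rewrite fub3.
rewrite ge0_integral_std; last 2 first.
- by move=> x; rewrite lee_fin.
- exact/measurable_EFinP.
transitivity (\int[mu]_s \int[gam]_x \int[gam]_y (gap_kernel h x y s)%:E)%E.
  apply: (fubini_tonelli (fun z : RR * RR =>
    \int[gam]_y (gap_kernel h z.1 y z.2)%:E)%E).
    apply: (measurable_fun_fubini_tonelli_F (m2 := gam)
      (fun w : (RR * RR) * RR => (gap_kernel h w.1.1 w.2 w.1.2)%:E)).
      by apply/measurable_EFinP; apply: measurable_gap_kernel => //;
        exact: measurableT_comp.
    by move=> w; rewrite /= lee_fin gap_kernel_ge0.
  by move=> z; apply: integral_ge0 => y _; rewrite lee_fin gap_kernel_ge0.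
by apply: eq_integral => s _; rewrite gap_xy EFinM.
Qed.

End kernel.

End normal_poincare.

Section normal_poincare_pair.
Context {R : realType}.
Local Notation gam := (@std_normal R).
Local Notation mu := (@lebesgue_measure R).
Local Notation RR := (measurableTypeR R).
Implicit Types h : R -> R.

Let gap_kernelE h (x y s : R) : gap_kernel h x y s =
  pos (x - y) * ((y < s) && (s <= x))%:R * h s.
Proof.
rewrite /gap_kernel /pos; congr (_ * _).
by case: (ltP y s) => ys; case: (leP s x) => sx;
  rewrite /= ?mulr0 ?mulr1 ?addr0 ?add0r;
  do ?case: (leP _ 0) => ?; lra.
Qed.

Lemma integral_gap_kernel_lt h (x y : R) : measurable_fun setT h ->
  (forall s, 0 <= h s) -> y < x -> (\int[mu]_s (gap_kernel h x y s)%:E =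
  (x - y)%:E * \int[mu]_(s in `[y, x]) (h s)%:E)%E.
Proof.
move=> mh h0 yx.
have pxy : pos (x - y) = x - y by rewrite /pos max_l// subr_ge0 ltW.
rewrite -integral_itv_obnd_cbnd; last first.
  by apply/measurable_EFinP; exact: measurable_funTS.
rewrite -ge0_integralZl//; last 3 first.
- by apply/measurable_EFinP; exact: measurable_funTS.
- by move=> s _; rewrite lee_fin.
- by rewrite lee_fin subr_ge0 ltW.
rewrite [RHS]integral_mkcond; apply: eq_integral => s _.
rewrite gap_kernelE pxy patchE mem_setE in_itv/=.
by case: ifP => _; rewrite ?mulr1 ?mulr0 ?mul0r -?EFinM.
Qed.

(** Expansion of the nonnegative integral of (f - c)^2 over [y, x], where c is the mean slope of
    F. *)
Let cauchy_schwarz_segment (F f : R -> R) (x y : R) :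
  (forall x, is_derive x (1 : R) F (f x)) -> continuous f -> y < x ->
  (((F x - F y) ^+ 2)%:E <=
    (x - y)%:E * \int[mu]_(s in `[y, x]) ((f s) ^+ 2)%:E)%E.
Proof.
move=> dF cf yx; have L0 : 0 < x - y by rewrite subr_gt0.
have cint (g : R -> R) : continuous g -> mu.-integrable `[y, x] (EFin \o g).
  move=> cg; apply: continuous_compact_integrable; first exact: segment_compact.
  exact: continuous_subspaceT.
have ftc : (\int[mu]_(s in `[y, x]) (f s)%:E = (F x - F y)%:E)%E.
  rewrite (@continuous_FTC2 _ f F)//.
  - exact: continuous_subspaceT.
  - have cF z : {for z, continuous F}.
      by apply/differentiable_continuous/derivable1_diffP; exact: (@ex_derive _ _ _ _ _ _ _ (dF z)).
    split.
    + by move=> z _; exact: (@ex_derive _ _ _ _ _ _ _ (dF z)).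
    + by apply: cvg_at_right_filter; exact: cF.
    + by apply: cvg_at_left_filter; exact: cF.
  - by move=> z _; rewrite derive1E (@derive_val _ _ _ _ _ _ _ (dF z)).
pose c := (F x - F y) / (x - y).
have if2 : mu.-integrable `[y, x] (EFin \o (fun s => f s ^+ 2)).
  apply: cint => z; rewrite (_ : (fun s => _) = f * f); last by apply/funext.
  by apply: cvgM; exact: cf.
have ifc : mu.-integrable `[y, x] (EFin \o (fun s => 2 * c * f s)).
  by apply: cint => z; apply: cvgM; [exact: cvg_cst|exact: cf].
have icc : mu.-integrable `[y, x] (EFin \o (fun=> c ^+ 2)).
  by apply: cint => z; exact: cvg_cst.
have J0 : 0 <= \int[mu]_(s in `[y, x]) (f s ^+ 2 - 2 * c * f s + c ^+ 2).
  apply: Rintegral_ge0 => s _; rewrite (_ : _ + _ = (f s - c) ^+ 2) ?sqr_ge0//.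
  by ring.
have iB : mu.-integrable `[y, x] (EFin \o (fun s => f s ^+ 2 - 2 * c * f s)).
  exact: eq_integrable (integrableB _ if2 ifc).
move: J0; rewrite RintegralD// RintegralB// RintegralZl//; last exact: cint.
rewrite [\int[mu]_(s in _) f s]/Rintegral ftc Rintegral_cst// => J0.
have muyx : fine (mu `[y, x]%classic) = x - y.
  by rewrite lebesgue_measure_itv/= lte_fin yx.
move: J0; rewrite muyx; set J := \int[mu]_(s in _) _ => J0.
have -> : (\int[mu]_(s in `[y, x]) (f s ^+ 2)%:E)%E = J%:E.
  by rewrite fineK//; exact: integrable_fin_num if2.
rewrite -EFinM lee_fin; move: J0.
have -> : J - 2 * c * (F x - F y) + c ^+ 2 * (x - y) =
    J - (F x - F y) ^+ 2 / (x - y) by rewrite /c; field; rewrite gt_eqF.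
by rewrite subr_ge0 ler_pdivrMr// mulrC.
Qed.

Let G h x y : \bar R := (\int[mu]_s (gap_kernel h x y s)%:E)%E.

Let mG h : measurable_fun setT h -> (forall s, 0 <= h s) ->
  measurable_fun setT (fun z : RR * RR => G h z.1 z.2).
Proof.
move=> mh h0; apply: (measurable_fun_fubini_tonelli_F (m2 := mu)
  (fun w : (RR * RR) * RR => (gap_kernel h w.1.1 w.1.2 w.2)%:E)).
  by apply/measurable_EFinP; apply: measurable_gap_kernel => //;
    exact: measurableT_comp.
by move=> w; rewrite /= lee_fin gap_kernel_ge0.
Qed.

Let G0 h x y : (forall s, 0 <= h s) -> (0 <= G h x y)%E.
Proof. by move=> h0; apply: integral_ge0 => s _; rewrite lee_fin gap_kernel_ge0. Qed.

(** The kernel vanishes unless y < x, so one term is taken for each order of the pair; each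
    contributes the integral of h. *)
Let double_gap h : measurable_fun setT h -> (forall s, 0 <= h s) ->
  (\int[gam]_x \int[gam]_y (G h x y + G h y x) =
   2%:E * \int[gam]_s (h s)%:E)%E.
Proof.
move=> mh h0; have mG' := mG mh h0; have G0' x y := G0 x y h0.
have mGx x : measurable_fun setT (fun y : RR => G h x y).
  exact: (measurableT_comp mG' (pair1_measurable x)).
have mGy x : measurable_fun setT (fun y : RR => G h y x).
  exact: (measurableT_comp mG' (pair2_measurable x)).
have mswap : measurable_fun setT (fun z : RR * RR => G h z.2 z.1).
  exact: (measurableT_comp mG' (@measurable_swap _ _ RR RR)).
under eq_integral do rewrite ge0_integralD//.
rewrite ge0_integralD//; first last.
- exact: (measurable_fun_fubini_tonelli_F (m2 := gam) (fun z => G h z.2 z.1)).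
- by move=> x _; exact: integral_ge0.
- exact: (measurable_fun_fubini_tonelli_F (m2 := gam) (fun z => G h z.1 z.2)).
- by move=> x _; exact: integral_ge0.
rewrite integral_gap_kernel// [X in (_ + X)%E](_ : _ = \int[gam]_s (h s)%:E)%E.
  by rewrite -mule2n mule_natl.
rewrite -(integral_gap_kernel mh h0).
exact: (fubini_tonelli (fun z : RR * RR => G h z.2 z.1)).
Qed.

Lemma normal_poincare (F f : R -> R) :
  (forall x, is_derive x (1 : R) F (f x)) -> continuous f ->
  (\int[gam]_x \int[gam]_y ((F x - F y) ^+ 2)%:E <=
   2%:E * \int[gam]_s (f s ^+ 2)%:E)%E.
Proof.
move=> dF cf; pose h s := f s ^+ 2.
have mf : measurable_fun setT f by exact: continuous_measurable_fun.
have mh : measurable_fun setT h by exact: measurable_funX.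
have h0 s : 0 <= h s by exact: sqr_ge0.
have cF : continuous F.
  by move=> z; apply/differentiable_continuous/derivable1_diffP;
    exact: (@ex_derive _ _ _ _ _ _ _ (dF z)).
have mF : measurable_fun setT F by exact: continuous_measurable_fun.
rewrite -(double_gap mh h0).
have mG' := mG mh h0; have G0' x y := G0 x y h0.
have mS : measurable_fun setT (fun z : RR * RR => (G h z.1 z.2 + G h z.2 z.1)%E).
  by apply: emeasurable_funD => //;
    exact: (measurableT_comp mG' (@measurable_swap _ _ RR RR)).
have mD : measurable_fun setT (fun z : RR * RR => ((F z.1 - F z.2) ^+ 2)%:E).
  by apply/measurable_EFinP; apply: measurable_funX; apply: measurable_funB;
    exact: measurableT_comp.
apply: ge0_le_integral => //.
- by move=> x _; apply: integral_ge0 => y _; rewrite lee_fin sqr_ge0.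
- apply: (measurable_fun_fubini_tonelli_F (m2 := gam)
    (fun z : RR * RR => ((F z.1 - F z.2) ^+ 2)%:E)) => // z.
  by rewrite /= lee_fin sqr_ge0.
- apply: (measurable_fun_fubini_tonelli_F (m2 := gam)
    (fun z : RR * RR => (G h z.1 z.2 + G h z.2 z.1)%E)) => // z.
  by rewrite /= adde_ge0.
move=> x _; apply: ge0_le_integral => //.
- by move=> y _; rewrite lee_fin sqr_ge0.
- exact: (measurableT_comp mD (pair1_measurable x)).
- exact: (measurableT_comp mS (pair1_measurable x)).
(* Off the diagonal the term matching the order of x and y suffices, by Cauchy-Schwarz; the other
   one is nonnegative. *)
move=> y _; have [yx|xy|->] := ltgtP y x.
- apply: (@le_trans _ _ (G h x y)); last by rewrite leeDl.
  by rewrite /G integral_gap_kernel_lt//; exact: cauchy_schwarz_segment.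
- apply: (@le_trans _ _ (G h y x)); last by rewrite leeDr.
  rewrite /G integral_gap_kernel_lt// -[(F x - F y) ^+ 2]sqrrN opprB.
  exact: cauchy_schwarz_segment.
- by rewrite subrr expr0n/= adde_ge0.
Qed.

(** For h = 1 the two gap terms add up to (x - y)^2 exactly, so this value comes from the same
    identity as the inequality. *)
Lemma normal_sqr_diff :
  (\int[gam]_x \int[gam]_y ((x - y) ^+ 2)%:E = 2%:E :> \bar R)%E.
Proof.
have m1 : measurable_fun setT (fun _ : R => 1 : R) by [].
have := double_gap m1 (fun=> ler01).
rewrite integral_cst// [X in (_ * (_ * X))%E](_ : _ = 1%E) ?mul1e ?mule1;
  last exact: probability_setT.
move=> <-; apply: eq_integral => x _; apply: eq_integral => y _.
have Glt (a b : R) : b < a -> G (fun=> 1) a b = ((a - b) ^+ 2)%:E.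
  move=> ba; rewrite /G integral_gap_kernel_lt// integral_cst// mul1e.
  have muE : mu `[b, a]%classic = (a - b)%:E.
    by rewrite lebesgue_measure_itv/= lte_fin ba.
  by rewrite expr2 EFinM; congr (_ * _)%E; exact: muE.
have Gge (a b : R) : a <= b -> G (fun=> 1) a b = 0%E.
  move=> ab; rewrite /G integral0_eq// => s _; rewrite gap_kernelE /pos max_r.
    by rewrite !mul0r.
  by rewrite subr_le0.
have [yx|xy] := ltP y x.
  by rewrite Glt// Gge ?ltW// adde0.
rewrite Gge// add0e; move: xy; rewrite le_eqVlt => /predU1P[->|xy].
  by rewrite Gge// subrr expr0n.
by rewrite Glt// -[(x - y) ^+ 2]sqrrN opprB.
Qed.

End normal_poincare_pair.

(** * Product laws and tensorization of the variance *)

Section prod_prob.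
Context d1 d2 (T1 : measurableType d1) (T2 : measurableType d2) (R : realType).
Variables (P1 : probability T1 R) (P2 : probability T2 R).
Local Open Scope ereal_scope.

Let prodT : (P1 \x P2) setT = 1.
Proof.
rewrite -setXTT product_measure1E//.
by rewrite -[1]mule1; congr (_ * _); exact: probability_setT.
Qed.

Definition prod_prob : probability (T1 * T2)%type R :=
  @measure_probability _ _ _ (P1 \x P2) prodT.

Lemma ge0_integral_prod_prob (f : T1 * T2 -> \bar R) :
  measurable_fun setT f -> (forall z, 0 <= f z) ->
  \int[prod_prob]_z f z = \int[P1]_x \int[P2]_y f (x, y).
Proof. by move=> mf f0; exact: (fubini_tonelli1 (m1 := P1) (m2 := P2) f). Qed.

Lemma measurable_ge0_integral_snd (f : T1 * T2 -> \bar R) :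
  measurable_fun setT f -> (forall z, 0 <= f z) ->
  measurable_fun setT (fun x => \int[P2]_y f (x, y)).
Proof. by move=> mf f0; exact: (measurable_fun_fubini_tonelli_F (m2 := P2) f). Qed.

Lemma ge0_integral_swap (f : T1 * T2 -> \bar R) :
  measurable_fun setT f -> (forall z, 0 <= f z) ->
  \int[P1]_x \int[P2]_y f (x, y) = \int[P2]_y \int[P1]_x f (x, y).
Proof. by move=> mf f0; exact: (fubini_tonelli (m1 := P1) (m2 := P2) f). Qed.

Lemma integral_prob_cst (r : \bar R) : 0 <= r -> \int[P1]__ r = r.
Proof.
move=> r0; rewrite integral_cst// [X in _ * X](_ : _ = 1) ?mule1//.
exact: probability_setT.
Qed.

End prod_prob.

Section tensorization.
Context d1 d2 (T1 : measurableType d1) (T2 : measurableType d2) (R : realType).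
Variables (mu : probability T1 R) (nu : probability T2 R) (F : T1 * T2 -> R).
Hypothesis mF : measurable_fun setT F.
Local Open Scope ereal_scope.

Local Notation W := (((T1 * T1)%type * T2)%type * T2)%type.
Local Notation Pi := (prod_prob (prod_prob (prod_prob mu mu) nu) nu).

(** For w = (((x, y), u), v), these are the values of F at the corners of a rectangle: a and e, at
    (x, u) and (y, v), form one diagonal, b and c the other. *)
Let a (w : W) : R := F (w.1.1.1, w.1.2).
Let b (w : W) : R := F (w.1.1.2, w.1.2).
Let c (w : W) : R := F (w.1.1.1, w.2).
Let e (w : W) : R := F (w.1.1.2, w.2).

Let mpair (f : W -> T1)
    (g : W -> T2) :
  measurable_fun setT f -> measurable_fun setT g ->
  measurable_fun setT (fun w => F (f w, g w)).
Proof.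
by move=> mf mg; apply: (measurableT_comp mF); exact/measurable_fun_pairP.
Qed.

Let m111 : measurable_fun setT (fun w : W => w.1.1.1).
Proof.
exact: (measurableT_comp measurable_fst (measurableT_comp measurable_fst
  measurable_fst)).
Qed.

Let m112 : measurable_fun setT (fun w : W => w.1.1.2).
Proof.
exact: (measurableT_comp measurable_snd (measurableT_comp measurable_fst
  measurable_fst)).
Qed.

Let m12 : measurable_fun setT (fun w : W => w.1.2).
Proof. exact: (measurableT_comp measurable_snd measurable_fst). Qed.

Let m2 : measurable_fun setT (fun w : W => w.2).
Proof. exact: measurable_snd. Qed.

Let ma : measurable_fun setT a. Proof. exact: mpair. Qed.
Let mb : measurable_fun setT b. Proof. exact: mpair. Qed.
Let mc : measurable_fun setT c. Proof. exact: mpair. Qed.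
Let me : measurable_fun setT e. Proof. exact: mpair. Qed.

Let sq (f g : W -> R) w : \bar R := ((f w - g w) ^+ 2)%:E.

Let sq0 f g w : 0 <= sq f g w. Proof. by rewrite lee_fin sqr_ge0. Qed.

Let msq f g : measurable_fun setT f -> measurable_fun setT g ->
  measurable_fun setT (sq f g).
Proof.
by move=> mf mg; apply/measurable_EFinP; apply: measurable_funX;
  exact: measurable_funB.
Qed.

Let iterE (f : W -> \bar R) : measurable_fun setT f ->
  (forall w, 0 <= f w) ->
  \int[Pi]_w f w = \int[mu]_x \int[mu]_y \int[nu]_u \int[nu]_v f (((x, y), u), v).
Proof.
move=> mf f0.
pose f3 z := \int[nu]_v f (z, v); pose f2 z := \int[nu]_u f3 (z, u).
have f30 z : 0 <= f3 z by exact: integral_ge0.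
have f20 z : 0 <= f2 z by exact: integral_ge0.
have mf3 : measurable_fun setT f3 by exact: measurable_ge0_integral_snd.
have mf2 : measurable_fun setT f2 by exact: measurable_ge0_integral_snd.
rewrite ge0_integral_prod_prob// -/f3.
by rewrite (ge0_integral_prod_prob _ _ mf3)// (ge0_integral_prod_prob _ _ mf2).
Qed.

Let sqF z z' : \bar R := ((F z - F z') ^+ 2)%:E.

Let sqF0 z z' : 0 <= sqF z z'. Proof. by rewrite lee_fin sqr_ge0. Qed.

Let msqF dT (T : measurableType dT) (f g : T -> T1 * T2) :
  measurable_fun setT f -> measurable_fun setT g ->
  measurable_fun setT (fun t => sqF (f t) (g t)).
Proof.
move=> mf mg; apply/measurable_EFinP; apply: measurable_funX.
by apply: measurable_funB; apply: (measurableT_comp mF).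
Qed.

Let mpr dT (T : measurableType dT) (f : T -> T1) (g : T -> T2) :
  measurable_fun setT f -> measurable_fun setT g ->
  measurable_fun setT (fun t => (f t, g t)).
Proof. by move=> mf mg; exact/measurable_fun_pairP. Qed.

Let mproj dA dB dC (A : measurableType dA) (B : measurableType dB)
    (C : measurableType dC) :
  [/\ measurable_fun setT (fun w : (A * B) * C => w.1.1),
      measurable_fun setT (fun w : (A * B) * C => w.1.2) &
      measurable_fun setT (fun w : (A * B) * C => w.2)].
Proof.
split; last exact: measurable_snd.
  exact: (measurableT_comp measurable_fst measurable_fst).
exact: (measurableT_comp measurable_snd measurable_fst).
Qed.

Let K x y := \int[nu]_u \int[nu]_v sqF (x, u) (y, v).

Let K0 x y : 0 <= K x y.
Proof. by do 2 (apply: integral_ge0 => ? _). Qed.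

Let mK : measurable_fun setT (fun z : T1 * T1 => K z.1 z.2).
Proof.
have m3 : measurable_fun setT (fun w : W => sqF (w.1.1.1, w.1.2) (w.1.1.2, w.2)).
  by apply: msqF; exact/measurable_fun_pairP.
have m2' := measurable_ge0_integral_snd nu m3 (fun w => sqF0 _ _).
have m2'0 (w : (T1 * T1) * T2) :
    0 <= \int[nu]_v sqF (w.1.1, w.2) (w.1.2, v) by exact: integral_ge0.
exact: (measurable_ge0_integral_snd nu m2' m2'0).
Qed.

(** The points (x, u) and (y, v) are independent with the product law; the four integrals are
    regrouped by Tonelli. *)
Let aeE : \int[Pi]_w sq a e w =
  \int[prod_prob mu nu]_z \int[prod_prob mu nu]_z' sqF z z'.
Proof.
rewrite (iterE (msq ma me) (sq0 _ _)).
have m4 : measurable_fun setT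
    (fun w : (T1 * T2) * (T1 * T2) => sqF w.1 w.2).
  by apply: msqF; [exact: measurable_fst|exact: measurable_snd].
rewrite ge0_integral_prod_prob; last 2 first.
- exact: (measurable_ge0_integral_snd (prod_prob mu nu) m4 (fun=> sqF0 _ _)).
- by move=> z; exact: integral_ge0.
apply: eq_integral => x _.
have mx : measurable_fun setT (fun w : (T2 * T1) * T2 => sqF (x, w.1.1) (w.1.2, w.2)).
  have [p1 p2 p3] := mproj T2 T1 T2.
  exact: (msqF (mpr (measurable_cst x) p1) (mpr p2 p3)).
have mx' := measurable_ge0_integral_snd nu mx (fun=> sqF0 _ _).
rewrite -(ge0_integral_swap nu mu mx' (fun=> integral_ge0 _ (fun _ _ => sqF0 _ _))).
apply: eq_integral => u _; rewrite ge0_integral_prod_prob//.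
by apply: msqF => //; exact: measurable_cst.
Qed.

(** Exchanging x and y maps one diagonal to the other. *)
Let bcE : \int[Pi]_w sq b c w = \int[Pi]_w sq a e w.
Proof.
rewrite (iterE (msq ma me) (sq0 _ _)) (iterE (msq mb mc) (sq0 _ _)).
transitivity (\int[mu]_x \int[mu]_y K y x); first by [].
have mK' : measurable_fun setT (fun z : T1 * T1 => K z.2 z.1).
  exact: (measurableT_comp mK (@measurable_swap _ _ T1 T1)).
exact: (ge0_integral_swap mu mu mK' (fun=> K0 _ _)).
Qed.

(** A side of the rectangle moves one coordinate only: two sides integrate to D1, the other two to
    D2. *)
Let D1 := \int[nu]_u \int[mu]_x \int[mu]_y sqF (x, u) (y, u).
Let D2 := \int[mu]_x \int[nu]_u \int[nu]_v sqF (x, u) (x, v).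

Let D1E : D1 = \int[mu]_x \int[mu]_y \int[nu]_u sqF (x, u) (y, u).
Proof.
have m3 : measurable_fun setT (fun w : (T2 * T1) * T1 => sqF (w.1.2, w.1.1) (w.2, w.1.1)).
  have [p1 p2 p3] := mproj T2 T1 T1.
  exact: (msqF (mpr p2 p1) (mpr p3 p1)).
have m2' := measurable_ge0_integral_snd mu m3 (fun=> sqF0 _ _).
rewrite /D1 (ge0_integral_swap nu mu m2' (fun=> integral_ge0 _ (fun _ _ => sqF0 _ _))).
apply: eq_integral => x _.
have mx : measurable_fun setT (fun w : T2 * T1 => sqF (x, w.1) (w.2, w.1)).
  exact: (msqF (mpr (measurable_cst x) measurable_fst)
    (mpr measurable_snd measurable_fst)).
exact: (ge0_integral_swap nu mu mx (fun=> sqF0 _ _)).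
Qed.

Let abE : \int[Pi]_w sq a b w = D1.
Proof.
rewrite (iterE (msq ma mb) (sq0 _ _)) D1E.
apply: eq_integral => x _; apply: eq_integral => y _; apply: eq_integral => u _.
by rewrite -[RHS](integral_prob_cst nu (sqF0 _ _)).
Qed.

Let ceE : \int[Pi]_w sq c e w = D1.
Proof.
rewrite (iterE (msq mc me) (sq0 _ _)) D1E.
apply: eq_integral => x _; apply: eq_integral => y _.
by rewrite -[RHS](integral_prob_cst nu)//; exact: integral_ge0.
Qed.

Let acE : \int[Pi]_w sq a c w = D2.
Proof.
rewrite (iterE (msq ma mc) (sq0 _ _)); apply: eq_integral => x _.
by rewrite -[RHS](integral_prob_cst mu)//; do 2 (apply: integral_ge0 => ? _).
Qed.

Let beE : \int[Pi]_w sq b e w = D2.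
Proof.
rewrite (iterE (msq mb me) (sq0 _ _)).
have D20 : 0 <= D2 by do 3 (apply: integral_ge0 => ? _).
rewrite -[RHS](integral_prob_cst mu D20).
by apply: eq_integral => x _; apply: eq_integral.
Qed.

(* Integrating [(a - e)^2 + (b - c)^2 <= (a - b)^2 + (c - e)^2 + (a - c)^2 +
   (b - e)^2], whose defect is [(a - b - c + e)^2], over two independent copies. *)
Lemma tensorization :
  \int[prod_prob mu nu]_z \int[prod_prob mu nu]_z' ((F z - F z') ^+ 2)%:E <=
  \int[nu]_u \int[mu]_x \int[mu]_y ((F (x, u) - F (y, u)) ^+ 2)%:E +
  \int[mu]_x \int[nu]_u \int[nu]_v ((F (x, u) - F (x, v)) ^+ 2)%:E.
Proof.
(* The inequality is doubled because both diagonals have the same mean and each of D1 and D2 is the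
   mean of two sides. *)
rewrite -/D1 -/D2 -[X in X <= _]aeE -(@lee_pmul2l _ 2%:E)// ?lte_fin//.
have two (r : \bar R) : 2%:E * r = r + r by rewrite -mule2n mule_natl.
rewrite !two -{2}bcE [leRHS]addeACA -{1}abE -{1}ceE -{1}acE -beE.
have mm f g := @msq f g.
rewrite -!ge0_integralD//; try exact: msq; try (by move=> w _; rewrite adde_ge0);
  try by apply: emeasurable_funD; exact: msq.
apply: ge0_le_integral => //.
- by move=> w _; rewrite adde_ge0.
- by apply: emeasurable_funD; exact: msq.
- by do ?apply: emeasurable_funD; exact: msq.
move=> w _; rewrite /sq -!EFinD lee_fin -subr_ge0.
rewrite [X in (0 <= X)%R](_ : _ = (a w - b w - c w + e w) ^+ 2)%R; first exact: sqr_ge0.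
by ring.
Qed.

End tensorization.

(** * Affine substitutions *)

Section affine_composition.
Context {R : realType}.

Lemma continuous_rV (T : topologicalType) n (f : T -> 'rV[R]_n) :
  (forall i, continuous (fun x => f x ord0 i)) -> continuous f.
Proof.
move=> cf x; apply/cvg_ballP => e e0.
have : \forall y \near x, forall i, ball (f x ord0 i) e (f y ord0 i).
  by apply: filter_forall => i; have /cvg_ballP := cf i x; apply.
by apply: filterS => y fxy; split=> // i j; rewrite ord1; exact: fxy.
Qed.

Lemma continuous_mulmxr m n (A : 'M[R]_(m, n)) :
  continuous (fun z : 'rV[R]_m => z *m A).
Proof.
apply: continuous_rV => i.
rewrite (_ : (fun z => _) = fun z : 'rV[R]_m => \sum_j z ord0 j * A j i).
  exact: continuous_sum_coord.
by apply/funext => z; rewrite mxE.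
Qed.

Lemma differentiable_affine m n (a : 'rV[R]_n) (A : 'M[R]_(m, n)) z :
  differentiable (fun z : 'rV[R]_m => a + z *m A) z.
Proof.
apply: differentiableD; first exact: differentiable_cst.
have cA : continuous (mulmxr A : 'rV[R]_m -> 'rV[R]_n) by exact: continuous_mulmxr.
exact: (linear_differentiable z cA).
Qed.

Lemma is_derive_line (V : normedModType R) (F : V -> R) (x v : V) (t : R) :
  derivable F (x + t *: v) v ->
  is_derive t (1 : R) (fun t => F (x + t *: v)) ('D_v F (x + t *: v)).
Proof.
have E : (fun h : R => h^-1 *: (((fun t => F (x + t *: v)) \o shift t) (h *: 1) -
      F (x + t *: v))) =
    (fun h : R => h^-1 *: ((F \o shift (x + t *: v)) (h *: v) - F (x + t *: v))).
  apply/funext => h /=; congr (_ *: (F _ - _)).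
  by rewrite -[h *: 1]/(h * 1) mulr1 scalerDl addrCA.
by move=> dF; split; [rewrite /derivable E|rewrite /derive E].
Qed.

Lemma diff_partialE n (F : 'rV[R]_n -> R) x v : differentiable F x ->
  'D_v F x = \sum_i v ord0 i * partial i F x.
Proof.
move=> dF; rewrite deriveE// {1}(row_sum_delta v) linear_sum.
by apply: eq_bigr => i _; rewrite linearZ /partial deriveE.
Qed.

(** A maps the i-th basis vector to its i-th row, so the partial derivative is a directional
    derivative of F along that row. *)
Lemma Ck1_affine m n (F : 'rV[R]_n -> R) (a : 'rV[R]_n) (A : 'M[R]_(m, n)) :
  Ck 1 F -> Ck 1 (fun z : 'rV[R]_m => F (a + z *m A)) /\
  forall i z, partial i (fun z : 'rV[R]_m => F (a + z *m A)) z =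
    \sum_j A i j * partial j F (a + z *m A).
Proof.
move=> [dF pF].
have pE i z : partial i (fun z : 'rV[R]_m => F (a + z *m A)) z =
    \sum_j A i j * partial j F (a + z *m A).
  transitivity ('D_(row i A) F (a + z *m A)); last first.
    by rewrite diff_partialE//; apply: eq_bigr => j _; rewrite mxE.
  have E : (fun h : R => h^-1 *: (((fun z : 'rV[R]_m => F (a + z *m A)) \o shift z)
        (h *: delta_mx ord0 i) - F (a + z *m A))) =
      (fun h => h^-1 *: ((F \o shift (a + z *m A)) (h *: row i A) - F (a + z *m A))).
    apply/funext => h /=; congr (_ *: (F _ - _)).
    by rewrite mulmxDl -scalemxAl -rowE addrCA.
  by rewrite /partial /derive E.
split=> //; split=> [z|i].
  apply: (differentiable_comp (f := fun z : 'rV[R]_m => a + z *m A)).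
    exact: differentiable_affine.
  exact: dF.
move=> z; rewrite (_ : partial i _ = fun z =>
    \sum_j partial j F (a + z *m A) * A i j); last first.
  by apply/funext => y; rewrite pE; apply: eq_bigr => j _; rewrite mulrC.
pose G (z : 'rV[R]_m) := \row_j partial j F (a + z *m A).
have cG : continuous G.
  apply: continuous_rV => j; rewrite (_ : (fun x => _) =
      partial j F \o (fun z : 'rV[R]_m => a + z *m A)).
    move=> y; apply: (@continuous_comp _ _ _ (fun z : 'rV[R]_m => a + z *m A)).
      exact/differentiable_continuous/differentiable_affine.
    exact: pF.
  by apply/funext => y; rewrite mxE.
rewrite (_ : (fun z => _) = (fun v : 'rV[R]_n => \sum_j v ord0 j * A i j) \o G).
  by apply: (@continuous_comp _ _ _ G); [exact: cG|exact: continuous_sum_coord].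
by apply/funext => y /=; apply: eq_bigr => j _; rewrite mxE.
Qed.

End affine_composition.

(** * The standard normal law on R^d and its Poincare inequality *)

Section gauss_rV.
Context {R : realType}.
Local Notation RR := (measurableTypeR R).

Section gauss_step.
Variables (d : nat) (m : probability 'rV[R]_d R).

Let mcons : measurable_fun setT (@rV_cons R d : RR * 'rV[R]_d -> 'rV[R]_d.+1).
Proof. exact: measurable_rV_cons. Qed.

Let stepT : image_measure (prod_prob (@std_normal R) m) mcons setT = 1%E.
Proof.
rewrite -[LHS]/(prod_prob (@std_normal R) m (_ @^-1` setT)) preimage_setT.
exact: probability_setT.
Qed.

Definition gauss_step : probability 'rV[R]_d.+1 R := measure_probability stepT.

Lemma ge0_integral_gauss_prod (f : 'rV[R]_d.+1 -> \bar R) :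
  measurable_fun setT f -> (forall x, 0 <= f x)%E ->
  (\int[gauss_step]_x f x =
   \int[prod_prob (@std_normal R) m]_w f (rV_cons w))%E.
Proof. by move=> mf f0; exact: (ge0_integral_pushforward mcons). Qed.

Lemma ge0_integral_gauss_step (f : 'rV[R]_d.+1 -> \bar R) :
  measurable_fun setT f -> (forall x, 0 <= f x)%E ->
  (\int[gauss_step]_x f x =
   \int[@std_normal R]_t \int[m]_z f (rV_cons (t, z)))%E.
Proof.
move=> mf f0; rewrite ge0_integral_gauss_prod//.
pose g (w : RR * 'rV[R]_d) : \bar R := f (rV_cons w).
have mg : measurable_fun setT g by exact: (measurableT_comp mf mcons).
exact: (ge0_integral_prod_prob (@std_normal R) m mg (fun w => f0 _)).
Qed.

End gauss_step.

(** Same recursion on coordinates as [lebesgue_rV], so that densities can be compared one coordinate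
    at a time. *)
Fixpoint gauss_rV d : probability 'rV[R]_d R :=
  if d is d'.+1 then gauss_step (gauss_rV d') else dirac (0 : 'rV[R]_0).

Lemma rV_cons0 d (t : R) (z : 'rV[R]_d) : (rV_cons (t, z)) ord0 ord0 = t.
Proof. exact: (congr1 fst (rV_consK (t, z))). Qed.

Lemma rV_consS d (t : R) (z : 'rV[R]_d) i :
  (rV_cons (t, z)) ord0 (lift ord0 i) = z ord0 i.
Proof.
have E : rsubmx (rV_cons (t, z) : 'rV[R]_(1 + d)) = z.
  exact: (congr1 snd (rV_consK (t, z))).
by rewrite -{2}E [RHS]mxE rshift1.
Qed.

Lemma rV_cons_line d (t : R) (z : 'rV[R]_d) :
  rV_cons (t, z) = rV_cons (0, z) + t *: delta_mx ord0 ord0.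
Proof.
have addZE (A D : 'rV[R]_d.+1) i : (A + t *: D) ord0 i = A ord0 i + t * D ord0 i.
  by rewrite !mxE.
have deltaE (i : 'I_d.+1) : (delta_mx ord0 ord0 : 'rV[R]_d.+1) ord0 i = (i == ord0)%:R.
  by rewrite mxE.
apply/rowP => i; rewrite addZE deltaE.
have [j|] := unliftP ord0 i => ->.
  by rewrite !rV_consS mulr0 addr0.
by rewrite !rV_cons0 eqxx mulr1 add0r.
Qed.

(** The matrix of z |-> (0, z), by which freezing the first coordinate becomes an affine
    substitution. *)
Definition lift_mx d : 'M[R]_(d, d.+1) := \matrix_(i, j) (lift ord0 i == j)%:R.

Lemma mulmx_lift_mx d (z : 'rV[R]_d) i :
  (z *m lift_mx d) ord0 (lift ord0 i) = z ord0 i.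
Proof.
rewrite mxE (bigD1 i)//= mxE eqxx mulr1 big1 ?addr0// => j ji.
by rewrite mxE (inj_eq lift_inj) (negbTE ji) mulr0.
Qed.

Lemma rV_cons_affine d (t : R) (z : 'rV[R]_d) :
  rV_cons (t, z) = rV_cons (t, 0) + z *m lift_mx d.
Proof.
apply/rowP => i; rewrite [RHS]mxE; have [j|] := unliftP ord0 i => ->.
  by rewrite mulmx_lift_mx !rV_consS mxE add0r.
rewrite !rV_cons0 mxE big1 ?addr0// => j _.
by rewrite mxE eq_sym (negbTE (neq_lift _ _)) mulr0.
Qed.

Lemma Ck1_rV_cons d (F : 'rV[R]_d.+1 -> R) (t : R) : Ck 1 F ->
  Ck 1 (fun z => F (rV_cons (t, z))) /\
  forall i z, partial i (fun z => F (rV_cons (t, z))) z =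
    partial (lift ord0 i) F (rV_cons (t, z)).
Proof.
move=> CF; have [C P] := Ck1_affine (rV_cons (t, 0)) (lift_mx d) CF.
rewrite (_ : (fun z => F (rV_cons (t, z))) =
    fun z => F (rV_cons (t, 0) + z *m lift_mx d)); last first.
  by apply/funext => z; rewrite -rV_cons_affine.
split=> // i z; rewrite P -rV_cons_affine (bigD1 (lift ord0 i))//= big1.
  by rewrite mxE eqxx mul1r addr0.
by move=> j ji; rewrite mxE eq_sym (negbTE ji) mul0r.
Qed.

Lemma gauss_rV_poincare d (F : 'rV[R]_d -> R) : Ck 1 F ->
  (\int[gauss_rV d]_x \int[gauss_rV d]_y ((F x - F y) ^+ 2)%:E <=
   2%:E * \int[gauss_rV d]_x (sqnorm_grad F x)%:E)%E.
Proof.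
elim: d F => [|d IH] F CF.
  rewrite integral0_eq ?mule_ge0 ?lee_fin//.
    by apply: integral_ge0 => x _; rewrite lee_fin sqnorm_grad_ge0.
  move=> x _; apply: integral0_eq => y _.
  by rewrite (_ : x = y) ?subrr ?expr0n//; apply/rowP => -[].
have mF := Ck_measurable CF.
have mcons : measurable_fun setT (@rV_cons R d : RR * 'rV[R]_d -> 'rV[R]_d.+1).
  exact: measurable_rV_cons.
pose G (w : RR * 'rV[R]_d) : R := F (rV_cons w).
have mG : measurable_fun setT G by exact: (measurableT_comp mF mcons).
have msq : measurable_fun setT (fun w : 'rV[R]_d.+1 * 'rV[R]_d.+1 =>
    ((F w.1 - F w.2) ^+ 2)%:E).
  apply/measurable_EFinP; apply: measurable_funX; apply: measurable_funB.
    exact: (measurableT_comp mF measurable_fst).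
  exact: (measurableT_comp mF measurable_snd).
have sq0 (x y : R) : (0 <= ((x - y) ^+ 2)%:E)%E by rewrite lee_fin sqr_ge0.
have g0 x : (0 <= (sqnorm_grad F x)%:E)%E by rewrite lee_fin sqnorm_grad_ge0.
have mg : measurable_fun setT (fun x => (sqnorm_grad F x)%:E).
  by apply/measurable_EFinP; exact: measurable_sqnorm_grad.
rewrite [X in (X <= _)%E]/= ge0_integral_gauss_prod; last 2 first.
- exact: (measurable_ge0_integral_snd (gauss_step (gauss_rV d)) msq
    (fun w => sq0 _ _)).
- by move=> x; apply: integral_ge0.
under eq_integral => w _.
  rewrite ge0_integral_gauss_prod; last 2 first.
  - exact: (measurableT_comp msq (pair1_measurable (rV_cons w))).
  - by [].
  over.
(* The first term is bounded by the one-dimensional inequality in t at fixed u, the second by the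
   induction hypothesis in u at fixed t; the squared gradient splits accordingly into [p0] and
   [ps]. *)
apply: (le_trans (tensorization (@std_normal R) (gauss_rV d) mG)).
pose p0 (w : RR * 'rV[R]_d) : R := partial ord0 F (rV_cons w) ^+ 2.
pose ps (w : RR * 'rV[R]_d) : R :=
  \sum_i partial (lift ord0 i) F (rV_cons w) ^+ 2.
have [dF pF] := CF.
have mp i : measurable_fun setT (fun w : RR * 'rV[R]_d =>
    partial i F (rV_cons w) ^+ 2).
  apply: measurable_funX; apply: (measurableT_comp _ mcons).
  exact: continuous_measurable_rV.
have mp0 : measurable_fun setT p0 by exact: mp.
have mps : measurable_fun setT ps by apply: measurable_sum => i; exact: mp.
have p00 w : (0 <= (p0 w)%:E)%E by rewrite lee_fin sqr_ge0.
have ps0 w : (0 <= (ps w)%:E)%E.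
  by rewrite lee_fin; apply: sumr_ge0 => i _; exact: sqr_ge0.
have rhsE : (\int[gauss_rV d.+1]_x (sqnorm_grad F x)%:E =
    \int[gauss_rV d]_u \int[@std_normal R]_t (p0 (t, u))%:E +
    \int[@std_normal R]_t \int[gauss_rV d]_u (ps (t, u))%:E)%E.
  rewrite /= ge0_integral_gauss_prod//.
  under eq_integral => w _.
    rewrite /sqnorm_grad big_ord_recl -/(p0 w) -/(ps w) EFinD.
    over.
  rewrite ge0_integralD//; [|exact/measurable_EFinP|exact/measurable_EFinP].
  rewrite ge0_integral_prod_prob//; last exact/measurable_EFinP.
  rewrite ge0_integral_prod_prob//; last exact/measurable_EFinP.
  congr (_ + _)%E.
  apply: (ge0_integral_swap (@std_normal R) (gauss_rV d) (f := EFin \o p0)) => //.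
  exact/measurable_EFinP.
rewrite rhsE ge0_muleDr; last 2 first.
- by apply: integral_ge0 => u _; apply: integral_ge0.
- by apply: integral_ge0 => u _; apply: integral_ge0.
have mswap : measurable_fun setT (fun w : 'rV[R]_d * RR => (w.2, w.1)).
  exact: (@measurable_swap _ _ 'rV[R]_d RR).
have mGc u : measurable_fun setT (fun t : RR => G (t, u)).
  exact: (measurableT_comp mG (pair2_measurable u)).
have mGr t : measurable_fun setT (fun u => G (t, u)).
  exact: (measurableT_comp mG (pair1_measurable t)).
apply: leeD.
  rewrite -ge0_integralZl//; last 2 first.
  - apply: (measurable_ge0_integral_snd (@std_normal R)
      (f := fun w : 'rV[R]_d * RR => (p0 (w.2, w.1))%:E)) => //.
    by apply/measurable_EFinP; exact: (measurableT_comp mp0 mswap).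
  - by move=> u _; apply: integral_ge0.
  apply: ge0_le_integral => //.
  - by move=> u _; do 2 (apply: integral_ge0 => ? _).
  - have m3 : measurable_fun setT (fun w : ('rV[R]_d * RR) * RR =>
        ((G (w.1.2, w.1.1) - G (w.2, w.1.1)) ^+ 2)%:E).
      apply/measurable_EFinP; apply: measurable_funX; apply: measurable_funB;
        apply: (measurableT_comp mG); apply/measurable_fun_pairP; split => /=.
      + exact: (measurableT_comp measurable_snd measurable_fst).
      + exact: (measurableT_comp measurable_fst measurable_fst).
      + exact: measurable_snd.
      + exact: (measurableT_comp measurable_fst measurable_fst).
    have m2 := measurable_ge0_integral_snd (@std_normal R) m3 (fun w => sq0 _ _).
    have m20 (w : 'rV[R]_d * RR) : (0 <= \int[@std_normal R]_y
        ((G (w.2, w.1) - G (y, w.1)) ^+ 2)%:E)%E by exact: integral_ge0.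
    exact: (measurable_ge0_integral_snd (@std_normal R) m2 m20).
  - apply: measurable_funeM; apply: (measurable_ge0_integral_snd (@std_normal R)
      (f := fun w : 'rV[R]_d * RR => (p0 (w.2, w.1))%:E)) => //.
    by apply/measurable_EFinP; exact: (measurableT_comp mp0 mswap).
  move=> u _; apply: (normal_poincare (F := fun t => F (rV_cons (t, u)))
    (f := fun t => partial ord0 F (rV_cons (t, u)))).
    move=> t; rewrite rV_cons_line.
    rewrite (_ : (fun t => _) =
      fun t => F (rV_cons (0, u) + t *: delta_mx ord0 ord0)); last first.
      by apply/funext => s; rewrite -rV_cons_line.
    by apply: is_derive_line; exact: diff_derivable.
  rewrite (_ : (fun t => _) = partial ord0 F \o
    (fun t => rV_cons (0, u) + t *: delta_mx ord0 ord0)); last first.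
    by apply/funext => s; rewrite /= -rV_cons_line.
  move=> t; apply: (@continuous_comp _ _ _
    (fun t : R => rV_cons (0, u) + t *: delta_mx ord0 ord0)); last exact: pF.
  apply: cvgD; first exact: cvg_cst.
  exact: scalel_continuous.
rewrite -ge0_integralZl//; last 2 first.
- apply: (measurable_ge0_integral_snd (gauss_rV d) (f := EFin \o ps)) => //.
  exact/measurable_EFinP.
- by move=> u _; apply: integral_ge0.
apply: ge0_le_integral => //.
- by move=> u _; do 2 (apply: integral_ge0 => ? _).
- have m3 : measurable_fun setT (fun w : (RR * 'rV[R]_d) * 'rV[R]_d =>
      ((G (w.1.1, w.1.2) - G (w.1.1, w.2)) ^+ 2)%:E).
    apply/measurable_EFinP; apply: measurable_funX; apply: measurable_funB;
      apply: (measurableT_comp mG); apply/measurable_fun_pairP; split => /=.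
    + exact: (measurableT_comp measurable_fst measurable_fst).
    + exact: (measurableT_comp measurable_snd measurable_fst).
    + exact: (measurableT_comp measurable_fst measurable_fst).
    + exact: measurable_snd.
  have m2 := measurable_ge0_integral_snd (gauss_rV d) m3 (fun w => sq0 _ _).
  have m20 (w : RR * 'rV[R]_d) : (0 <= \int[gauss_rV d]_y
      ((G (w.1, w.2) - G (w.1, y)) ^+ 2)%:E)%E by exact: integral_ge0.
  exact: (measurable_ge0_integral_snd (gauss_rV d) m2 m20).
- apply: measurable_funeM.
  apply: (measurable_ge0_integral_snd (gauss_rV d) (f := EFin \o ps)) => //.
  exact/measurable_EFinP.
move=> t _; have [Ct Pt] := Ck1_rV_cons t CF.
have E : (\int[gauss_rV d]_u (sqnorm_grad (fun z => F (rV_cons (t, z))) u)%:E =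
    \int[gauss_rV d]_u (ps (t, u))%:E)%E.
  by apply: eq_integral => u _; congr EFin; apply: eq_bigr => i _; rewrite Pt.
have := IH _ Ct; rewrite E; apply.
Qed.

End gauss_rV.

(** * Variance as a double integral, and covariances of the standard normal law *)

Section pair_variance.
Context d (T : measurableType d) (R : realType) (P : probability T R).
Implicit Types f : T -> R.

Lemma pair_rcov f : f \in Lfun P 2%:E ->
  (\int[P]_x \int[P]_y ((f x - f y) ^+ 2)%:E = (2 * rcov P f f)%:E)%E.
Proof.
move=> f2; set m := \int[P]_x f x; set M := \int[P]_x (f x * f x).
have if1 := Lfun2_integrable f2; have iff := Lfun2_integrableM f2 f2.
have cstE (r : R) : \int[P]_x r = r.
  rewrite Rintegral_cst// [X in _ * fine X](_ : _ = 1%E) ?mulr1//.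
  exact: probability_setT.
have icst (r : R) : P.-integrable setT (EFin \o (fun=> r)).
  exact: finite_measure_integrable_cst.
have mE : (\int[P]_x (f x)%:E = m%:E)%E by rewrite fineK//; exact: integrable_fin_num.
have ME : (\int[P]_x (f x * f x)%:E = M%:E)%E.
  by rewrite fineK//; exact: integrable_fin_num.
(* The inner and the outer integrand are both quadratic polynomials in f, so one formula serves
   twice. *)
have quad (a b c : R) : P.-integrable setT
      (EFin \o (fun x => a * (f x * f x) + b * f x + c)) /\
    (\int[P]_x (a * (f x * f x) + b * f x + c)%:E = (a * M + b * m + c)%:E)%E.
  have i1 : P.-integrable setT (EFin \o (fun x => a * (f x * f x))).
    exact: eq_integrable (integrableZl measurableT a iff).
  have i2 : P.-integrable setT (EFin \o (fun x => b * f x)).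
    exact: eq_integrable (integrableZl measurableT b if1).
  have i12 : P.-integrable setT (EFin \o (fun x => a * (f x * f x) + b * f x)).
    exact: eq_integrable (integrableD measurableT i1 i2).
  have i : P.-integrable setT (EFin \o (fun x => a * (f x * f x) + b * f x + c)).
    exact: eq_integrable (integrableD measurableT i12 (icst c)).
  split=> //; rewrite -[LHS]fineK; last exact: integrable_fin_num.
  rewrite -[fine _]/(\int[P]_x (a * (f x * f x) + b * f x + c)).
  by rewrite RintegralD// RintegralD// !RintegralZl// cstE.
have inner x : (\int[P]_y ((f x - f y) ^+ 2)%:E =
    (1 * (f x * f x) + (- (2 * m)) * f x + M)%:E)%E.
  rewrite (_ : (_ + M) = 1 * M + (- (2 * f x)) * m + f x * f x); last by ring.
  by rewrite -(quad _ _ _).2; apply: eq_integral => y _; congr EFin; ring.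
under eq_integral do rewrite inner.
by rewrite (quad _ _ _).2 /rcov -/m -/M; congr EFin; ring.
Qed.

(** Some section y |-> f x - f y is square-integrable, and f is the constant f x minus that
    section. *)
Lemma Lfun2_pair f : measurable_fun setT f ->
  (\int[P]_x \int[P]_y ((f x - f y) ^+ 2)%:E < +oo)%E -> f \in Lfun P 2%:E.
Proof.
move=> mf foo.
have m2 : measurable_fun setT (fun z : T * T => ((f z.1 - f z.2) ^+ 2)%:E).
  apply/measurable_EFinP; apply: measurable_funX; apply: measurable_funB.
    exact: (measurableT_comp mf measurable_fst).
  exact: (measurableT_comp mf measurable_snd).
have sq0 (x y : R) : (0 <= ((x - y) ^+ 2)%:E)%E by rewrite lee_fin sqr_ge0.
have [x xoo] : exists x, (\int[P]_y ((f x - f y) ^+ 2)%:E < +oo)%E.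
  apply: contrapT => /forallNP H; move: foo.
  have : (\int[P]_x \int[P]_y ((f x - f y) ^+ 2)%:E = \int[P]__ +oo)%E.
    apply: eq_integral => x _; apply/eqP; rewrite eq_le leey/= leNgt.
    exact/negP/H.
  by move=> ->; rewrite integral_prob_cst.
have gx2 : (fun y => f x - f y) \in Lfun P 2%:E.
  apply/Lfun2P; split=> //; exact: measurable_funB.
apply/Lfun2P; split=> //.
have c2 : (cst (f x) : T -> R) \in Lfun P 2%:E by exact: Lfun_cst.
have : (cst (f x) - (fun y => f x - f y)) \in Lfun P 2%:E.
  by rewrite rpredB// ?lee1n.
have -> : cst (f x) - (fun y => f x - f y) = f.
  by apply/funext => y; rewrite /= -[LHS]/(f x - (f x - f y)); ring.
by case/Lfun2P.
Qed.

End pair_variance.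

Section gauss_covariance.
Context {R : realType}.
Local Notation RR := (measurableTypeR R).

(** Stated for pairs because square integrability of the coordinates is itself deduced from this
    value. *)
Lemma gauss_rV_coord_pair d (i : 'I_d) :
  (\int[@gauss_rV R d]_x \int[gauss_rV d]_y ((x ord0 i - y ord0 i) ^+ 2)%:E
   = 2%:E :> \bar R)%E.
Proof.
elim: d i => [[]//|d IH] i.
have mi (k : 'I_d.+1) := @measurable_rV_coord R _ k.
have sq0 (x y : R) : (0 <= ((x - y) ^+ 2)%:E)%E by rewrite lee_fin sqr_ge0.
have mx (r : R) : measurable_fun setT
    (fun y : 'rV[R]_d.+1 => ((r - y ord0 i) ^+ 2)%:E).
  by apply/measurable_EFinP; apply: measurable_funX; apply: measurable_funB.
have m2 : measurable_fun setT (fun w : 'rV[R]_d.+1 * 'rV[R]_d.+1 =>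
    ((w.1 ord0 i - w.2 ord0 i) ^+ 2)%:E).
  apply/measurable_EFinP; apply: measurable_funX; apply: measurable_funB.
    exact: (measurableT_comp (mi i) measurable_fst).
  exact: (measurableT_comp (mi i) measurable_snd).
rewrite -[gauss_rV d.+1]/(gauss_step (gauss_rV d)).
have m1 : measurable_fun setT (fun x : 'rV[R]_d.+1 =>
    \int[gauss_step (gauss_rV d)]_y ((x ord0 i - y ord0 i) ^+ 2)%:E)%E.
  exact: (measurable_ge0_integral_snd (gauss_step (gauss_rV d)) m2
    (fun w => sq0 _ _)).
rewrite (ge0_integral_gauss_step _ m1); last by move=> x; apply: integral_ge0.
have [j ij|i0] := unliftP ord0 i.
  rewrite -[RHS](integral_prob_cst (@std_normal R)) ?lee_fin//.
  apply: eq_integral => t _; rewrite -(IH j); apply: eq_integral => z _.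
  rewrite (ge0_integral_gauss_step _ (mx _))//.
  rewrite ij rV_consS.
  under eq_integral => s _.
    under eq_integral => y _ do rewrite rV_consS.
    over.
  by rewrite integral_prob_cst//; exact: integral_ge0.
rewrite -normal_sqr_diff; apply: eq_integral => t _.
have inner z : (\int[gauss_step (gauss_rV d)]_y
    (((rV_cons (t, z)) ord0 i - y ord0 i) ^+ 2)%:E =
    \int[@std_normal R]_s ((t - s) ^+ 2)%:E)%E.
  rewrite (ge0_integral_gauss_step _ (mx _))//; apply: eq_integral => s _.
  rewrite i0 rV_cons0.
  under eq_integral => y _ do rewrite rV_cons0.
  by rewrite integral_prob_cst.
under eq_integral => z _ do rewrite inner.
by rewrite integral_prob_cst//; exact: integral_ge0.
Qed.

End gauss_covariance.

Section linear_functionals.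
Context {R : realType} {d : nat}.
Implicit Types c : 'I_d -> R.

Definition linear_fun c (x : 'rV[R]_d) : R := \sum_i c i * x ord0 i.

Lemma linear_funE c : linear_fun c = fun x => \sum_i x ord0 i * c i.
Proof. by apply/funext => x; apply: eq_bigr => i _; rewrite mulrC. Qed.

Lemma partial_linear_fun c x :
  differentiable (linear_fun c) x /\ forall i, partial i (linear_fun c) x = c i.
Proof.
apply: (@quadratic_differentiable _ _ _ _ _ 0) => v _; rewrite mul0r.
rewrite [X in `|X|](_ : _ = 0) ?normr0// linear_funE -!sumrB big1// => i _.
by rewrite mxE; ring.
Qed.

Lemma Ck_linear_fun k c : Ck k (linear_fun c).
Proof.
apply: Ck_sum => i; apply: eq_Ck (CkM (Ck_cst k (c i)) (Ck_coord k i)).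
by [].
Qed.

Lemma sqnorm_grad_linear_fun c x : sqnorm_grad (linear_fun c) x = \sum_i c i ^+ 2.
Proof. by apply: eq_bigr => i _; rewrite (partial_linear_fun c x).2. Qed.

Lemma measurable_linear_fun c : measurable_fun setT (linear_fun c).
Proof. exact: Ck_measurable (Ck_linear_fun 0 c). Qed.

Local Notation gam := (@gauss_rV R d).

Lemma sum_delta (i : 'I_d) (F : 'I_d -> R) : \sum_k (k == i)%:R * F k = F i.
Proof.
by rewrite (bigD1 i)//= eqxx mul1r big1 ?addr0// => k /negbTE ->; rewrite mul0r.
Qed.

Let coord2 i : (fun x : 'rV[R]_d => x ord0 i) \in Lfun gam 2%:E.
Proof.
apply: Lfun2_pair; first exact: measurable_rV_coord.
by rewrite gauss_rV_coord_pair ltry.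
Qed.

Let rcov_diag i :
  rcov gam (fun x => x ord0 i) (fun x => x ord0 i) = 1.
Proof.
have := pair_rcov (coord2 i); rewrite gauss_rV_coord_pair => -[] /eqP.
by rewrite -{1}[2]mulr1 => /eqP /(mulfI _) <-//; rewrite pnatr_eq0.
Qed.

(** The gradient of a linear function is constant, so the Poincare inequality for pairs yields
    square integrability and the bound together. *)
Let rcov_linear_le c : linear_fun c \in Lfun gam 2%:E /\
  rcov gam (linear_fun c) (linear_fun c) <= \sum_i c i ^+ 2.
Proof.
have := gauss_rV_poincare (Ck_linear_fun 1 c).
under [X in (_ <= _ * X)%E]eq_integral do rewrite sqnorm_grad_linear_fun.
rewrite integral_prob_cst; last first.
  by rewrite lee_fin; apply: sumr_ge0 => i _; exact: sqr_ge0.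
move=> le; have L2 : linear_fun c \in Lfun gam 2%:E.
  apply: Lfun2_pair; first exact: measurable_linear_fun.
  by rewrite (le_lt_trans le)// -EFinM ltry.
split=> //; move: le; rewrite pair_rcov// -EFinM lee_fin ler_pM2l//.
Qed.

(* The covariance matrix has diagonal entries 1 and is bounded above by the
   identity, hence its off-diagonal entries vanish. *)
Let rcov_offdiag i j : i != j ->
  rcov gam (fun x => x ord0 i) (fun x => x ord0 j) = 0.
Proof.
move=> ij; set r := rcov _ _ _.
(* For e = 1 or -1, the linear function with coefficients delta_i + e delta_j has variance 2 + 2 e
   r, bounded by 2; both signs together force r = 0. *)
suff H (e : R) : e ^+ 2 = 1 -> e * r <= 0.
  apply/eqP; rewrite eq_le; apply/andP; split.
    by have := H 1; rewrite expr1n mul1r => ->.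
  by rewrite -oppr_le0; have := H (-1); rewrite sqrrN expr1n mulN1r => ->.
move=> e2; pose c k : R := (k == i)%:R + e * (k == j)%:R.
have [L2 le] := rcov_linear_le c.
have cE (F : 'I_d -> R) : \sum_k c k * F k = F i + e * F j.
  rewrite -(sum_delta i F) -(sum_delta j F) mulr_sumr -big_split.
  by apply: eq_bigr => k _; rewrite /c /=; ring.
have ci : c i = 1 by rewrite /c eqxx (negbTE ij) mulr0 addr0.
have cj : c j = e by rewrite /c eqxx eq_sym (negbTE ij) mulr1 add0r.
have : rcov gam (linear_fun c) (linear_fun c) <= 2.
  apply: le_trans le _; under eq_bigr do rewrite expr2.
  by rewrite cE ci cj -expr2 e2; lra.
have [_ ->] := rcov_sumr c L2 coord2; rewrite cE.
have rc k : rcov gam (linear_fun c) (fun x => x ord0 k) =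
    rcov gam (fun x => x ord0 k) (fun x => x ord0 i) +
    e * rcov gam (fun x => x ord0 k) (fun x => x ord0 j).
  by rewrite rcovC; have [_ ->] := rcov_sumr c (coord2 k) coord2; rewrite cE.
have rji : rcov gam (fun x => x ord0 j) (fun x => x ord0 i) = r by rewrite rcovC.
rewrite !rc !rcov_diag rji -/r.
have -> : 1 + e * r + e * (r + e * 1) = 2 * (e * r) + 1 + e ^+ 2 by ring.
by rewrite e2; lra.
Qed.

Lemma gauss_rV_linear c : linear_fun c \in Lfun gam 2%:E /\
  rcov gam (linear_fun c) (linear_fun c) = \sum_i c i ^+ 2.
Proof.
have [L2 _] := rcov_linear_le c; split=> //.
have [_ ->] := rcov_sumr c L2 coord2; apply: eq_bigr => i _.
rewrite rcovC; have [_ ->] := rcov_sumr c (coord2 i) coord2.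
rewrite (bigD1 i)//= rcov_diag big1 => [|j ji]; first by ring.
by rewrite rcov_offdiag 1?eq_sym// mulr0.
Qed.

End linear_functionals.

(** * Gaussian laws *)

Section affine_change_of_variables.
Context {R : realType}.
Local Notation RR := (measurableTypeR R).

(** s times the image of Lebesgue measure under t |-> m + s t agrees with Lebesgue measure on
    half-open intervals, which determine it. *)
Lemma ge0_integral_lebesgue_affine (m s : R) (f : R -> \bar R) : 0 < s ->
  measurable_fun setT f -> (forall x, 0 <= f x)%E ->
  (\int[lebesgue_measure]_x f x =
   s%:E * \int[lebesgue_measure]_t f (m + s * t)%R)%E.
Proof.
move=> s0 mf f0; pose h (t : RR) : RR := m + s * t.
have mh : measurable_fun setT h.
  by apply: measurable_funD => //; exact: measurable_funM.
pose nu : {measure set RR -> \bar R} :=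
  mscale (NngNum (ltW s0)) (image_measure (@lebesgue_measure R) mh).
have nuE A : measurable A -> lebesgue_measure A = nu A.
  move=> mA; apply: lebesgue_measure_unique => //= _ [[a b]] _ <-.
  rewrite /= -[RHS]/(s%:E * lebesgue_measure (h @^-1` `]a, b]%classic))%E.
  have -> : h @^-1` `]a, b]%classic = `](a - m) / s, (b - m) / s]%classic.
    apply/seteqP; split=> t; rewrite /h /= !in_itv/= ltr_pdivrMr// ler_pdivlMr//;
      by rewrite mulrC ltrBlDl lerBrDl.
  rewrite !lebesgue_measure_itv/= !lte_fin ltr_pM2r ?invr_gt0// ltrD2r.
  case: ifP => _; last by rewrite mule0.
  by rewrite -!EFinB -EFinM; congr EFin; field; rewrite gt_eqF.
transitivity (\int[nu]_x f x)%E.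
  by apply: eq_measure_integral => A mA _; exact: nuE.
rewrite ge0_integral_mscale//; congr (_ * _)%E.
by rewrite (ge0_integral_pushforward mh).
Qed.

(** The substitution x = m + t / sqrt(a) contributes 1 / sqrt(a), and passing from exp(-t^2 / 2) to
    the normal density contributes the inverse of [normal_peak 1]. *)
Lemma ge0_integral_gaussian1 (a m : R) (f : R -> \bar R) : 0 < a ->
  measurable_fun setT f -> (forall x, 0 <= f x)%E ->
  (\int[lebesgue_measure]_x ((expR (- (a * (x - m) ^+ 2) / 2))%:E * f x) =
   ((Num.sqrt a * normal_peak 1)^-1)%:E *
     \int[@std_normal R]_t f (m + t / Num.sqrt a)%R)%E.
Proof.
move=> a0 mf f0; have s0 : 0 < (Num.sqrt a)^-1 by rewrite invr_gt0 sqrtr_gt0.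
have pk : 0 < @normal_peak R 1 by rewrite normal_peak_gt0// oner_neq0.
have mE : measurable_fun setT (fun x : R => (expR (- (a * (x - m) ^+ 2) / 2))%:E).
  apply/measurable_EFinP; apply: measurableT_comp => //.
  apply: measurable_funM => //; apply: measurableT_comp => //.
  apply: measurable_funM => //; apply: measurable_funX.
  exact: measurable_funB.
rewrite (ge0_integral_lebesgue_affine m s0); last 2 first.
- exact: emeasurable_funM.
- by move=> x; rewrite mule_ge0// lee_fin expR_ge0.
rewrite invfM EFinM -muleA; congr (_ * _)%E.
have mg : measurable_fun setT (fun t : R => f (m + t / Num.sqrt a)%R).
  apply: (measurableT_comp mf); apply: measurable_funD => //.
  exact: measurable_funM.
rewrite ge0_integral_std// -ge0_integralZl//; last 3 first.
- by apply: emeasurable_funM => //; apply/measurable_EFinP; exact: measurable_std_pdf.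
- by move=> x _; rewrite mule_ge0// lee_fin std_pdf_ge0.
- by rewrite lee_fin invr_ge0 ltW.
apply: eq_integral => t _; rewrite muleA -EFinM [_^-1 * t]mulrC.
congr (_%:E * _)%E; rewrite std_pdfE mulKf ?gt_eqF//.
congr expR; rewrite [m + _]addrC addrK exprMn exprVn sqr_sqrtr ?ltW//.
by field; rewrite gt_eqF.
Qed.

End affine_change_of_variables.

Section lebesgue_rV_step.
Context {R : realType} {d : nat}.
Local Notation RR := (measurableTypeR R).

(** The first coordinate is integrated innermost, in the order in which squares are completed. *)
Lemma ge0_integral_lebesgue_rVS (f : 'rV[R]_d.+1 -> \bar R) :
  measurable_fun setT f -> (forall x, 0 <= f x)%E ->
  (\int[lebesgue_rV d.+1]_x f x =
   \int[lebesgue_rV d]_z \int[lebesgue_measure]_t f (rV_cons (t, z)))%E.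
Proof.
move=> mf f0.
have mcons : measurable_fun setT (@rV_cons R d : RR * 'rV[R]_d -> 'rV[R]_d.+1).
  exact: measurable_rV_cons.
pose g (w : RR * 'rV[R]_d) : \bar R := f (rV_cons w).
have mg : measurable_fun setT g by exact: (measurableT_comp mf mcons).
have g0 w : (0 <= g w)%E by exact: f0.
transitivity (\int[(@lebesgue_measure R \x lebesgue_rV d)%E]_w g w)%E.
  exact: (ge0_integral_pushforward mcons).
rewrite (fubini_tonelli1 (m1 := @lebesgue_measure R) (m2 := lebesgue_rV d) g mg g0).
exact: (fubini_tonelli (m1 := @lebesgue_measure R) (m2 := lebesgue_rV d) g mg g0).
Qed.

End lebesgue_rV_step.

(** * Schur complements and the Cholesky factor of a Gaussian density *)

Section quadratic_forms.
Context {R : realType}.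

Definition qform d (M : 'M[R]_d) (u : 'rV[R]_d) : R := (u *m M *m u^T) ord0 ord0.

Lemma qformE d (M : 'M[R]_d) u :
  qform M u = \sum_j (\sum_i u ord0 i * M i j) * u ord0 j.
Proof. by rewrite /qform !mxE; apply: eq_bigr => j _; rewrite !mxE. Qed.

Lemma continuous_qform d (M : 'M[R]_d) : continuous (qform M).
Proof.
apply: (@Ck_continuous _ _ 0); apply: eq_Ck.
  by move=> u; rewrite qformE; reflexivity.
apply: Ck_sum => j; apply: CkM; last exact: Ck_coord.
apply: Ck_sum => i; apply: CkM; [exact: Ck_coord|exact: Ck_cst].
Qed.

Section schur.
Variables (d : nat) (M : 'M[R]_d.+1).
Hypothesis M_spd : spd M.

Let M' : 'M[R]_(1 + d) := M.
Let a : R := M ord0 ord0.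
Let b : 'rV[R]_d := ursubmx M'.
Let D : 'M[R]_d := drsubmx M'.

Definition schur_complement : 'M[R]_d := D - a^-1 *: (b^T *m b).

(** Its opposite is the value of t that minimizes the form at (t, u). *)
Definition schur_shift (u : 'rV[R]_d) : R := (u *m b^T) ord0 ord0 / a.

Let M'E : M' = block_mx a%:M b b^T D.
Proof.
have MT : M'^T = M' := M_spd.1.
rewrite -[LHS]submxK; congr block_mx; last by rewrite /b trmx_ursub MT.
by rewrite [LHS]mx11_scalar !mxE; congr (M' _ _)%:M; exact: val_inj.
Qed.

Let schur_qform0 (t : R) u : qform M (rV_cons (t, u)) =
  a * t ^+ 2 + 2 * t * (u *m b^T) ord0 ord0 + qform D u.
Proof.
have bu : (b *m u^T) ord0 ord0 = (u *m b^T) ord0 ord0.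
  by rewrite -[u *m b^T]trmxK trmx_mul trmxK [RHS]mxE.
transitivity ((row_mx t%:M u *m block_mx a%:M b b^T D *m
    (row_mx t%:M u)^T) ord0 ord0); first by rewrite -M'E.
rewrite /qform mul_row_block tr_row_mx mul_row_col.
have E (A B : 'M[R]_1) : (A + B) ord0 ord0 = A ord0 ord0 + B ord0 ord0.
  by rewrite mxE.
rewrite tr_scalar_mx !mulmxDl mul_mx_scalar !mul_scalar_mx mul_mx_scalar.
rewrite -scalemxAl !E.
have Z (c : R) (A : 'M[R]_1) : (c *: A) ord0 ord0 = c * A ord0 ord0.
  by rewrite mxE.
by rewrite !Z bu mxE eqxx mulr1n; ring.
Qed.

Lemma schur_diag_gt0 : 0 < a.
Proof.
have := M_spd.2 (rV_cons (1, 0)); rewrite -/(qform _ _) schur_qform0.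
rewrite mul0mx mxE mulr0 addr0 expr1n mulr1.
rewrite /qform !mul0mx mxE addr0; apply; apply/eqP => /rowP /(_ ord0).
by rewrite rV_cons0 mxE => /eqP; rewrite oner_eq0.
Qed.

Lemma schur_qform (t : R) u : qform M (rV_cons (t, u)) =
  a * (t + schur_shift u) ^+ 2 + qform schur_complement u.
Proof.
have -> : qform schur_complement u =
    qform D u - a^-1 * (u *m (b^T *m b) *m u^T) ord0 ord0.
  rewrite /qform /schur_complement mulmxBr mulmxBl -scalemxAr -scalemxAl.
  by rewrite [LHS]mxE; congr (_ + _); rewrite [LHS]mxE; congr (- _); rewrite [LHS]mxE.
rewrite schur_qform0 /schur_shift.
have -> : (u *m (b^T *m b) *m u^T) ord0 ord0 = (u *m b^T) ord0 ord0 ^+ 2.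
  rewrite mulmxA -mulmxA mxE big_ord1 -[b *m u^T]trmxK trmx_mul trmxK.
  by rewrite [X in _ * X]mxE expr2.
have := schur_diag_gt0; move=> a0.
by field; rewrite gt_eqF.
Qed.

Lemma schur_complement_spd : spd schur_complement.
Proof.
have MT : M'^T = M' := M_spd.1.
split=> [|u u0].
  rewrite /schur_complement linearB /= linearZ /= trmx_mul trmxK.
  by rewrite /D trmx_drsub MT.
rewrite -/(qform _ _).
(* At this first coordinate the square vanishes, and the form of M reduces to that of the
   complement. *)
have := M_spd.2 (rV_cons (- schur_shift u, u)); rewrite -/(qform _ _) schur_qform.
rewrite addNr expr0n mulr0 add0r; apply; apply/eqP => uE.
case/eqP: u0; apply/rowP => i; have /rowP/(_ (lift ord0 i)) := uE.
by rewrite rV_consS !mxE.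
Qed.

End schur.

Lemma measurable_qform d (M : 'M[R]_d) : measurable_fun setT (qform M).
Proof. by apply: continuous_measurable_rV; exact: continuous_qform. Qed.

End quadratic_forms.

Section gaussian_integral.
Context {R : realType}.
Local Notation RR := (measurableTypeR R).

Lemma measurable_affine d n (a : 'rV[R]_n) (A : 'M[R]_(d, n)) :
  measurable_fun setT (fun z => a + z *m A).
Proof.
apply: measurable_fun_rV => i.
apply: (eq_measurable_fun (fun z => a ord0 i + linear_fun (A^~ i) z)) => [z _|].
  by rewrite !mxE; congr (_ + _); apply: eq_bigr => j _; rewrite mulrC.
by apply: measurable_funD => //; exact: measurable_linear_fun.
Qed.

Lemma measurable_subr_rV d (a : 'rV[R]_d) :
  measurable_fun setT (fun x : 'rV[R]_d => x - a).
Proof.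
apply: (eq_measurable_fun (fun x => - a + x *m 1%:M)) => [x _|].
  by rewrite mulmx1 addrC.
exact: measurable_affine.
Qed.

Lemma measurable_expR_qform d (M : 'M[R]_d) (a : 'rV[R]_d) :
  measurable_fun setT (fun x : 'rV[R]_d => (expR (- qform M (x - a) / 2))%:E).
Proof.
apply/measurable_EFinP; apply: measurableT_comp => //.
apply: measurable_funM => //; apply: measurable_funN.
exact: (measurableT_comp (measurable_qform M) (measurable_subr_rV a)).
Qed.

Lemma rV_consE d (x : 'rV[R]_d.+1) :
  exists t z, x = rV_cons (t, z).
Proof.
exists (x ord0 ord0), (\row_i x ord0 (lift ord0 i)).
apply/rowP => i; have [j ->|->] := unliftP ord0 i.
  by rewrite rV_consS mxE.
by rewrite rV_cons0.
Qed.

Lemma rV_consD d (t s : R) (z w : 'rV[R]_d) :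
  rV_cons (t, z) + rV_cons (s, w) = rV_cons (t + s, z + w).
Proof.
apply/rowP => i; rewrite [LHS]mxE; have [j ->|->] := unliftP ord0 i.
  by rewrite !rV_consS mxE.
by rewrite !rV_cons0.
Qed.

Lemma rV_consB d (t s : R) (z w : 'rV[R]_d) :
  rV_cons (t, z) - rV_cons (s, w) = rV_cons (t - s, z - w).
Proof. by apply/eqP; rewrite subr_eq rV_consD !subrK. Qed.

Lemma measurable_schur_shift d (M : 'M[R]_d.+1) :
  measurable_fun setT (schur_shift M).
Proof.
apply: measurable_funM => //.
apply: (eq_measurable_fun (linear_fun (fun i =>
  ursubmx (M : 'M[R]_(1 + d)) ord0 i))) => [z _|].
  by rewrite mxE; apply: eq_bigr => j _; rewrite mulrC [in RHS]mxE.
exact: measurable_linear_fun.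
Qed.

(* The Cholesky factor A is built by completing the square in the first
   variable. *)
Lemma gaussian_integral d (M : 'M[R]_d) : spd M ->
  exists (A : 'M[R]_d) (c : R),
    (forall z, qform M (z *m A) = \sum_i z ord0 i ^+ 2) /\
    forall (mu : 'rV[R]_d) (f : 'rV[R]_d -> \bar R),
      measurable_fun setT f -> (forall x, 0 <= f x)%E ->
    (\int[lebesgue_rV d]_x ((expR (- qform M (x - mu) / 2))%:E * f x) =
     c%:E * \int[gauss_rV d]_z f (mu + z *m A)%R)%E.
Proof.
elim: d M => [|d IH] M M_spd.
  exists 0, 1; split=> [z|mu f mf f0].
    by rewrite big_ord0 /qform mulmx0 mul0mx mul0mx mxE.
  have mg : measurable_fun setT
      (fun x : 'rV[R]_0 => ((expR (- qform M (x - mu) / 2))%:E * f x)%E).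
    by apply: emeasurable_funM => //; exact: measurable_expR_qform.
  rewrite /= !integral_dirac//; last exact: (measurableT_comp mf (measurable_affine _ _)).
  rewrite !diracT !mul1e [0 - mu]thinmx0 [mu + _]thinmx0.
  by rewrite /qform !mul0mx mxE oppr0 mul0r expR0 mul1e.
have a0 := schur_diag_gt0 M_spd.
have [A' [c' [A'E H]]] := IH _ (schur_complement_spd M_spd).
set a := M ord0 ord0 in a0; set S := schur_complement M in A'E H.
pose b := ursubmx (M : 'M[R]_(1 + d)).
(* Chosen so that (t, z) A has first entry t / sqrt(a) minus the shift at z A': the shift cancels in
   the completed square, which leaves t^2. *)
pose A : 'M[R]_d.+1 := block_mx (Num.sqrt a)^-1%:M 0
  (- (a^-1 *: (A' *m b^T))) A' : 'M[R]_(1 + d).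
have AE t (z : 'rV[R]_d) : rV_cons (t, z) *m A =
    rV_cons (t / Num.sqrt a - schur_shift M (z *m A'), z *m A').
  transitivity (row_mx t%:M z *m block_mx (Num.sqrt a)^-1%:M 0
    (- (a^-1 *: (A' *m b^T))) A') => //.
  rewrite mul_row_block mulmx0 add0r /rV_cons /=; congr (@row_mx _ 1 1 d _ _).
  rewrite -scalar_mxM mulmxN -scalemxAr mulmxA [_ *m b^T]mx11_scalar.
  by rewrite scale_scalar_mx -raddfB /= [_^-1 * _]mulrC.
exists A, ((Num.sqrt a * normal_peak 1)^-1 * c'); split=> [x|mu f mf f0].
  have [t [z ->]] := rV_consE x.
  rewrite AE schur_qform// A'E subrK big_ord_recl rV_cons0; congr (_ + _).
    by rewrite exprMn exprVn sqr_sqrtr ?ltW// mulrC -mulrA mulVf ?mulr1// gt_eqF.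
  by apply: eq_bigr => i _; rewrite rV_consS.
have [mu0 [mu' muE]] := rV_consE mu.
rewrite ge0_integral_lebesgue_rVS; last 2 first.
- by apply: emeasurable_funM => //; exact: measurable_expR_qform.
- by move=> x; rewrite mule_ge0// lee_fin expR_ge0.
set c0 := (Num.sqrt a * _)^-1.
have c00 : 0 <= c0.
  by rewrite invr_ge0 mulr_ge0 ?sqrtr_ge0// normal_peak_ge0.
(* Given the other coordinates x', the first one is normal with mean [m x'] and variance 1 / a. *)
pose m x' := mu0 - schur_shift M (x' - mu').
pose g (w : 'rV[R]_d * RR) : \bar R :=
  f (rV_cons (m w.1 + w.2 / Num.sqrt a, w.1)).
have mg : measurable_fun setT g.
  apply: (measurableT_comp mf); apply: (measurableT_comp (@measurable_rV_cons R d)).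
  apply/measurable_fun_pairP; split=> /=; last exact: measurable_fst.
  apply: measurable_funD.
    apply: measurable_funB => //.
    apply: (measurableT_comp (measurable_schur_shift M)).
    exact: (measurableT_comp (measurable_subr_rV mu') measurable_fst).
  by apply: measurable_funM => //; exact: measurable_snd.
pose G x' : \bar R := (\int[@std_normal R]_t g (x', t))%E.
have mG : measurable_fun setT G.
  exact: (measurable_ge0_integral_snd (@std_normal R) mg (fun w => f0 _)).
have G0 x' : (0 <= G x')%E by apply: integral_ge0 => t _; exact: f0.
transitivity (\int[lebesgue_rV d]_x'
    ((expR (- qform S (x' - mu') / 2))%:E * (c0%:E * G x')))%E.
  apply: eq_integral => x' _.
  have mfx : measurable_fun setT (fun t : RR => f (rV_cons (t, x'))).
    exact: (measurableT_comp mf (measurableT_comp (@measurable_rV_cons R d)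
      (pair2_measurable x'))).
  have mfe : measurable_fun setT (fun t : RR =>
      ((expR (- (a * (t - m x') ^+ 2) / 2))%:E * f (rV_cons (t, x')))%E).
    apply: emeasurable_funM => //; apply/measurable_EFinP.
    apply: measurableT_comp => //; apply: measurable_funM => //.
    apply: measurable_funN; apply: measurable_funM => //.
    by apply: measurable_funX; apply: measurable_funB.
  transitivity (\int[lebesgue_measure]_t ((expR (- qform S (x' - mu') / 2))%:E *
      ((expR (- (a * (t - m x') ^+ 2) / 2))%:E * f (rV_cons (t, x')))))%E.
    apply: eq_integral => t _; rewrite muE rV_consB (schur_qform M_spd) -/a -/S.
    rewrite muleA -EFinM -expRD; congr ((expR _)%:E * _)%E.
    by rewrite /m; ring.
  rewrite ge0_integralZl//; last first.
    by move=> t _; rewrite mule_ge0// lee_fin expR_ge0.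
  by congr (_ * _)%E; exact: (ge0_integral_gaussian1 _ a0 mfx).
rewrite H; last 2 first.
- exact: measurable_funeM.
- by move=> x; rewrite mule_ge0// lee_fin.
have mGA : measurable_fun setT (fun z => G (mu' + z *m A')).
  exact: (measurableT_comp mG (measurable_affine _ _)).
rewrite ge0_integralZl// EFinM muleA [(c'%:E * _)%E]muleC; congr (_ * _)%E.
pose h (w : RR * 'rV[R]_d) : \bar R := f (mu + rV_cons w *m A).
have mh : measurable_fun setT h.
  exact: (measurableT_comp (measurableT_comp mf (measurable_affine mu A))
    (@measurable_rV_cons R d)).
transitivity (\int[@std_normal R]_t \int[gauss_rV d]_z h (t, z))%E; last first.
  apply/esym.
  apply: (ge0_integral_gauss_step (gauss_rV d)
    (f := fun z => f (mu + z *m A))) => //.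
  exact: (measurableT_comp mf (measurable_affine _ _)).
rewrite (ge0_integral_swap (@std_normal R) (gauss_rV d) mh (fun w => f0 _)).
apply: eq_integral => z _; apply: eq_integral => t _.
rewrite /g /h AE muE rV_consD /m /= [mu' + _ - _]addrC addKr.
by congr (f (rV_cons (_, _))); ring.
Qed.

End gaussian_integral.

Section gaussian_law.
Context {R : realType}.

Lemma row_mxM_delta d (N : 'M[R]_d) i j :
  ((delta_mx ord0 i : 'rV[R]_d) *m N *m (delta_mx ord0 j : 'rV[R]_d)^T) ord0 ord0 = N i j.
Proof. by rewrite trmx_delta -rowE -colE !mxE. Qed.

Lemma qform_bilinear d (N : 'M[R]_d) u w : N^T = N ->
  qform N (u + w) = qform N u + qform N w + 2 * (u *m N *m w^T) ord0 ord0.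
Proof.
move=> NT.
have E : (w *m N *m u^T) ord0 ord0 = (u *m N *m w^T) ord0 ord0.
  have -> : u *m N *m w^T = (w *m N *m u^T)^T.
    by rewrite !trmx_mul trmxK NT mulmxA.
  by rewrite [RHS]mxE.
have D (A B : 'M[R]_1) : (A + B) ord0 ord0 = A ord0 ord0 + B ord0 ord0.
  by rewrite mxE.
rewrite /qform linearD /= mulmxDr !mulmxDl !D E; ring.
Qed.

(** Polarization at pairs of basis vectors recovers the entries of N. *)
Lemma qform_eq_sqr d (N : 'M[R]_d) : N^T = N ->
  (forall z, qform N z = \sum_i z ord0 i ^+ 2) -> N = 1%:M.
Proof.
move=> NT NE; apply/matrixP => i j; rewrite -[LHS]row_mxM_delta.
rewrite -[RHS]row_mxM_delta.
have N1 z : qform 1%:M z = \sum_i z ord0 i ^+ 2.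
  by rewrite /qform mulmx1 row_mul_trE.
have := qform_bilinear (delta_mx ord0 i) (delta_mx ord0 j) NT.
by rewrite !NE -!N1 (qform_bilinear _ _ (trmx1 _ _)) => /addrI /mulfI -> //.
Qed.

Lemma spd_unitmx d (M : 'M[R]_d) : spd M -> M \in unitmx.
Proof.
move=> [_ M0]; rewrite unitmxE unitfE; apply/negP => /det0P[v v0 vM].
by have := M0 v v0; rewrite vM mul0mx mxE ltxx.
Qed.

Lemma spd_invmx d (M : 'M[R]_d) : spd M -> spd (invmx M).
Proof.
move=> sM; have uM := spd_unitmx sM; have [MT M0] := sM.
split=> [|v v0]; first by rewrite trmx_inv MT.
have := M0 (v *m invmx M); rewrite trmx_mul trmx_inv MT !mulmxA mulmxKV//.
by apply; apply: contraNneq v0 => E; rewrite -[v](mulmxKV uM) E mul0mx.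
Qed.

(** The Cholesky factor of the inverse satisfies A Sigma^-1 A^T = 1, hence A^T A = Sigma. The
    product [k * c] of the two normalizing constants equals 1 because both laws have mass 1. *)
Lemma gaussian_law d (p : {measure set 'rV[R]_d -> \bar R}) mu Sigma :
  p setT = 1%E -> is_gaussian p mu Sigma ->
  exists A : 'M[R]_d, A^T *m A = Sigma /\
    forall f : 'rV[R]_d -> \bar R,
      measurable_fun setT f -> (forall x, 0 <= f x)%E ->
    (\int[p]_x f x = \int[gauss_rV d]_z f (mu + z *m A)%R)%E.
Proof.
move=> p1 [sS [mq q0 pE]]; have uS := spd_unitmx sS.
have sM := spd_invmx sS.
have [A [c [AE cE]]] := gaussian_integral sM.
exists A; split.
  have N1 : A *m invmx Sigma *m A^T = 1%:M.
    apply: qform_eq_sqr => [|z]; first by rewrite !trmx_mul trmxK sM.1 mulmxA.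
    by rewrite -AE /qform trmx_mul !mulmxA.
  have : invmx Sigma *m A^T *m A = 1%:M by apply: mulmx1C; rewrite mulmxA.
  by rewrite -mulmxA => /(congr1 (mulmx Sigma)); rewrite mulKVmx// mulmx1.
pose k := (Num.sqrt ((2 * pi) ^+ d * \det Sigma))^-1.
have k0 : 0 <= k by rewrite invr_ge0 sqrtr_ge0.
have H (f : 'rV[R]_d -> \bar R) : measurable_fun setT f -> (forall x, 0 <= f x)%E ->
    (\int[p]_x f x = (k * c)%:E * \int[gauss_rV d]_z f (mu + z *m A)%R)%E.
  move=> mf f0; rewrite (integral_density mq q0 pE f0 mf).
  rewrite EFinM -muleA -cE// -ge0_integralZl//; last 2 first.
  - by apply: emeasurable_funM => //; exact: measurable_expR_qform.
  - by move=> x _; rewrite mule_ge0// lee_fin expR_ge0.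
  by apply: eq_integral => x _; rewrite /gaussian_pdf EFinM -muleA.
have kc : k * c = 1.
  have := H (cst 1%E) (measurable_cst _) (fun=> lee01).
  rewrite integral_prob_cst// integral_cst// mul1e [LHS]p1 mule1.
  by move=> [].
by move=> f mf f0; rewrite H// kc mul1e.
Qed.

End gaussian_law.

(** * The largest eigenvalue as the maximum of the quadratic form *)

Section rayleigh.
Context {R : realType} {d : nat}.
Variable S : 'M[R]_d.
Hypothesis d_gt0 : (0 < d)%N.
Hypothesis S_spd : spd S.

Local Notation sqn v := (\sum_i (v : 'rV[R]_d) ord0 i ^+ 2).

Let qS : 'rV[R]_d -> R := qform S.

Lemma qformZ (N : 'M[R]_d) c w : qform N (c *: w) = c ^+ 2 * qform N w.
Proof.
rewrite /qform linearZ /= -scalemxAr -!scalemxAl scalerA -expr2.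
by rewrite [LHS]mxE.
Qed.

Lemma sqn_gt0 (v : 'rV[R]_d) : v != 0 -> 0 < sqn v.
Proof.
move=> v0; rewrite lt_neqAle eq_sym sumr_ge0 ?andbT => [|i _]; last exact: sqr_ge0.
apply: contra v0; rewrite psumr_eq0 => [/allP h|i _]; last exact: sqr_ge0.
apply/eqP/rowP => i; rewrite mxE; apply/eqP; rewrite -sqrf_eq0.
by have := h i (mem_index_enum _); rewrite implyTb.
Qed.

Let sphere := [set v : 'rV[R]_d | sqn v = 1].

Let sphere_compact : compact sphere.
Proof.
apply: bounded_closed_compact.
  exists 1; split=> // M M1 v v1 /=; rewrite /Num.norm/= mx_normrE.
  apply: bigmax_le => [|[i j] _ /=]; first exact: ltW (lt_trans ltr01 M1).
  rewrite ord1 (le_trans _ (ltW M1))// -[leRHS](@normr1 R) -ler_sqr ?nnegrE//.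
  rewrite !real_normK ?num_real// expr1n -v1 (bigD1 j)//= lerDl sumr_ge0// => k _.
  exact: sqr_ge0.
have -> : sphere = (fun v => sqn v) @^-1` [set 1] by [].
apply: closed_comp => [v _|]; last exact: closed_eq.
apply: (@Ck_continuous _ _ 0); apply: Ck_sum => i.
by apply: eq_Ck (CkM (Ck_coord 0 i) (Ck_coord 0 i)) => x; rewrite expr2.
Qed.

(* The maximum of the form over the unit sphere is attained at some v, and v is
   in the kernel of the nonnegative form lam |.|^2 - qS. *)
Let rayleigh_max : exists2 v : 'rV[R]_d, v != 0 &
  exists lam, v *m S = lam *: v /\ forall w, qS w <= lam * sqn w.
Proof.
have S0 : sphere !=set0.
  exists (delta_mx ord0 (Ordinal d_gt0)); rewrite /sphere /= (bigD1 (Ordinal d_gt0))//=.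
  rewrite mxE !eqxx expr1n big1 ?addr0// => i /negbTE i0.
  by rewrite mxE i0 andbF expr0n.
have [|v] := EVT_max_rV S0 sphere_compact (f := qS).
  exact/continuous_subspaceT/continuous_qform.
rewrite inE => v1 vmax; pose lam := qS v.
have le w : qS w <= lam * sqn w.
  have [->|w0] := eqVneq w 0.
    rewrite big1 ?mulr0 /qS /qform ?mul0mx ?mxE// => i _.
    by rewrite mxE expr0n.
  have n0 := sqn_gt0 w0; have nge0 := ltW n0.
  have := vmax ((Num.sqrt (sqn w))^-1 *: w); rewrite inE /sphere /=.
  have -> : sqn ((Num.sqrt (sqn w))^-1 *: w) = 1.
    under eq_bigr do rewrite mxE exprMn.
    by rewrite -mulr_sumr exprVn sqr_sqrtr// mulVf// gt_eqF.
  move=> /(_ erefl); rewrite /qS qformZ exprVn sqr_sqrtr//.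
  by rewrite ler_pdivrMl// mulrC.
exists v.
  apply/eqP => v0; move: v1; rewrite /sphere /= v0 big1 => [/eqP|i _].
    by rewrite eq_sym oner_eq0.
  by rewrite mxE expr0n.
exists lam; split=> //; apply/esym/eqP; rewrite -subr_eq0; apply/negPn/negP.
pose N := lam%:M - S.
have -> : lam *: v - v *m S = v *m N by rewrite mulmxBr mul_mx_scalar.
move=> u0; set u := v *m N in u0.
have NT : N^T = N by rewrite /N linearB /= tr_scalar_mx S_spd.1.
have NE w : qform N w = lam * sqn w - qS w.
  rewrite /qform /N mulmxBr mulmxBl mxE mul_mx_scalar -scalemxAl mxE row_mul_trE.
  by congr (_ + _); rewrite mxE.
have N0 w : 0 <= qform N w by rewrite NE subr_ge0.
pose c := sqn u; have c0 : 0 < c by exact: sqn_gt0.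
pose q := qform N u; have q1 : 0 < q + 1 by rewrite ltr_wpDl// N0.
(* If u = v N were nonzero, a small move from v against u would make the form of N negative; q + 1
   in the step size avoids a vanishing denominator. *)
have := N0 (v + (- (c / (q + 1))) *: u).
rewrite qform_bilinear// qformZ NE v1 mulr1 subrr add0r -/q.
rewrite [(_ *: u)^T]linearZ /= -scalemxAr -/u mxE row_mul_trE -/c.
have -> : (- (c / (q + 1))) ^+ 2 * q + 2 * (- (c / (q + 1)) * c) =
    - (c ^+ 2 * (q + 2) / (q + 1) ^+ 2) by field; rewrite gt_eqF.
rewrite oppr_ge0 leNgt divr_gt0// ?mulr_gt0 ?exprn_gt0//.
by rewrite ltr_wpDl// N0.
Qed.

(** Every eigenvalue is a Rayleigh quotient, hence at most the maximum of the form on the sphere;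
    that maximum is itself an eigenvalue, so it is the supremum. *)
Lemma lambda_maxP : exists2 v : 'rV[R]_d, v != 0 &
  [/\ v *m S = lambda_max S *: v,
      forall w, qform S w <= lambda_max S * sqn w & 0 < lambda_max S].
Proof.
have [v v0 [lam [vS le]]] := rayleigh_max.
have qE a w : w *m S = a *: w -> qS w = a * sqn w.
  by move=> wS; rewrite /qS /qform wS -scalemxAl mxE row_mul_trE.
have lamE : lambda_max S = lam.
  have ub : ubound [set a | eigenvalue S a] lam.
    move=> a /= /eigenvalueP[w wS w0].
    by rewrite -(ler_pM2r (sqn_gt0 w0)) -(qE _ _ wS).
  have mem : [set a | eigenvalue S a] lam by apply/eigenvalueP; exists v.
  apply/eqP; rewrite eq_le; apply/andP; split.
    by apply: ge_sup => //; exists lam.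
  by apply: ub_le_sup => //; exists lam.
exists v => //; rewrite lamE; split=> //.
by have := S_spd.2 v v0; rewrite -/(qform _ _) -/(qS _) (qE _ _ vS) pmulr_lgt0// sqn_gt0.
Qed.

End rayleigh.

(** * Linear functions and the Poincare inequality under a Gaussian law *)

Section gaussian_poincare.
Context {R : realType} {d : nat}.
Variable p : probability 'rV[R]_d R.
Variables (mu : 'rV[R]_d) (S : 'M[R]_d).
Hypothesis p_gaussian : is_gaussian p mu S.

Lemma gaussian_law_pair : exists A : 'M[R]_d, A^T *m A = S /\
  (forall f : 'rV[R]_d -> \bar R,
      measurable_fun setT f -> (forall x, 0 <= f x)%E ->
    (\int[p]_x f x = \int[gauss_rV d]_z f (mu + z *m A)%R)%E) /\
  (forall f : 'rV[R]_d -> R, measurable_fun setT f ->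
    (\int[p]_x \int[p]_y ((f x - f y) ^+ 2)%:E =
     \int[gauss_rV d]_z \int[gauss_rV d]_u
       ((f (mu + z *m A) - f (mu + u *m A)) ^+ 2)%:E)%E).
Proof.
have [A [AS H]] := gaussian_law (probability_setT p) p_gaussian.
exists A; split=> //; split=> // f mf.
have sq0 (x y : R) : (0 <= ((x - y) ^+ 2)%:E)%E by rewrite lee_fin sqr_ge0.
have m2 : measurable_fun setT (fun z : 'rV[R]_d * 'rV[R]_d =>
    ((f z.1 - f z.2) ^+ 2)%:E).
  apply/measurable_EFinP; apply: measurable_funX; apply: measurable_funB.
    exact: (measurableT_comp mf measurable_fst).
  exact: (measurableT_comp mf measurable_snd).
rewrite H; last 2 first.
- exact: (measurable_ge0_integral_snd p m2 (fun z => sq0 _ _)).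
- by move=> x; apply: integral_ge0.
apply: eq_integral => z _.
apply: (H (fun y => ((f (mu + z *m A) - f y) ^+ 2)%:E)) => //.
apply/measurable_EFinP; apply: measurable_funX.
exact: measurable_funB.
Qed.

(** Along x = mu + z A the function is, up to a constant, linear in z with coefficients A c, and |A
    c|^2 is the form of S = A^T A at c. *)
Lemma gaussian_linear (c : 'I_d -> R) : linear_fun c \in Lfun p 2%:E /\
  rcov p (linear_fun c) (linear_fun c) = qform S (\row_i c i).
Proof.
have [A [AS [_ H]]] := gaussian_law_pair.
pose c' i := \sum_j A i j * c j.
have LE z : linear_fun c (mu + z *m A) = linear_fun c mu + linear_fun c' z.
  rewrite /linear_fun /c'.
  have -> : \sum_i (\sum_j A i j * c j) * z ord0 i = \sum_j c j * (z *m A) ord0 j.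
    under eq_bigr do rewrite mulr_suml.
    rewrite exchange_big; apply: eq_bigr => j _ /=; rewrite mxE mulr_sumr.
    by apply: eq_bigr => i _; ring.
  by rewrite -big_split; apply: eq_bigr => i _ /=; rewrite mxE mulrDr.
have [L2 Lc] := gauss_rV_linear c'.
have P : (\int[p]_x \int[p]_y ((linear_fun c x - linear_fun c y) ^+ 2)%:E =
    (2 * \sum_i c' i ^+ 2)%:E)%E.
  rewrite H; last exact: measurable_linear_fun.
  rewrite -Lc -(pair_rcov L2); apply: eq_integral => z _.
  apply: eq_integral => u _.
  by rewrite !LE; congr (_ ^+ 2)%:E; ring.
have p2 : linear_fun c \in Lfun p 2%:E.
  by apply: Lfun2_pair; [exact: measurable_linear_fun|rewrite P ltry].
split=> //; have := P; rewrite pair_rcov//.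
have n2 : (2 : R) != 0 by rewrite pnatr_eq0.
move=> -[] /(mulfI n2) ->.
rewrite /qform -AS mulmxA -mulmxA -[A *m _]trmxK trmx_mul trmxK.
rewrite row_mul_trE; apply: eq_bigr => i _; congr (_ ^+ 2).
by rewrite mxE; apply: eq_bigr => j _; rewrite !mxE mulrC.
Qed.

(** The gradient of z |-> f(mu + z A) is A grad f, whose squared norm is the form of S at grad f. *)
Lemma gaussian_poincare (lam : R) : 0 <= lam ->
  (forall w, qform S w <= lam * \sum_i w ord0 i ^+ 2) -> poincare p lam.
Proof.
move=> lam0 Sle f sf f2; have [A [AS [H1 H2]]] := gaussian_law_pair.
have C1 := sf 1%N; have mf := Lfun2_measurable f2.
have [F1 Fp] := Ck1_affine mu A C1.
have msq := measurable_sqnorm_grad C1.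
have le : (\int[p]_x \int[p]_y ((f x - f y) ^+ 2)%:E <=
    2%:E * (lam%:E * \int[p]_x (sqnorm_grad f x)%:E))%E.
  rewrite H2// (le_trans (gauss_rV_poincare F1))//.
  rewrite lee_pmul2l//.
  rewrite (H1 (EFin \o sqnorm_grad f)); last 2 first.
  - exact/measurable_EFinP.
  - by move=> x; rewrite lee_fin sqnorm_grad_ge0.
  have mA : measurable_fun setT (fun z => sqnorm_grad f (mu + z *m A)).
    exact: (measurableT_comp msq (measurable_affine _ _)).
  rewrite -ge0_integralZl//; last 2 first.
  - exact/measurable_EFinP.
  - by move=> x _; rewrite lee_fin sqnorm_grad_ge0.
  apply: ge0_le_integral => //.
  - by move=> x _; rewrite lee_fin sqnorm_grad_ge0.
  - by apply/measurable_EFinP; exact: measurable_sqnorm_grad.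
  - by apply/measurable_EFinP; exact: measurable_funM.
  move=> z _; rewrite -EFinM lee_fin.
  pose g : 'rV[R]_d := \row_j partial j f (mu + z *m A).
  have -> : sqnorm_grad f (mu + z *m A) = \sum_i g ord0 i ^+ 2.
    by apply: eq_bigr => i _; rewrite mxE.
  apply: le_trans (Sle g); rewrite /qform -AS mulmxA -mulmxA.
  rewrite -[A *m _]trmxK trmx_mul trmxK row_mul_trE.
  rewrite le_eqVlt; apply/orP; left; apply/eqP.
  apply: eq_bigr => i _; congr (_ ^+ 2).
  by rewrite Fp mxE; apply: eq_bigr => j _; rewrite !mxE mulrC.
by move: le; rewrite pair_rcov// variance_rcov// EFinM lee_pmul2l.
Qed.

End gaussian_poincare.

(** * Sharpness: pairs of functions that attain the correlation bound *)

Section rcov_constants.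
Context d (T : measurableType d) (R : realType) (P : probability T R).
Implicit Types f g : T -> R.

Lemma Rintegral_prob_cst (c : R) : \int[P]_x c = c.
Proof.
rewrite Rintegral_cst// [X in _ * fine X](_ : _ = 1%E) ?mulr1//.
exact: probability_setT.
Qed.

Lemma Lfun2_prob_cst (c : R) : (fun=> c) \in Lfun P 2%:E.
Proof. exact: (@Lfun2_bounded _ _ _ _ _ `|c|). Qed.

Lemma Lfun2_subr_cst f (c : R) :
  f \in Lfun P 2%:E -> (fun x => f x - c) \in Lfun P 2%:E.
Proof.
move=> f2; have c2 := Lfun2_prob_cst c.
by apply: rpredB => //; rewrite ?lee1n// => le12; exact: f2.
Qed.

Lemma Rintegral_subr_cst f (c : R) : P.-integrable setT (EFin \o f) ->
  \int[P]_x (f x - c) = \int[P]_x f x - c.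
Proof.
move=> fi; rewrite RintegralB ?Rintegral_prob_cst//.
exact: Lfun2_integrable (Lfun2_prob_cst c).
Qed.

Lemma rcov_subr_cst f g (c : R) : f \in Lfun P 2%:E -> g \in Lfun P 2%:E ->
  rcov P f (fun x => g x - c) = rcov P f g.
Proof.
move=> f2 g2; have fi := Lfun2_integrable f2.
rewrite /rcov (Rintegral_subr_cst _ (Lfun2_integrable g2)).
have -> : \int[P]_x (f x * (g x - c)) = \int[P]_x (f x * g x) - \int[P]_x f x * c.
  under eq_Rintegral do rewrite mulrBr.
  rewrite RintegralB ?RintegralZr//; first exact: Lfun2_integrableM.
  exact: Lfun2_integrableM (Lfun2_prob_cst c).
by ring.
Qed.

Lemma rcov_ae_constant f : measurable_fun setT f -> ae_constant P f ->
  rcov P f f = 0.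
Proof.
move=> mf [c fc]; rewrite /rcov.
have -> : \int[P]_x f x = c.
  rewrite -[RHS]Rintegral_prob_cst /Rintegral; congr fine.
  apply: ae_eq_integral => //; first exact/measurable_EFinP.
  by apply: filterS fc => x /= -> _.
have -> : \int[P]_x (f x * f x) = c * c.
  rewrite -[RHS]Rintegral_prob_cst /Rintegral; congr fine.
  apply: ae_eq_integral => //; first exact/measurable_EFinP/measurable_funM.
  by apply: filterS fc => x /= -> _.
by rewrite subrr.
Qed.

End rcov_constants.

Section attained_correlation.
Context dO d1 d2 (Omega : measurableType dO) (T1 : measurableType d1)
  (T2 : measurableType d2) (R : realType) (Pr : probability Omega R).
Variables (X : {RV Pr >-> T1}) (Y : {RV Pr >-> T2}).
Variables (K : R.-pker T1 ~> T2) (Q : R.-pker T2 ~> T1).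
Hypothesis XYK : cond_law X Y K.
Hypothesis YXQ : cond_law Y X Q.
Variable p : probability T1 R.
Hypothesis X_law : forall A, measurable A -> distribution Pr X A = p A.
Variables (r : R) (f : T1 -> R) (g : T2 -> R).
Hypothesis f2 : f \in Lfun (distribution Pr X) 2%:E.
Hypothesis g2 : g \in Lfun (distribution Pr Y) 2%:E.
Hypothesis f_gt0 : 0 < rcov Pr (f \o X) (f \o X).
Hypothesis g_gt0 : 0 < rcov Pr (g \o Y) (g \o Y).
Hypothesis fgE : rcov Pr (f \o X) (g \o Y) ^+ 2 =
  r * (rcov Pr (f \o X) (f \o X) * rcov Pr (g \o Y) (g \o Y)).

Lemma rho_max2_ge : (r%:E <= rho_max2 X Y)%E.
Proof.
apply: ereal_sup_ubound; exists f, g; split=> //.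
- move=> /(rcov_ae_constant (Lfun2_measurable f2)) f0.
  by move: f_gt0; rewrite (rcov_distribution f2 f2) f0 ltxx.
- move=> /(rcov_ae_constant (Lfun2_measurable g2)) g0.
  by move: g_gt0; rewrite (rcov_distribution g2 g2) g0 ltxx.
rewrite corr_sqrE ?Lfun2_distribution// fgE mulfK//.
by rewrite mulf_neq0// gt_eqF.
Qed.

(** For h = f - E f one has Cov(f(X), g(Y)) = Cov(Qh(Y), g(Y)). Cauchy-Schwarz and the equality
    assumed of f and g give r Var(f(X)) <= Var(Qh(Y)), and the right side is <h, Ph>. *)
Lemma spectral_gap_le :
  (spectral_gap p (mkcomp_noparam K Q) <= (1 - r)%:E)%E.
Proof.
rewrite /spectral_gap EFinB leeB//.
pose c := \int[distribution Pr X]_x f x.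
pose h x := f x - c.
have h2 : h \in Lfun (distribution Pr X) 2%:E by exact: Lfun2_subr_cst.
have hp : h \in Lfun p 2%:E by exact: (eq_measure_Lfun2 X_law).
have h0 : \int[distribution Pr X]_x h x = 0.
  by rewrite (Rintegral_subr_cst _ (Lfun2_integrable f2)) subrr.
have hE u : u \in Lfun Pr 2%:E -> rcov Pr u (h \o X) = rcov Pr u (f \o X).
  by move=> u2; exact: (rcov_subr_cst c u2 (Lfun2_distribution f2)).
have hh : rcov Pr (h \o X) (h \o X) = rcov Pr (f \o X) (f \o X).
  rewrite hE ?Lfun2_distribution// rcovC hE//; exact: Lfun2_distribution.
have [e1 e2 e3] := rcov_composed_kernel YXQ h2 h0.
have Qh2 := Lfun2_kernel YXQ h2.
have V_gt0 : 0 < \int[distribution Pr X]_x (h x ^+ 2) by rewrite -e3 hh.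
pose s := (\int[p]_x (h x * kernel_op (mkcomp_noparam K Q) h x)) /
             (\int[p]_x (h x ^+ 2)).
apply: (@le_trans _ _ s%:E).
  rewrite lee_fin /s -!(eq_measure_Rintegral X_law).
  rewrite (Rintegral_composed_kernel XYK YXQ)// ler_pdivlMr//.
  rewrite -e2 -e3 hh -(ler_pM2r g_gt0) -mulrA -fgE.
  have -> : rcov Pr (f \o X) (g \o Y) =
      rcov Pr ((fun y => \int[Q y]_z h z) \o Y) (g \o Y).
    rewrite rcovC -hE ?Lfun2_distribution// (rcov_kernel YXQ g2 h2).
    by rewrite -(rcov_distribution g2 Qh2) rcovC.
  exact: rcov_sqr_le (Lfun2_distribution Qh2) (Lfun2_distribution g2).
apply: ereal_sup_ubound; exists h; split=> //.
- rewrite unlock -[LHS]fineK.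
    by rewrite -[fine _]/(\int[p]_x h x) -(eq_measure_Rintegral X_law) h0.
  exact/integrable_fin_num/Lfun2_integrable.
move=> ae0; have : ae_constant p h by exists 0.
move=> /(rcov_ae_constant (Lfun2_measurable hp)).
rewrite -(eq_measure_rcov X_law) -(rcov_distribution h2 h2) hh => E.
by move: f_gt0; rewrite E ltxx.
Qed.

End attained_correlation.

Section gaussian_channel_linear.
Context {R : realType} {d : nat} dO (Omega : measurableType dO).
Variables (alpha : R) (Pr : probability Omega R).
Variables (X0 XT : {RV Pr >-> 'rV[R]_d}) (K : R.-pker 'rV[R]_d ~> 'rV[R]_d).
Hypothesis alpha0 : 0 < alpha.
Hypothesis alpha1 : alpha < 1.
Hypothesis XT_given_X0 : cond_law X0 XT K.
Hypothesis K_gaussian : forall x,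
  is_gaussian (K x) (Num.sqrt alpha *: x) ((1 - alpha)%:M).
Variable c : 'I_d -> R.

Local Notation L := (linear_fun c).
Local Notation n := (\sum_i c i ^+ 2).

Let K_prob_gaussian x :
  is_gaussian (kernel_prob K x) (Num.sqrt alpha *: x) ((1 - alpha)%:M).
Proof. exact: K_gaussian. Qed.

Let coord2 x i : (fun y : 'rV[R]_d => y ord0 i) \in Lfun (kernel_prob K x) 2%:E.
Proof.
have [+ _] := gaussian_linear (K_prob_gaussian x) (fun j => (j == i)%:R).
have -> // : linear_fun (fun j => (j == i)%:R) = (fun y : 'rV[R]_d => y ord0 i).
by apply/funext => y; exact: sum_delta.
Qed.

(** Obtained from [exp_family_mean] by cancelling the factor sqrt(alpha) / (1 - alpha) between w and
    y. *)
Lemma gaussian_channel_coord x i :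
  \int[kernel_prob K x]_y y ord0 i = Num.sqrt alpha * x ord0 i.
Proof.
have s0 : 1 - alpha != 0 by rewrite gt_eqF// subr_gt0.
have a0 : Num.sqrt alpha != 0 by rewrite gt_eqF// sqrtr_gt0.
have b0 : Num.sqrt alpha / (1 - alpha) != 0 by rewrite mulf_neq0// invr_eq0.
have := exp_family_mean (measurable_scale_rV _) (K := kernel_prob K)
  (gaussian_channel_exp_family alpha0 alpha1 K_gaussian) i x.
under eq_Rintegral do rewrite mxE.
rewrite RintegralZl//; last exact: Lfun2_integrable (coord2 x i).
move=> E; apply: (mulfI b0); rewrite E -[X in X / _ * _](@sqr_sqrtr _ alpha) ?ltW//.
by rewrite expr2; ring.
Qed.

Lemma kernel_linear_fun x : [/\ L \in Lfun (kernel_prob K x) 2%:E,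
  \int[kernel_prob K x]_y L y = Num.sqrt alpha * L x &
  \int[kernel_prob K x]_y (L y * L y) = (1 - alpha) * n + alpha * L x ^+ 2].
Proof.
have [L2 LE] := gaussian_linear (K_prob_gaussian x) c.
have m : \int[kernel_prob K x]_y L y = Num.sqrt alpha * L x.
  rewrite /linear_fun (Rintegral_sum _).2; last first.
    move=> i; exact: (integrableZl measurableT (c i) (Lfun2_integrable (coord2 x i))).
  rewrite mulr_sumr; apply: eq_bigr => i _.
  rewrite RintegralZl//; last exact: Lfun2_integrable (coord2 x i).
  by rewrite gaussian_channel_coord mulrCA.
split=> //; apply/eqP; rewrite -subr_eq; apply/eqP; move: LE.
rewrite /rcov m -expr2 exprMn sqr_sqrtr ?ltW// => ->.
rewrite /qform mul_mx_scalar -scalemxAl mxE row_mul_trE; congr (_ * _).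
by apply: eq_bigr => i _; rewrite mxE.
Qed.

(** Law of total variance: given X_0, the variable L(X_T) has mean sqrt(alpha) L(X_0) and the
    constant variance (1 - alpha) |c|^2. *)
Lemma gaussian_channel_linear : L \in Lfun (distribution Pr X0) 2%:E ->
  let V := rcov Pr (L \o X0) (L \o X0) in
  [/\ L \in Lfun (distribution Pr XT) 2%:E,
      rcov Pr (L \o X0) (L \o XT) = Num.sqrt alpha * V &
      rcov Pr (L \o XT) (L \o XT) = (1 - alpha) * n + alpha * V].
Proof.
move=> L2 V; have mL := measurable_linear_fun c.
have iL := Lfun2_integrable L2; have iLL := Lfun2_integrableM L2 L2.
have L2X := Lfun2_distribution L2.
have h0 (z : 'rV[R]_d * 'rV[R]_d) : (0 <= (L z.2 ^+ 2)%:E)%E.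
  by rewrite lee_fin sqr_ge0.
have mh : measurable_fun setT (fun z : 'rV[R]_d * 'rV[R]_d => (L z.2 ^+ 2)%:E).
  apply/measurable_EFinP; apply: measurable_funX.
  exact: (measurableT_comp mL measurable_snd).
(* Extended-valued, since it is this identity that shows L to be square-integrable under the law of
   X_T. *)
have E2 : (\int[Pr]_w (L (XT w) ^+ 2)%:E =
    \int[distribution Pr X0]_x ((1 - alpha) * n + alpha * L x ^+ 2)%:E)%E.
  rewrite (cond_law_ge0_integral XT_given_X0 h0 mh).
  apply: eq_integral => x _; have [Lx2 _ <-] := kernel_linear_fun x.
  rewrite /Rintegral fineK; last first.
    by apply: integrable_fin_num => //; exact: (Lfun2_integrableM Lx2 Lx2).
  by apply: eq_integral => y _; rewrite expr2.
have icst : (distribution Pr X0).-integrable setT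
    (EFin \o (fun=> (1 - alpha) * n)).
  exact: Lfun2_integrable (Lfun2_prob_cst _ _).
have iQ : (distribution Pr X0).-integrable setT
    (EFin \o (fun x => (1 - alpha) * n + alpha * L x ^+ 2)).
  have -> : (fun x => (1 - alpha) * n + alpha * L x ^+ 2) =
      (fun x => (1 - alpha) * n + alpha * (L x * L x)).
    by apply/funext => x; rewrite expr2.
  exact: (integrableD measurableT icst (integrableZl measurableT alpha iLL)).
have LT2 : L \in Lfun (distribution Pr XT) 2%:E.
  apply/Lfun2P; split=> //; rewrite ge0_integral_distribution//; last 2 first.
  - by apply/measurable_EFinP; exact: measurable_funX.
  - by move=> y; rewrite lee_fin sqr_ge0.
  rewrite [X in (X < _)%E]E2.
  by rewrite ltey_eq; apply/orP; left; exact: integrable_fin_num.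
have KL : (fun x => \int[K x]_y L y) = (fun x => Num.sqrt alpha * L x).
  by apply/funext => x; have [_ + _] := kernel_linear_fun x.
have LT2X := Lfun2_distribution LT2.
have mean : \int[Pr]_w L (XT w) = Num.sqrt alpha * \int[Pr]_w L (X0 w).
  rewrite (Rintegral_kernel XT_given_X0 LT2) KL RintegralZl//.
  by rewrite Rintegral_distribution//; exact: Lfun2_integrable.
split=> //.
- rewrite (rcov_kernel XT_given_X0 L2 LT2) KL /V (rcov_distribution L2 L2) /rcov.
  rewrite RintegralZl//.
  have -> : \int[distribution Pr X0]_x (L x * (Num.sqrt alpha * L x)) =
      Num.sqrt alpha * \int[distribution Pr X0]_x (L x * L x).
    by rewrite -RintegralZl//; apply: eq_Rintegral => x _; ring.
  by ring.
have E3 : \int[Pr]_w (L (XT w) * L (XT w)) =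
    (1 - alpha) * n + alpha * \int[Pr]_w (L (X0 w) * L (X0 w)).
  transitivity (\int[distribution Pr X0]_x ((1 - alpha) * n + alpha * L x ^+ 2)).
    by rewrite /Rintegral -E2; under eq_integral do rewrite -expr2.
  under eq_Rintegral do rewrite expr2.
  rewrite RintegralD//; last exact: (integrableZl measurableT alpha iLL).
  rewrite Rintegral_prob_cst RintegralZl// Rintegral_distribution//.
    exact: measurable_funM.
  exact: (Lfun2_integrableM L2X L2X).
rewrite /V /rcov /= E3 mean.
have -> (m M : R) : alpha * (M - m * m) = alpha * M - Num.sqrt alpha ^+ 2 * m * m.
  by rewrite sqr_sqrtr ?ltW//; ring.
ring.
Qed.

End gaussian_channel_linear.

(** * The two bounds under a Poincare inequality, and equality for Gaussian targets *)

Theorem mainTheorem1 (R : realType) (d : nat) (d_gt0 : (0 < d)%N)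
    (p : probability 'rV[R]_d R) (q : 'rV[R]_d -> R)
    (p_density : has_density p q) (q_C1 : Ck 1 q)
    (T : R) (T_gt0 : 0 < T) (alpha : R) (alphaE : alpha = expR (- T))
    (dO : measure_display) (Omega : measurableType dO)
    (Pr : probability Omega R) (X0 XT : {RV Pr >-> 'rV[R]_d})
    (X0_law : forall A, measurable A -> distribution Pr X0 A = p A)
    (K : R.-pker 'rV[R]_d ~> 'rV[R]_d) (XT_given_X0 : cond_law X0 XT K)
    (K_gaussian : forall x,
      is_gaussian (K x) (Num.sqrt alpha *: x) ((1 - alpha)%:M))
    (Q : R.-pker 'rV[R]_d ~> 'rV[R]_d) (X0_given_XT : cond_law XT X0 Q) :
  let P := mkcomp_noparam K Q in
  (forall CP : R, poincare p CP ->
     (rho_max2 X0 XT <= (alpha * CP / (1 - alpha + alpha * CP))%:E)%E /\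
     (((1 - alpha) / (1 - alpha + alpha * CP))%:E <= spectral_gap p P)%E) /\
  (forall (mu : 'rV[R]_d) (Sigma : 'M[R]_d), is_gaussian p mu Sigma ->
     [/\ optimal_poincare p (lambda_max Sigma),
         rho_max2 X0 XT =
           (alpha * lambda_max Sigma /
             (1 - alpha + alpha * lambda_max Sigma))%:E &
         spectral_gap p P =
           ((1 - alpha) / (1 - alpha + alpha * lambda_max Sigma))%:E]).
Proof.
move=> P.
have alpha0 : 0 < alpha by rewrite alphaE expR_gt0.
have alpha1 : alpha < 1 by rewrite alphaE expR_lt1 oppr_lt0.
have s0 : 0 < 1 - alpha by rewrite subr_gt0.
have D0 C : 0 <= C -> 0 < 1 - alpha + alpha * C.
  by move=> C0; rewrite ltr_wpDr// mulr_ge0// ltW.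
have subE C : 0 <= C -> 1 - alpha * C / (1 - alpha + alpha * C) =
    (1 - alpha) / (1 - alpha + alpha * C).
  by move=> C0; field; rewrite gt_eqF// D0.
have upper CP : poincare p CP ->
    (rho_max2 X0 XT <= (alpha * CP / (1 - alpha + alpha * CP))%:E)%E /\
    (((1 - alpha) / (1 - alpha + alpha * CP))%:E <= spectral_gap p P)%E.
  move=> pCP; have CP0 := poincare_constant_ge0 d_gt0 p_density pCP.
  have r0 : 0 <= alpha * CP / (1 - alpha + alpha * CP).
    by rewrite divr_ge0 ?mulr_ge0// ltW// D0.
  have bound := gaussian_channel_correlation alpha0 alpha1 X0_law XT_given_X0
    K_gaussian pCP CP0.
  split; first exact: rho_max2_le bound.
  by rewrite -subE//; exact: (spectral_gap_ge XT_given_X0 X0_given_XT X0_law r0 bound).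
split=> // mu Sigma p_gaussian; have S_spd := p_gaussian.1.
have [v v0 [vS Sle lam0]] := lambda_maxP d_gt0 S_spd.
set lam := lambda_max Sigma in vS Sle lam0 *.
pose c i := v ord0 i; pose n := \sum_i c i ^+ 2.
have n0 : 0 < n by exact: sqn_gt0.
have p_poincare : poincare p lam by apply: (gaussian_poincare p_gaussian) => //; exact: ltW.
have [L2 LE] := gaussian_linear p_gaussian c.
have {}LE : rcov p (linear_fun c) (linear_fun c) = lam * n.
  rewrite LE (_ : \row_i c i = v); last by apply/rowP => i; rewrite mxE.
  by rewrite /qform vS -scalemxAl mxE row_mul_trE.
have L2X : linear_fun c \in Lfun (distribution Pr X0) 2%:E.
  by apply: (@eq_measure_Lfun2 _ _ _ p) => // A mA; exact/esym/X0_law.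
have VE : rcov Pr (linear_fun c \o X0) (linear_fun c \o X0) = lam * n.
  by rewrite (rcov_distribution L2X L2X) (eq_measure_rcov X0_law).
have [L2T] := gaussian_channel_linear alpha0 alpha1 XT_given_X0 K_gaussian L2X.
rewrite VE => XYE YYE.
have V0 : 0 < lam * n by exact: mulr_gt0.
(* Both sides equal alpha (lam n)^2. *)
have rE : rcov Pr (linear_fun c \o X0) (linear_fun c \o XT) ^+ 2 =
    alpha * lam / (1 - alpha + alpha * lam) *
    (rcov Pr (linear_fun c \o X0) (linear_fun c \o X0) *
     rcov Pr (linear_fun c \o XT) (linear_fun c \o XT)).
  rewrite XYE YYE VE exprMn sqr_sqrtr ?ltW// -/n.
  by field; rewrite gt_eqF// D0// ltW.
have V0' : 0 < rcov Pr (linear_fun c \o X0) (linear_fun c \o X0) by rewrite VE.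
have W0 : 0 < rcov Pr (linear_fun c \o XT) (linear_fun c \o XT).
  by rewrite YYE ltr_pwDl ?mulr_gt0// ltW// mulr_gt0.
have [le1 le2] := upper _ p_poincare.
split.
- split=> // C' pC'.
  (* The test function has variance lam n and constant energy n, which forces lam <= C'. *)
  have := pC' _ (fun k => Ck_linear_fun k c) L2.
  rewrite variance_rcov// LE.
  under eq_integral do rewrite sqnorm_grad_linear_fun.
  rewrite integral_prob_cst; last by rewrite lee_fin ltW.
  by rewrite -EFinM lee_fin ler_pM2r.
- apply/eqP; rewrite eq_le le1/=.
  exact: rho_max2_ge L2X L2T V0' W0 rE.
- apply/eqP; rewrite eq_le le2 andbT -(subE _ (ltW lam0)).
  exact: (spectral_gap_le XT_given_X0 X0_given_XT X0_law L2X L2T V0' W0 rE).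
Qed.
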